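(* Let $W_0$ be a uniform $k$-block graphon. The sequence $(\tilde{\mathbb P}_{kn,W_0})_{n\ge 1}$ obeys a large deviation principle in the space $\tilde{\mathcal W}$ (equipped with the cut metric $\delta_\square$) with speed $(kn)^2$ and rate function $J_{W_0}$. Explicitly: 1. For any open set $\tilde U\subseteq\tilde{\mathcal W}$, $\liminf_{n\to\infty}\frac{1}{(kn)^2}\log\tilde{\mathbb P}_{kn,W_0}(\tilde U)\ge-\inf_{\tilde h\in\tilde U}J_{W_0}(\tilde h)$. 2. For any closed set $\tilde F\subseteq\tilde{\mathcal W}$, $\limsup_{n\to\infty}\frac{1}{(kn)^2}\log\tilde{\mathbb P}_{kn,W_0}(\tilde F)\le-\inf_{\tilde h\in\tilde F}J_{W_0}(\tilde h)$. (The infimum over the empty set is $\infty$.)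
   Context: A graphon is a measurable function $f:[0,1]^2\to[0,1]$ with $f(x,y)=f(y,x)$; $\mathcal W$ is the set of graphons. The cut distance is $d_\square(f,g)=\sup_{S,T\subseteq[0,1]}\left|\int_{S\times T}(f-g)\,dx\,dy\right|$ over measurable $S,T$. The cut metric is $\delta_\square(f,g)=\inf_{\phi}d_\square(f,g^\phi)$ over bijective Lebesgue-measure-preserving maps $\phi:[0,1]\to[0,1]$, where $g^\phi(x,y)=g(\phi(x),\phi(y))$. Write $f\sim g$ if $\delta_\square(f,g)=0$, $\tilde f$ for the equivalence class of $f$, and $\tilde{\mathcal W}=\mathcal W/\!\sim$; $\delta_\square$ is well defined on classes (and between classes and graphons), and $(\tilde{\mathcal W},\delta_\square)$ carries its Borel $\sigma$-algebra. A uniform $k$-block graphon is a graphon $W_0=(p_{ij})_{i,j\in[k]}$ with $p_{ij}=p_{ji}\in[0,1]$ that takes the constant value $p_{ij}$ on $I_i\times I_j$, where $I_1=[0,1/k]$ and $I_j=((j-1)/k,j/k]$ for $j\ge 2$. Sampling: let $G$ be the random simple graph on vertex set $[kn]$ in which each pair $i\ne j$ is independently an edge with probability $W_0(i/(kn),j/(kn))=p_{\lceil i/n\rceil,\lceil j/n\rceil}$. For a graph $G$ on $[N]$, its empirical graphon $f^G$ equals $1$ at $(x,y)$ if $(\vartheta_N(x),\vartheta_N(y))$ is an edge and $0$ otherwise, where $\vartheta_N(x)=i$ for $\frac{i-1}{N}<x\le\frac iN$ and $\vartheta_N(0)=1$. $\mathbb P_{kn,W_0}$ is the law of $f^G$ on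 $\mathcal W$ and $\tilde{\mathbb P}_{kn,W_0}$ is the law of its class $\tilde f^G$ on $\tilde{\mathcal W}$. Let $h_p(u)=u\log\frac up+(1-u)\log\frac{1-u}{1-p}$ (with $0\log0=0$, $0\log(0/0)=0$, and value $+\infty$ when $p\in\{0,1\}$, $u\ne p$), and $I_{W_0}(f)=\frac12\int_{[0,1]^2}h_{W_0(x,y)}(f(x,y))\,dx\,dy$. Let $\Omega=\{(x,y):W_0(x,y)\in(0,1)\}$, let $\mathcal W_\Omega$ be the set of $f\in\mathcal W$ with $f=W_0$ almost everywhere on $\Omega^c$, and $\tilde{\mathcal W}_\Omega=\{\tilde f\in\tilde{\mathcal W}:\delta_\square(\tilde f,g)=0\text{ for some }g\in\mathcal W_\Omega\}$. The rate function is $J_{W_0}(\tilde f)=\sup_{\eta>0}\inf\{I_{W_0}(h):h\in\mathcal W,\ \delta_\square(\tilde f,h)\le\eta\}$ if $\tilde f\in\tilde{\mathcal W}_\Omega$, and $J_{W_0}(\tilde f)=\infty$ otherwise. *)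

(* Defs.v *)
From HB Require Import structures.
From mathcomp Require Import all_boot all_order all_algebra.
From mathcomp Require Import all_classical all_reals all_analysis.
From mathcomp Require Import measurable_realfun.
Set Implicit Arguments.
Unset Strict Implicit.
Unset Printing Implicit Defensive.
Import Order.TTheory GRing.Theory Num.Theory.
Import numFieldNormedType.Exports.
Local Open Scope classical_set_scope.
Local Open Scope ring_scope.

Notation mR := measurableTypeR.

Definition unit_itv (R : realType) : set (mR R) := `[0, 1].
Arguments unit_itv : clear implicits.

Definition unit_sq (R : realType) : set (mR R * mR R)%type :=
  unit_itv R `*` unit_itv R.
Arguments unit_sq : clear implicits.

Definition leb (R : realType) : {measure set (mR R) -> \bar R} :=
  lebesgue_measure.
Arguments leb : clear implicits.

Definition leb2 (R : realType) : {measure set (mR R * mR R)%type -> \bar R} :=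
  (@lebesgue_measure R \x @lebesgue_measure R)%E.
Arguments leb2 : clear implicits.

(* A graphon is encoded by a function on the plane of which only the
   restriction to the unit square matters; measurability is with respect to
   the Borel sigma-algebra. *)
Record graphon (R : realType) := Graphon {
  graphon_fun :> mR R * mR R -> mR R ;
  graphon_meas : measurable_fun (unit_sq R) graphon_fun ;
  graphon_itv : forall z, unit_sq R z -> 0 <= graphon_fun z <= 1 ;
  graphon_sym : forall x y, unit_sq R (x, y) ->
    graphon_fun (x, y) = graphon_fun (y, x) }.

Definition cut_dist (R : realType) (f g : mR R * mR R -> mR R) : R :=
  sup [set r : R | exists S T : set (mR R),
    [/\ measurable S, measurable T, S `<=` unit_itv R, T `<=` unit_itv R &
        r = `| \int[leb2 R]_(z in S `*` T) (f z - g z) |] ].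

Definition mp_bij (R : realType) (phi : mR R -> mR R) : Prop :=
  [/\ set_bij (unit_itv R) (unit_itv R) phi,
      measurable_fun (unit_itv R) phi &
      forall A : set (mR R), measurable A -> A `<=` unit_itv R ->
        leb R (unit_itv R `&` phi @^-1` A) = leb R A].

Definition cut_metric (R : realType) (f g : graphon R) : R :=
  inf [set cut_dist f (fun z => g (phi z.1, phi z.2)) | phi in @mp_bij R].

Definition graphon_sim (R : realType) (f g : graphon R) : Prop :=
  cut_metric f g = 0.

(* The points of the quotient space are the equivalence classes themselves. *)
Record graphon_class (R : realType) := GraphonClass {
  class_set :> set (graphon R) ;
  class_setP : exists f, class_set = [set g | graphon_sim f g] }.

Definition to_class (R : realType) (f : graphon R) : graphon_class R :=
  GraphonClass (ex_intro _ f erefl).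

(* The cut metric is constant on classes, so distances to a class are computed
   on a chosen representative. *)
Definition class_repr (R : realType) (C : graphon_class R) : graphon R :=
  projT1 (cid (class_setP C)).

Definition class_metric (R : realType) (C D : graphon_class R) : R :=
  cut_metric (class_repr C) (class_repr D).

Definition graphon0 (R : realType) : graphon R.
Proof.
apply: (@Graphon R (cst 0)) => [|z _|//]; first exact: measurable_cst.
by rewrite lexx ler01.
Defined.

Section class_topology.
Variable R : realType.

HB.instance Definition _ := gen_eqMixin (graphon_class R).
HB.instance Definition _ := gen_choiceMixin (graphon_class R).
HB.instance Definition _ :=
  isPointed.Build (graphon_class R) (to_class (graphon0 R)).

Definition class_open (U : set (graphon_class R)) : Prop :=
  forall C, U C -> exists2 e : R, 0 < e &
    forall D, class_metric C D < e -> U D.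

Lemma class_openT : class_open [set: graphon_class R].
Proof. by move=> C _; exists 1. Qed.

Lemma class_openI : setI_closed class_open.
Proof.
move=> U V oU oV C [/oU[d d0 dU] /oV[e e0 eV]].
exists (Num.min d e); first by rewrite lt_min d0.
by move=> D; rewrite lt_min => /andP[/dU ? /eV].
Qed.

Lemma class_open_bigU (I : Type) (F : I -> set (graphon_class R)) :
  (forall i, class_open (F i)) -> class_open (\bigcup_i F i).
Proof.
by move=> oF C [i _ /oF[e e0 eF]]; exists e => // D /eF FD; exists i.
Qed.

HB.instance Definition _ := isOpenTopological.Build (graphon_class R)
  class_openT class_openI class_open_bigU.

End class_topology.

Definition borel_class (R : realType) :=
  g_sigma_algebraType (@open (graphon_class R)).
HB.instance Definition _ (R : realType) := Measurable.on (borel_class R).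

(* The i-th of the N intervals that partition [0, 1], with i counted from 0. *)
Definition cell (R : realType) (N i : nat) : set (mR R) :=
  [set` if i == 0 then `[0, N%:R^-1] else `]i%:R / N%:R, i.+1%:R / N%:R]].
Arguments cell : clear implicits.

Definition uniform_block_graphon (R : realType) (k : nat) (W0 : graphon R) :=
  exists p : 'M[R]_k,
    [/\ forall i j, p i j = p j i,
        forall i j, 0 <= p i j <= 1 &
        forall (i j : 'I_k) x y,
          cell R k i x -> cell R k j y -> W0 (x, y) = p i j].

(* A simple graph on N vertices is a set of edges, the unordered pair of
   distinct vertices i and j being represented by (i, j) with i < j. *)
Definition edge (N : nat) := {e : 'I_N * 'I_N | (e.1 < e.2)%N}.

Definition sgraph (N : nat) : Type := {set edge N}.

Section sgraph.
Variable N : nat.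

HB.instance Definition _ := Finite.on (sgraph N).
HB.instance Definition _ := isPointed.Build (sgraph N) finset.set0.
HB.instance Definition _ := @isMeasurable.Build default_measure_display
  (sgraph N) discrete_measurable discrete_measurable0
  discrete_measurableC discrete_measurableU.

Definition adj (G : sgraph N) (i j : 'I_N) : bool :=
  [exists e : edge N, (e \in (G : {set edge N})) &&
    ((val e == (i, j)) || (val e == (j, i)))].

Lemma adj_sym (G : sgraph N) i j : adj G i j = adj G j i.
Proof. by apply: eq_existsb => e; rewrite orbC. Qed.

End sgraph.

Section empirical.
Variables (R : realType) (N : nat) (G : sgraph N).

Definition empirical_fun : mR R * mR R -> mR R :=
  \1_[set z | exists i j : 'I_N,
                [/\ cell R N i z.1, cell R N j z.2 & adj G i j]].

Lemma empirical_meas : measurable_fun (unit_sq R) empirical_fun.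
Proof.
apply: measurable_indic.
rewrite (_ : [set _ | _] = \bigcup_(ij in [set ij : 'I_N * 'I_N | adj G ij.1 ij.2])
    (cell R N ij.1 `*` cell R N ij.2)).
  apply: fin_bigcup_measurable => //.
  by move=> ij _; apply: measurableX; exact: measurable_itv.
apply/seteqP; split => [z [i [j [zi zj ij]]]|z [[i j] /= ij [zi zj]]].
  by exists (i, j).
by exists i, j.
Qed.

Lemma empirical_itv z : unit_sq R z -> 0 <= empirical_fun z <= 1.
Proof. by move=> _; rewrite /empirical_fun indicE; case: (_ \in _); rewrite ?lexx ler01. Qed.

Lemma empirical_sym x y : unit_sq R (x, y) ->
  empirical_fun (x, y) = empirical_fun (y, x).
Proof.
move=> _; rewrite /empirical_fun !indicE; congr ((nat_of_bool _)%:R).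
by apply/idP/idP => /[!inE] -[i [j [xi yj ij]]]; exists j, i; rewrite adj_sym.
Qed.

Definition empirical : graphon R :=
  Graphon empirical_meas empirical_itv empirical_sym.

End empirical.

Section sgraph_law.
Variables (R : realType) (W0 : graphon R) (N : nat).

(* Vertices are counted from 0: vertex i sits at (i+1)/N. *)
Definition edge_prob (e : edge N) : R :=
  W0 ((val e).1.+1%:R / N%:R, (val e).2.+1%:R / N%:R).

Definition sgraph_pmf (G : sgraph N) : R :=
  \prod_(e : edge N) bernoulli_pmf (edge_prob e) (e \in (G : {set edge N})).

Definition sgraph_law (A : set (sgraph N)) : \bar R :=
  (\sum_(G : sgraph N) (sgraph_pmf G)%:E * \d_G A)%E.

Lemma edge_prob_itv e : 0 <= edge_prob e <= 1.
Proof.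
apply: graphon_itv; split; rewrite /unit_itv /= in_itv /=.
  rewrite divr_ge0//= ler_pdivrMr ?mul1r ?ler_nat// ltr0n.
  exact: leq_ltn_trans (ltn_ord (val e).1).
rewrite divr_ge0//= ler_pdivrMr ?mul1r ?ler_nat// ltr0n.
exact: leq_ltn_trans (ltn_ord (val e).1).
Qed.

Lemma sgraph_pmf_ge0 G : 0 <= sgraph_pmf G.
Proof.
by apply: prodr_ge0 => e _; apply: bernoulli_pmf_ge0; exact: edge_prob_itv.
Qed.

Lemma sgraph_pmf_sum1 : \sum_(G : sgraph N) sgraph_pmf G = 1.
Proof.
transitivity (\prod_(e : edge N) (edge_prob e + (1 - edge_prob e))).
  by rewrite bigA_distr.
by rewrite big1// => e _; rewrite addrC subrK.
Qed.

Let sgraph_law0 : sgraph_law set0 = 0%E.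
Proof. by rewrite /sgraph_law big1// => G _; rewrite measure0 mule0. Qed.

Let sgraph_law_ge0 A : (0 <= sgraph_law A)%E.
Proof.
by apply: sume_ge0 => G _; rewrite mule_ge0// lee_fin sgraph_pmf_ge0.
Qed.

Let sgraph_law_sigma_additive : semi_sigma_additive sgraph_law.
Proof.
move=> F mF tF mUF; rewrite /sgraph_law.
rewrite (_ : (fun n => _) = (fun n => \sum_(G : sgraph N)
    (sgraph_pmf G)%:E * \sum_(0 <= i < n) \d_G (F i)))%E; last first.
  apply/funext => n; rewrite exchange_big/=; apply: eq_bigr => G _.
  by rewrite ge0_sume_distrr.
apply: cvg_nnesum => G _.
  apply: nearW => n; rewrite mule_ge0 ?lee_fin ?sgraph_pmf_ge0//.
  exact: sume_ge0.
by apply: cvgeZl => //; exact: measure_semi_sigma_additive.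
Qed.

HB.instance Definition _ := isMeasure.Build _ _ _ sgraph_law
  sgraph_law0 sgraph_law_ge0 sgraph_law_sigma_additive.

Let sgraph_law_setT : sgraph_law setT = 1%E.
Proof.
rewrite /sgraph_law.
under eq_bigr do rewrite diracT mule1.
by rewrite sumEFin sgraph_pmf_sum1.
Qed.

HB.instance Definition _ := Measure_isProbability.Build _ _ _
  sgraph_law sgraph_law_setT.

Definition empirical_class (G : sgraph N) : borel_class R :=
  to_class (empirical R G).

Lemma empirical_class_meas : measurable_fun setT empirical_class.
Proof. by []. Qed.

HB.instance Definition _ :=
  isMeasurableFun.Build _ _ _ _ empirical_class empirical_class_meas.

Definition class_law : probability (borel_class R) R :=
  distribution sgraph_law empirical_class.

End sgraph_law.

Section rate_function.
Variable R : realType.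
Local Open Scope ereal_scope.

(* Since ln 0 = 0 and 0^-1 = 0 in the library, the real-valued branch obeys the
   conventions 0 log 0 = 0 log (0/0) = 0. *)
Definition rel_entropy (p u : R) : \bar R :=
  if ((p == 0%R) || (p == 1%R)) && (u != p) then +oo
  else (u * ln (u / p) + (1 - u) * ln ((1 - u) / (1 - p)))%:E.

Variable W0 : graphon R.

Definition rate_I (f : graphon R) : \bar R :=
  (2^-1)%:E * \int[leb2 R]_(z in unit_sq R) rel_entropy (W0 z) (f z).

Definition Omega : set (mR R * mR R) :=
  [set z | unit_sq R z /\ (0 < W0 z < 1)%R].

Definition W_Omega : set (graphon R) :=
  [set f | {ae leb2 R, forall z, (unit_sq R `\` Omega) z -> f z = W0 z}].

Definition class_Omega : set (graphon_class R) :=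
  [set C | exists2 g, W_Omega g & cut_metric (class_repr C) g = 0%R].

Definition rate_J (C : graphon_class R) : \bar R :=
  if `[< class_Omega C >] then
    ereal_sup [set ereal_inf [set rate_I h | h in
                 [set h | (cut_metric (class_repr C) h <= eta)%R]]
              | eta in [set eta : R | (0 < eta)%R]]
  else +oo.

End rate_function.

(* Main.v *)
Require Import Defs.
From mathcomp Require Import all_boot all_order all_algebra.
From mathcomp Require Import all_classical all_reals all_analysis.
From HB Require Import structures.
From mathcomp Require Import measurable_realfun ring lra perm.

(** Why the theorem holds. Write N = kn, and let [ent p u] be the relative
    entropy of a Bernoulli law of mean u with respect to one of mean p. As W0 is
    constant on the cells of the N-grid, the edges of the random graph are
    independent, of parameters p_e read off from the blocks, and for the step
    graphon h of a symmetric matrix q the number N^2 I(h) is, up to the diagonal,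
    the sum over the edges of [ent p_e q_e] ([rate_I_step]). Two inequalities for
    product Bernoulli laws link this sum with probabilities of events A:
    - if q_e is the conditional probability of the edge e given A, then ln P(A)
      is at most minus the sum of the [ent p_e q_e] ([ln_bprob_le]);
    - if Q is a product law of parameters q and Q(A) is close to 1, then ln P(A)
      is at least nearly minus this sum ([ln_bprob_ge]).

    Upper bound. By weak regularity, balls of small cut norm around exp (O(N))
    matrices cover all graphs ([regularity]), so at speed N^2 a single ball
    carries the probability of the event that the class is in F. Balls are
    convex, so the conditional edge probabilities given this event and the ball
    stay in the ball: they form a step graphon h with I(h) nearly at most the
    exponential rate of F, close to the empirical graphon of some graph with
    class in F ([bprob_upper]). The step graphons obtained for smaller and
    smaller balls have a limit point g for the cut metric, through
    measure-preserving maps that respect the blocks ([block_compactness]). As F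
    is closed, it contains the class of g; the step graphons converging to g
    bound the lower semicontinuous envelope J at g; and since the maps respect
    the blocks, g is equal to W0 almost everywhere outside Omega
    ([limit_W_Omega]). Thus F contains a point at which J is small ([ldp_upper]).

    Lower bound. If J(C) < c for a point C of the open set U, some graphon h near
    C has I(h) < c. Averaging h over the cells of the N-grid does not increase I,
    by convexity and since W0 is constant on the cells ([rate_I_avg]), and the
    averages converge to h in L1 ([cell_avg_approx]). A graph sampled from the
    averages is close to them in cut norm with probability tending to 1
    ([concentration]), so the change of measure gives the bound ([ldp_lower]).

    Compactness is obtained from total boundedness and completeness: modulo
    permutations within the blocks, a matrix is close to one of finitely many
    step functions, whose number does not depend on its size ([totally_bounded]),
    and the cut norm is complete on functions with values in [0, 1]
    ([cut_complete]), by the Radon-Nikodym theorem applied to an ultralimit of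
    measures. *)

Set Implicit Arguments.
Unset Strict Implicit.
Unset Printing Implicit Defensive.
Import Order.TTheory GRing.Theory Num.Theory.
Import numFieldNormedType.Exports.
Local Open Scope classical_set_scope.
Local Open Scope ring_scope.

(** * Relative entropy and product Bernoulli laws *)

Section entropy.
Variable R : realType.
Implicit Types p q u : R.

(** Relative entropy of the Bernoulli law of mean u with respect to that of
    mean p. The conventions x / 0 = 0 and ln 0 = 0 make it finite everywhere,
    so it has this meaning only under [dominated p u]. *)
Definition ent p u : R := u * ln (u / p) + (1 - u) * ln ((1 - u) / (1 - p)).

(** Absolute continuity of the Bernoulli law of mean u with respect to that of
    mean p, for u in [0, 1]. *)
Definition dominated p u := (p = 0 -> u = 0) /\ (p = 1 -> u = 1).

Lemma ln_le_subr1 (x : R) : 0 < x -> ln x <= x - 1.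
Proof.
by move=> x0; have := @le_ln1Dx R (x - 1); rewrite (addrC 1) subrK; apply; lra.
Qed.

Lemma gibbs_term (a b : R) : 0 <= a -> 0 <= b -> (b = 0 -> a = 0) ->
  a - b <= a * ln (a / b).
Proof.
move=> a0 b0 ba; have [->|an0] := eqVneq a 0; first by rewrite mul0r; lra.
have a1 : 0 < a by rewrite lt_neqAle eq_sym an0.
have b1 : 0 < b.
  by rewrite lt_neqAle eq_sym b0 andbT; apply/eqP => /ba/eqP; rewrite (negbTE an0).
have := ln_le_subr1 (divr_gt0 b1 a1); rewrite -[X in ln X]invf_div lnV ?posrE ?divr_gt0// => h.
have : a * - ln (a / b) <= a * (b / a - 1) by rewrite ler_pM2l.
rewrite mulrBr mulrCA divff// !mulr1; lra.
Qed.

(** Gibbs' inequality at the square roots of a and b. Summed over the two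
    outcomes it bounds the relative entropy below by a squared Hellinger
    distance. *)
Lemma hellinger_term (a b : R) : 0 <= a -> 0 <= b -> (b = 0 -> a = 0) ->
  2 * a - 2 * (Num.sqrt a * Num.sqrt b) <= a * ln (a / b).
Proof.
move=> a0 b0 ba; have [->|an0] := eqVneq a 0; first by rewrite sqrtr0 !mul0r; lra.
have a1 : 0 < a by rewrite lt_neqAle eq_sym an0.
have b1 : 0 < b.
  by rewrite lt_neqAle eq_sym b0 andbT; apply/eqP => /ba/eqP; rewrite (negbTE an0).
have -> : ln (a / b) = 2 * ln (Num.sqrt a / Num.sqrt b).
  by rewrite mulr_natl -lnXn ?divr_gt0 ?sqrtr_gt0// expr_div_n !sqr_sqrtr.
rewrite -{1 3}(sqr_sqrtr a0); have := @gibbs_term (Num.sqrt a) (Num.sqrt b).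
rewrite !sqrtr_ge0; have : Num.sqrt b != 0 by rewrite gt_eqF ?sqrtr_gt0.
set x := Num.sqrt a; set y := Num.sqrt b => /eqP y0 /(_ isT isT (fun e => False_ind _ (y0 e))) h.
have -> : 2 * x ^+ 2 - 2 * (x * y) = 2 * x * (x - y) by ring.
have -> : x ^+ 2 * (2 * ln (x / y)) = 2 * x * (x * ln (x / y)) by ring.
by rewrite ler_wpM2l// mulr_ge0// sqrtr_ge0.
Qed.

(** A weak form of Pinsker's inequality: (u - p)^2 is the product of the
    squares of sqrt u - sqrt p and of sqrt u + sqrt p, the second of which is
    at most 4. *)
Lemma ent_ge_sqr p u : 0 <= p <= 1 -> 0 <= u <= 1 -> dominated p u ->
  (u - p) ^+ 2 / 4 <= ent p u.
Proof.
move=> /andP[p0 p1] /andP[u0 u1] [d0 d1].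
have p1' : 0 <= 1 - p by lra.
have u1' : 0 <= 1 - u by lra.
have h1 := hellinger_term u0 p0 d0.
have h2 := @hellinger_term (1 - u) (1 - p) u1' p1'.
have {}h2 := h2 ltac:(move=> h; have := d1 ltac:(lra); lra).
rewrite /ent; set a := Num.sqrt u in h1 *; set b := Num.sqrt p in h1 *.
set c := Num.sqrt (1 - u) in h2; set d := Num.sqrt (1 - p) in h2.
have ha : a ^+ 2 = u by rewrite sqr_sqrtr.
have hb : b ^+ 2 = p by rewrite sqr_sqrtr.
have hc : c ^+ 2 = 1 - u by rewrite sqr_sqrtr.
have hd : d ^+ 2 = 1 - p by rewrite sqr_sqrtr.
have a0 : 0 <= a by exact: sqrtr_ge0.
have b0 : 0 <= b by exact: sqrtr_ge0.
have a1 : a <= 1 by rewrite -sqrtr1 ler_wsqrtr.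
have b1 : b <= 1 by rewrite -sqrtr1 ler_wsqrtr.
have : (u - p) ^+ 2 / 4 <= (a - b) ^+ 2.
  rewrite -ha -hb subr_sqr exprMn -mulrA ler_piMr ?sqr_ge0//.
  rewrite ler_pdivrMr// mul1r; have -> : 4 = 2 ^+ 2 :> R by rewrite -natrX.
  by rewrite ler_sqr ?nnegrE; lra.
have : 0 <= (c - d) ^+ 2 by exact: sqr_ge0.
move: h1 h2; rewrite !sqrrB ha hb hc hd -!(mulr_natl (_ * _)).
set X := u * ln _; set Y := (1 - u) * ln _; set ab := a * b; set cd := c * d.
set Z := _ / 4; move: X Y ab cd Z => X Y ab cd Z.
clear; lra.
Qed.

Lemma ent_ge0 p u : 0 <= p <= 1 -> 0 <= u <= 1 -> dominated p u -> 0 <= ent p u.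
Proof.
move=> hp hu d; apply: le_trans (ent_ge_sqr hp hu d).
by rewrite divr_ge0 ?sqr_ge0.
Qed.

Lemma ent_self p : ent p p = 0.
Proof.
rewrite /ent.
have [->|p0] := eqVneq p 0; first by rewrite !subr0 mul0r add0r divff// ln1 mulr0.
rewrite divff// ln1 mulr0 add0r.
have [->|p1] := eqVneq p 1; first by rewrite subrr mul0r.
by rewrite divff ?ln1 ?mulr0// subr_eq0 eq_sym.
Qed.

End entropy.

Section product_bernoulli.
Variables (R : realType) (E : finType).
Implicit Types (p q : E -> R) (G : {set E}) (A : pred {set E}).

Definition bpmf p G : R := \prod_e bernoulli_pmf (p e) (e \in G).

Definition bprob p A : R := \sum_(G | A G) bpmf p G.

Definition cond_mean p A e : R :=
  (bprob p A)^-1 * \sum_(G | A G) bpmf p G * (e \in G)%:R.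

Section fixed.
Variable p : E -> R.
Hypothesis hp : forall e, 0 <= p e <= 1.

Lemma bpmf_ge0 G : 0 <= bpmf p G.
Proof. by apply: prodr_ge0 => e _; exact: bernoulli_pmf_ge0. Qed.

Lemma bprob_ge0 A : 0 <= bprob p A.
Proof. by apply: sumr_ge0 => G _; exact: bpmf_ge0. Qed.

Lemma bpmf_gt0 G e : 0 < bpmf p G -> 0 < bernoulli_pmf (p e) (e \in G).
Proof.
move=> /gt_eqF/negbT; rewrite /bpmf prodf_seq_neq0 => /allP/(_ e).
by rewrite mem_index_enum lt_neqAle eq_sym bernoulli_pmf_ge0// andbT; apply.
Qed.

Lemma le_bprob (A B : pred {set E}) : (forall G, A G -> B G) -> bprob p A <= bprob p B.
Proof.
move=> AB; rewrite /bprob big_mkcond [leRHS]big_mkcond/=; apply: ler_sum => G _.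
by case: ifPn => [/AB->//|_]; case: ifP => // _; exact: bpmf_ge0.
Qed.

Lemma bprob_or (I : finType) (A : pred {set E}) (B : I -> pred {set E}) :
  (forall G, A G -> exists i, B i G) -> bprob p A <= \sum_i bprob p (B i).
Proof.
move=> AB; rewrite /bprob (exchange_big_dep predT)//= big_mkcond/=.
apply: ler_sum => G _; case: ifPn => [/AB[i Bi]|_]; last first.
  by apply: sumr_ge0 => *; exact: bpmf_ge0.
by rewrite (bigD1 i)//= lerDl; apply: sumr_ge0 => *; exact: bpmf_ge0.
Qed.

End fixed.

Lemma bpmf_sum1 p : \sum_G bpmf p G = 1.
Proof.
transitivity (\prod_e (p e + (1 - p e))); first by rewrite bigA_distr.
by rewrite big1// => e _; rewrite addrC subrK.
Qed.

Lemma bprob_le1 p A : (forall e, 0 <= p e <= 1) -> bprob p A <= 1.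
Proof.
move=> hp; rewrite -(bpmf_sum1 p) /bprob [leRHS](bigID A)/= lerDl.
by apply: sumr_ge0 => *; exact: bpmf_ge0.
Qed.

Lemma bprobC p A : bprob p (fun G => ~~ A G) = 1 - bprob p A.
Proof. by rewrite -(bpmf_sum1 p) [in RHS](bigID A)/= /bprob addrAC subrr add0r. Qed.

(** Expanding the product over the edges, with the factor 1 - p e replaced by
    0, leaves the graphs that contain e. *)
Lemma bpmf_mean p e : \sum_G bpmf p G * (e \in G)%:R = p e.
Proof.
transitivity (\prod_e' (p e' + (if e' == e then 0 else 1 - p e'))).
  rewrite bigA_distr; apply: eq_bigr => G _.
  have [eG|eG] := boolP (e \in G).
    rewrite mulr1; apply: eq_bigr => e' _; case: ifPn => // e'G.
    by case: eqP => // ee; rewrite ee eG in e'G.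
  by rewrite mulr0 (bigD1 e)//= (negbTE eG) eqxx mul0r.
rewrite (bigD1 e)//= eqxx addr0 big1 ?mulr1// => e' /negbTE ->.
by rewrite addrC subrK.
Qed.

(** The log-likelihood ratio of two product laws is a sum over the edges, each
    term of which looks at one edge only, so its mean under a weight w depends
    on w through the edge marginals q alone. *)
Lemma entropy_sum p q (w : {set E} -> R) :
  \sum_G w G = 1 -> (forall e, \sum_G w G * (e \in G)%:R = q e) ->
  \sum_G w G * (\sum_e ln (bernoulli_pmf (q e) (e \in G) /
                            bernoulli_pmf (p e) (e \in G))) =
  \sum_e ent (p e) (q e).
Proof.
move=> w1 wq; under eq_bigr do rewrite mulr_sumr.
rewrite exchange_big/=; apply: eq_bigr => e _.
have wq' : \sum_G w G * (e \notin G)%:R = 1 - q e.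
  rewrite -[X in X - _]w1 -(wq e) -sumrB; apply: eq_bigr => G _.
  by case: (e \in G); rewrite /= ?mulr1 ?mulr0 ?subrr ?subr0.
rewrite /ent -[X in X * ln _ + _](wq e) -[X in _ + X * ln _]wq' !mulr_suml -big_split/=; apply: eq_bigr => G _.
by rewrite /bernoulli_pmf; case: (e \in G); rewrite /= ?mulr1 ?mulr0 ?mul0r ?addr0 ?add0r.
Qed.

Lemma ln_prod (F : E -> R) : (forall e, 0 < F e) ->
  ln (\prod_e F e) = \sum_e ln (F e).
Proof.
move=> F0; have : 0 < \prod_e F e /\ ln (\prod_e F e) = \sum_e ln (F e).
  elim/big_rec2 : _ => [|e x y _ [y0 <-]]; first by rewrite ln1.
  by rewrite lnM ?posrE// mulr_gt0.
by case.
Qed.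

Lemma ln_bpmf_ratio p q G : (forall e, 0 <= p e <= 1) ->
  (forall e, 0 <= q e <= 1) -> 0 < bpmf p G -> 0 < bpmf q G ->
  \sum_e ln (bernoulli_pmf (q e) (e \in G) / bernoulli_pmf (p e) (e \in G)) =
  ln (bpmf q G / bpmf p G).
Proof.
move=> hp hq pG qG; rewrite /bpmf -prodf_div ln_prod// => e.
by rewrite divr_gt0 ?(bpmf_gt0 hp)// (bpmf_gt0 hq).
Qed.

Section upper.
Variables (p : E -> R) (A : pred {set E}).
Hypothesis hp : forall e, 0 <= p e <= 1.
Hypothesis PA : 0 < bprob p A.
Let q := cond_mean p A.
Let w G : R := if A G then bpmf p G / bprob p A else 0.

Lemma cond_meanE (b : E -> R) :
  \sum_e b e * cond_mean p A e =
  \sum_G w G * \sum_e b e * (e \in G)%:R.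
Proof.
under eq_bigr do rewrite /cond_mean mulrCA mulr_sumr mulr_sumr big_mkcond/=.
rewrite exchange_big/=; apply: eq_bigr => G _; rewrite /w mulr_sumr.
apply: eq_bigr => e _; case: ifPn; rewrite ?mul0r// => AG; ring.
Qed.

Let w_ge0 G : 0 <= w G.
Proof. by rewrite /w; case: ifPn => // _; rewrite divr_ge0// ?bpmf_ge0// ltW. Qed.

Let w_sum1 : \sum_G w G = 1.
Proof. by rewrite /w -big_mkcond/= -mulr_suml divff// gt_eqF. Qed.

(** The conditional mean is an average of points of A, and so inherits the
    convex constraints that they satisfy. *)
Lemma cond_mean_weights : exists w0 : {set E} -> R,
  [/\ forall G, 0 <= w0 G, \sum_G w0 G = 1, forall G, ~~ A G -> w0 G = 0 &
   forall b : E -> R, \sum_e b e * cond_mean p A e =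
    \sum_G w0 G * \sum_e b e * (e \in G)%:R].
Proof. by exists w; split => //; [move=> G /negbTE AG; rewrite /w AG|exact: cond_meanE]. Qed.

Let w_mean e : \sum_G w G * (e \in G)%:R = q e.
Proof.
rewrite /q /cond_mean mulr_sumr big_mkcond/= [in RHS]big_mkcond/=; apply: eq_bigr => G _.
by rewrite /w; case: ifPn; rewrite ?mul0r// => AG; rewrite mulrA (mulrC (_ ^-1)).
Qed.

Let w_meanC e : \sum_G w G * (e \notin G)%:R = 1 - q e.
Proof.
rewrite -[X in X - _]w_sum1 -(w_mean e) -sumrB; apply: eq_bigr => G _.
by case: (e \in G); rewrite /= ?mulr1 ?mulr0 ?subrr ?subr0.
Qed.

Lemma cond_mean_itv e : 0 <= cond_mean p A e <= 1.
Proof.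
apply/andP; split; first by rewrite -/q -w_mean sumr_ge0// => G _; rewrite mulr_ge0.
by rewrite -subr_ge0 -/q -w_meanC sumr_ge0// => G _; rewrite mulr_ge0.
Qed.

Lemma cond_mean_dominated e : dominated (p e) (cond_mean p A e).
Proof.
split=> pe.
  rewrite -/q -w_mean big1// => G _; case: (boolP (e \in G)); rewrite ?mulr0// => eG.
  rewrite /w mulr1; case: ifPn => // AG; rewrite /bpmf (bigD1 e)//= eG /= pe.
  by rewrite !mul0r.
apply/eqP; rewrite eq_sym -subr_eq0 -/q -w_meanC big1// => G _.
case: (boolP (e \in G)); rewrite ?mulr0// => eG.
rewrite /w mulr1; case: ifPn => // AG; rewrite /bpmf (bigD1 e)//= (negbTE eG) /= pe.
by rewrite subrr !mul0r.
Qed.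

(** Let w be the law conditioned on A and Q the product law with the edge
    marginals q of w. Gibbs' inequality gives 0 <= \sum_G w G * ln (w G / Q G).
    On A, w is P / P(A), so by [entropy_sum] the right-hand side is - ln P(A)
    minus the sum of the entropies. *)
Lemma ln_bprob_le : ln (bprob p A) <= - \sum_e ent (p e) (cond_mean p A e).
Proof.
rewrite -(entropy_sum p w_sum1 w_mean) -subr_le0 opprK.
have -> : ln (bprob p A) = \sum_G w G * ln (bprob p A).
  by rewrite -mulr_suml w_sum1 mul1r.
rewrite -big_split/=.
apply: (@le_trans _ _ (\sum_G (bpmf q G - w G))); last first.
  by rewrite sumrB w_sum1 bpmf_sum1 subrr.
apply: ler_sum => G _; have := w_ge0 G; rewrite le_eqVlt => /orP[/eqP<-|wG].
  by rewrite !mul0r subr0 addr0; apply: bpmf_ge0; exact: cond_mean_itv.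
have AG : A G by move: wG; rewrite /w; case: ifPn => //; rewrite ltxx.
have wGE : w G = bpmf p G / bprob p A by rewrite /w AG.
have pG : 0 < bpmf p G by move: wG; rewrite wGE pmulr_lgt0// invr_gt0.
have qG : 0 < bpmf q G.
  apply: prodr_gt0 => e _; rewrite /bernoulli_pmf; case: ifPn => eG.
    rewrite -w_mean (bigD1 G)//= eG mulr1 ltr_pwDl// sumr_ge0// => ? _.
    by rewrite mulr_ge0.
  rewrite -w_meanC (bigD1 G)//= eG mulr1 ltr_pwDl// sumr_ge0// => ? _.
  by rewrite mulr_ge0.
rewrite ln_bpmf_ratio//; last exact: cond_mean_itv.
rewrite -mulrDr -lnM ?posrE ?divr_gt0//.
have -> : bprob p A * (bpmf q G / bpmf p G) = bpmf q G / w G.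
  by rewrite wGE; field; rewrite !gt_eqF.
apply: (@le_trans _ _ (w G * (bpmf q G / w G - 1))).
  by rewrite ler_pM2l// ln_le_subr1// divr_gt0.
by rewrite mulrBr mulr1 mulrCA divff ?gt_eqF// mulr1.
Qed.

End upper.

(** Change of measure. Gibbs' inequality is used on A for Q against c P with c
    = Q(A) / P(A), and off A for Q against P, where it loses at most 1. *)
Lemma ln_bprob_ge p q A :
  (forall e, 0 <= p e <= 1) -> (forall e, 0 <= q e <= 1) ->
  (forall e, dominated (p e) (q e)) -> 0 < bprob q A ->
  0 < bprob p A /\
  ln (bprob q A) - (\sum_e ent (p e) (q e) + 1) / bprob q A <= ln (bprob p A).
Proof.
move=> hp hq pq QA.
have pG0 G : 0 < bpmf q G -> 0 < bpmf p G.
  move=> qG; apply: prodr_gt0 => e _; have := bpmf_gt0 hq e qG.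
  have [p0 p1] := pq e; have /andP[pe0 pe1] := hp e.
  rewrite /bernoulli_pmf; case: ifPn => _ h.
    by rewrite lt_neqAle eq_sym pe0 andbT; apply/eqP => /p0 q0; move: h; rewrite q0 ltxx.
  rewrite subr_gt0 lt_neqAle pe1 andbT; apply/eqP => /p1 q1.
  by move: h; rewrite q1 subrr ltxx.
have PA : 0 < bprob p A.
  have [G AG qG] : exists2 G, A G & 0 < bpmf q G.
    apply: contrapT => h; move: QA; rewrite /bprob big1 ?ltxx// => G AG.
    apply/eqP; rewrite eq_le bpmf_ge0// andbT leNgt; apply/negP => qG.
    by apply: h; exists G.
  rewrite /bprob (bigD1 G)//= ltr_pwDl ?pG0//; apply: sumr_ge0 => *; exact: bpmf_ge0.
split => //.
pose L G := \sum_e ln (bernoulli_pmf (q e) (e \in G) / bernoulli_pmf (p e) (e \in G)).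
have HE : \sum_G bpmf q G * L G = \sum_e ent (p e) (q e).
  by apply: entropy_sum; [exact: bpmf_sum1|exact: bpmf_mean].
have key c G : 0 < c -> bpmf q G - c * bpmf p G <= bpmf q G * (L G - ln c).
  move=> c0; have := bpmf_ge0 hq G; rewrite le_eqVlt => /orP[/eqP<-|qG].
    by rewrite mul0r subr_le0 mulr_ge0 ?bpmf_ge0// ltW.
  rewrite /L ln_bpmf_ratio ?pG0// -ln_div ?posrE ?divr_gt0 ?pG0//.
  have cp0 : 0 < c * bpmf p G by rewrite mulr_gt0 ?pG0.
  have -> : bpmf q G / bpmf p G / c = bpmf q G / (c * bpmf p G).
    by field; rewrite !gt_eqF ?pG0.
  by apply: gibbs_term; rewrite ?ltW// => h; rewrite h ltxx in cp0.
set c := bprob q A / bprob p A.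
have c0 : 0 < c by rewrite divr_gt0.
have h1 : 0 <= \sum_(G | A G) bpmf q G * (L G - ln c).
  apply: le_trans (ler_sum _ (fun G _ => key c G c0)).
  by rewrite sumrB -mulr_sumr /c -/(bprob p A) -/(bprob q A) mulrVK ?subrr// unitfE gt_eqF.
(* the sum is at least Q(A^c) - P(A^c), by Gibbs' inequality term by term *)
have h2 : -1 <= \sum_(G | ~~ A G) bpmf q G * L G.
  have key1 G := key 1 G ltr01.
  under [leRHS]eq_bigr do rewrite -[L _]subr0 -ln1.
  apply: le_trans (ler_sum _ (fun G _ => key1 G)).
  rewrite sumrB -/(bprob q (fun G => ~~ A G)).
  under [X in _ - X]eq_bigr do rewrite mul1r.
  rewrite -/(bprob p (fun G => ~~ A G)).
  have := bprob_le1 (fun G => ~~ A G) hp.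
  have := bprob_ge0 hq (fun G => ~~ A G); lra.
have h3 : \sum_(G | A G) bpmf q G * L G = \sum_e ent (p e) (q e) - \sum_(G | ~~ A G) bpmf q G * L G.
  by rewrite -HE [in RHS](bigID A)/= addrK.
have h4 : \sum_(G | A G) bpmf q G * (L G - ln c) = \sum_(G | A G) bpmf q G * L G - bprob q A * ln c.
  by rewrite /bprob mulr_suml -sumrB; apply: eq_bigr => G _; rewrite mulrBr.
have : bprob q A * ln c <= \sum_e ent (p e) (q e) + 1 by rewrite h4 h3 in h1; lra.
rewrite -ler_pdivlMl// mulrC /c ln_div ?posrE//; lra.
Qed.

End product_bernoulli.

(** * Weak regularity of matrices *)

Section matrix_cut.
Variables (R : realType) (N : nat).
Hypothesis N0 : (0 < N)%N.
Implicit Types (B : 'I_N -> 'I_N -> R) (e : R).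

(** The cut norm of B, normalized by the number of entries, is at most e. *)
Definition mcut B e := forall S T : {set 'I_N},
  `| \sum_(i in S) \sum_(j in T) B i j | <= e * N%:R ^+ 2.

Lemma eq_mcut B B' e : (forall i j, B i j = B' i j) -> mcut B e -> mcut B' e.
Proof. by move=> BB'; have -> : B' = B by apply/funext => i; apply/funext => j. Qed.

Lemma sum_le_pos (c s : 'I_N -> R) (d : R) : (forall i, 0 <= s i <= d) ->
  \sum_i s i * c i <= d * \sum_(i in [set i | 0 < c i]%SET) c i.
Proof.
move=> sd; rewrite mulr_sumr [leRHS]big_mkcond/=; apply: ler_sum => i _.
have /andP[s0 sd'] := sd i; rewrite inE; case: ifPn => [c0|]; first by rewrite ler_wpM2r// ltW.
by rewrite -leNgt => c0; rewrite mulr_ge0_le0.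
Qed.

Lemma bilinear_le B e (s t : 'I_N -> R) :
  (forall i, 0 <= s i <= N%:R^-1) -> (forall i, 0 <= t i <= N%:R^-1) ->
  (forall S T : {set 'I_N}, \sum_(i in S) \sum_(j in T) B i j <= e * N%:R ^+ 2) ->
  \sum_i \sum_j B i j * (s i * t j) <= e.
Proof.
move=> hs ht hB; have N00 : 0 < N%:R^-1 :> R by rewrite invr_gt0 ltr0n.
have -> : \sum_i \sum_j B i j * (s i * t j) = \sum_i s i * \sum_j t j * B i j.
  by apply: eq_bigr => i _; rewrite mulr_sumr; apply: eq_bigr => j _; ring.
apply: le_trans (sum_le_pos _ hs) _.
set S := [set i | _]%SET; rewrite exchange_big/=.
under eq_bigr do rewrite -mulr_sumr.
have := sum_le_pos (fun j => \sum_(i in S) B i j) ht.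
set T := [set i | _]%SET; rewrite exchange_big/= => h.
apply: le_trans (ler_wpM2l (ltW N00) h) _.
apply: le_trans (ler_wpM2l (ltW N00) (ler_wpM2l (ltW N00) (hB S T))) _.
rewrite le_eqVlt; apply/orP; left; apply/eqP; field.
by rewrite gt_eqF// ltr0n.
Qed.

(** A bilinear form on a product of cubes is extremal at vertices, that is at
    indicators of sets. *)
Lemma mcut_bilinear B e (s t : 'I_N -> R) :
  (forall i, 0 <= s i <= N%:R^-1) -> (forall i, 0 <= t i <= N%:R^-1) ->
  mcut B e -> `| \sum_i \sum_j B i j * (s i * t j) | <= e.
Proof.
move=> hs ht hB; rewrite ler_norml; apply/andP; split.
  rewrite lerNl -sumrN; under eq_bigr do rewrite -sumrN.
  under eq_bigr do under eq_bigr do rewrite -mulNr.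
  apply: bilinear_le => // S T; under eq_bigr do rewrite sumrN.
  by rewrite sumrN; apply: le_trans (hB S T); rewrite -normrN ler_norm.
by apply: bilinear_le => // S T; apply: le_trans (hB S T); exact: ler_norm.
Qed.

Definition signed_rect := (bool * {set 'I_N} * {set 'I_N})%type.

(** All rectangles get the same coefficient up to sign, so that for a given
    number of rectangles there are finitely many such matrices. *)
Definition rect_sum (eps : R) (w : seq signed_rect) (i j : 'I_N) : R :=
  eps * \sum_(x <- w) (-1) ^+ x.1.1 * (i \in x.1.2)%:R * (j \in x.2)%:R.

Lemma rect_sum_nseq0 eps m i j :
  rect_sum eps (nseq m (false, finset.set0, finset.set0)) i j = 0.
Proof.
rewrite /rect_sum; elim: m => [|m IHm]; first by rewrite big_nil mulr0.
by rewrite /= big_cons !finset.in_set0 /= !(mulr0, mul0r, add0r).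
Qed.

Lemma sum_rect (S T : {set 'I_N}) B :
  \sum_i \sum_j B i j * ((i \in S)%:R * (j \in T)%:R) =
  \sum_(i in S) \sum_(j in T) B i j.
Proof.
rewrite [in RHS]big_mkcond/=; apply: eq_bigr => i _; case: ifPn => iS; last first.
  by rewrite big1// => j _; rewrite mul0r mulr0.
by rewrite [RHS]big_mkcond/=; apply: eq_bigr => j _; case: ifPn => jT;
  rewrite ?mulr1 ?mulr0.
Qed.

Lemma sum_sq1 : \sum_(i < N) \sum_(j < N) 1 = N%:R ^+ 2 :> R.
Proof. by rewrite !sumr_const !card_ord -mulrnA -natrX mulnn. Qed.

(** Energy decrement: when S x T violates the cut bound, subtracting eps times
    its signed indicator lowers the sum of squares by at least eps^2 N^2. The
    hypothesis allows m such steps; if fewer suffice, empty rectangles complete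
    the tuple. *)
Lemma greedy_regularity (eps : R) m B : 0 < eps ->
  \sum_i \sum_j B i j ^+ 2 <= m%:R * eps ^+ 2 * N%:R ^+ 2 ->
  exists w : m.-tuple signed_rect,
    mcut (fun i j => B i j - rect_sum eps w i j) eps.
Proof.
move=> e0; elim: m B => [|m IH] B hB.
  exists [tuple] => S T; have B0 i j : B i j = 0.
    apply/eqP; rewrite -(sqrf_eq0 (B i j)) -normr_le0 ger0_norm ?sqr_ge0//.
    apply: le_trans (_ : _ <= \sum_i \sum_j B i j ^+ 2) _; last by move: hB; rewrite !mul0r.
    rewrite (bigD1 i)//= (bigD1 j)//= -addrA lerDl addr_ge0//.
      by apply: sumr_ge0 => *; exact: sqr_ge0.
    by apply: sumr_ge0 => *; apply: sumr_ge0 => *; exact: sqr_ge0.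
  rewrite big1 ?normr0 => [|i _]; first by rewrite mulr_ge0 ?sqr_ge0// ltW.
  by rewrite big1// => j _; rewrite B0 /rect_sum big_nil mulr0 subrr.
have [hc|hc] := pselect (mcut B eps).
  exists (nseq_tuple m.+1 (false, finset.set0, finset.set0)).
  by apply: eq_mcut hc => i j; rewrite rect_sum_nseq0 subr0.
have [S [T hST]] : exists S T : {set 'I_N}, eps * N%:R ^+ 2 < `| \sum_(i in S) \sum_(j in T) B i j |.
  apply: contrapT => h; apply: hc => S T; rewrite leNgt; apply/negP => ?.
  by apply: h; exists S, T.
set X := \sum_(i in S) _ in hST.
pose b := X < 0; have bX : (-1) ^+ b * X = `|X|.
  rewrite /b; case: (ltrP X 0) => h; first by rewrite expr1 mulN1r ltr0_norm.
  by rewrite mul1r ger0_norm.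
have [] := IH (fun i j => B i j - eps * ((-1) ^+ b * ((i \in S)%:R * (j \in T)%:R))).
  have -> : \sum_i \sum_j (B i j - eps * ((-1) ^+ b * ((i \in S)%:R * (j \in T)%:R))) ^+ 2 =
    \sum_i \sum_j B i j ^+ 2 - 2 * eps * `|X| + eps ^+ 2 * \sum_i \sum_j ((i \in S)%:R * (j \in T)%:R).
    rewrite -bX /X -(sum_rect S T B) !mulr_sumr -sumrB -big_split/=.
    apply: eq_bigr => i _; rewrite !mulr_sumr -sumrB -big_split/=; apply: eq_bigr => j _.
    rewrite sqrrB exprMn exprMn -exprM mulnC exprM sqrrN expr1n.
    rewrite -mulr_natl expr1n mul1r exprMn.
    have -> : forall c : bool, (c%:R : R) ^+ 2 = c%:R by case; rewrite ?expr1n ?expr0n.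
    have -> : forall c : bool, (c%:R : R) ^+ 2 = c%:R by case; rewrite ?expr1n ?expr0n.
    by ring.
  have hle : \sum_(i < N) \sum_(j < N) ((i \in S)%:R * (j \in T)%:R) <= N%:R ^+ 2 :> R.
    rewrite -sum_sq1.
    apply: ler_sum => i _; apply: ler_sum => j _.
    by case: (i \in S); case: (j \in T); rewrite ?mulr1 ?mulr0 ?ler01.
  have h1 : eps ^+ 2 * \sum_(i < N) \sum_(j < N) ((i \in S)%:R * (j \in T)%:R) <= eps ^+ 2 * N%:R ^+ 2.
    by rewrite ler_wpM2l ?sqr_ge0.
  have h2 : eps ^+ 2 * N%:R ^+ 2 <= eps * `|X|.
    by rewrite expr2 -mulrA ler_wpM2l ?ltW.
  move: hB h1 h2; rewrite -[m.+1]addn1 natrD mulrDl mulrDl mul1r -!mulrA.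
  set a := eps * (eps * N%:R ^+ 2); set c := m%:R * a; set x := (\sum_i \sum_j _); set y := eps * `|X|; set z := eps * (eps * _).
  by move: a c x y z => a c x y z; clear; lra.
move=> w hw; exists [tuple of (b, S, T) :: w].
by apply: eq_mcut hw => i j; rewrite /rect_sum big_cons /=; ring.
Qed.

Lemma regularity (eps : R) m B : 0 < eps -> 1 <= m%:R * eps ^+ 2 ->
  (forall i j, `|B i j| <= 1) ->
  exists w : m.-tuple signed_rect,
    mcut (fun i j => B i j - rect_sum eps w i j) eps.
Proof.
move=> e0 me B1; apply: greedy_regularity => //.
apply: (@le_trans _ _ (N%:R ^+ 2)); last by rewrite ler_peMl ?sqr_ge0.
rewrite -sum_sq1.
apply: ler_sum => i _; apply: ler_sum => j _.
by rewrite -real_normK ?num_real// expr_le1.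
Qed.

End matrix_cut.

(** * The L1 and cut norms on the unit square *)

Section bounded_measurable.
Variable R : realType.
Local Notation I01 := (unit_itv R).
Local Notation sq := (unit_sq R).
Local Notation plane := (mR R * mR R)%type.
Implicit Types (f g : plane -> mR R) (S T : set (mR R)).

Lemma measurable_unit_itv : measurable I01.
Proof. exact: measurable_itv. Qed.

Lemma measurable_unit_sq : measurable sq.
Proof. by apply: measurableX; exact: measurable_unit_itv. Qed.
Hint Resolve measurable_unit_itv measurable_unit_sq : core.

Lemma leb_unit_itv : leb R I01 = 1%E.
Proof.
transitivity (@lebesgue_measure R `[0, 1]%classic) => //.
by rewrite lebesgue_measure_itv /= lte_fin ltr01 oppr0 adde0.
Qed.

Lemma leb_sub_fin S : measurable S -> S `<=` I01 -> leb R S \is a fin_num.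
Proof.
move=> mS SI; rewrite ge0_fin_numE//; apply: (@le_lt_trans _ _ (leb R I01)).
  by apply: le_measure; rewrite ?inE//; exact: measurable_unit_itv.
by rewrite leb_unit_itv ltry.
Qed.

Lemma leb2X S T : measurable S -> measurable T ->
  leb2 R (S `*` T) = (leb R S * leb R T)%E.
Proof. exact: (@product_measure1E _ _ _ _ _ (@lebesgue_measure R) (@lebesgue_measure R)). Qed.

Lemma leb2_unit_sq : leb2 R sq = 1%E.
Proof. by rewrite leb2X// leb_unit_itv mule1. Qed.

Lemma leb2_sub_fin D : measurable D -> D `<=` sq -> (leb2 R D < +oo)%E.
Proof.
move=> mD DS; apply: (@le_lt_trans _ _ (leb2 R sq)); last by rewrite leb2_unit_sq ltry.
by apply: le_measure; rewrite ?inE.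
Qed.

Definition bounded_meas f :=
  measurable_fun sq f /\ exists B, forall z, sq z -> `|f z| <= B.

Lemma bounded_meas_itv f : measurable_fun sq f ->
  (forall z, sq z -> 0 <= f z <= 1) -> bounded_meas f.
Proof.
by move=> mf f01; split=> //; exists 1 => z /f01/andP[f0 f1]; rewrite ger0_norm.
Qed.

Lemma bounded_meas_graphon (f : graphon R) : bounded_meas f.
Proof. by apply: bounded_meas_itv; [exact: graphon_meas|exact: graphon_itv]. Qed.

Lemma bounded_meas_cst c : bounded_meas (cst c).
Proof. by split; [exact: measurable_cst|exists `|c|]. Qed.

Lemma bounded_measD f g : bounded_meas f -> bounded_meas g ->
  bounded_meas (fun z => f z + g z).
Proof.
move=> [mf [B fB]] [mg [C gC]]; split; first exact: measurable_funD.
exists (B + C) => z sz; apply: le_trans (ler_normD _ _) _.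
by rewrite lerD ?fB ?gC.
Qed.

Lemma bounded_measM f g : bounded_meas f -> bounded_meas g ->
  bounded_meas (fun z => f z * g z).
Proof.
move=> [mf [B fB]] [mg [C gC]]; split; first exact: measurable_funM.
by exists (B * C) => z sz; rewrite normrM ler_pM// ?fB ?gC.
Qed.

Lemma bounded_measN f : bounded_meas f -> bounded_meas (fun z => - f z).
Proof.
move=> [mf [B fB]]; split; first exact: measurableT_comp.
by exists B => z sz; rewrite normrN fB.
Qed.

Lemma bounded_measB f g : bounded_meas f -> bounded_meas g ->
  bounded_meas (fun z => f z - g z).
Proof. by move=> bf bg; apply: bounded_measD => //; exact: bounded_measN. Qed.

Lemma bounded_meas_norm f : bounded_meas f -> bounded_meas (fun z => `|f z|).
Proof.
move=> [mf [B fB]]; split; first exact: measurableT_comp.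
by exists B => z sz; rewrite normr_id fB.
Qed.

Lemma bounded_meas_sum (I : Type) (r : seq I) (F : I -> plane -> mR R) :
  (forall i, bounded_meas (F i)) -> bounded_meas (fun z => \sum_(i <- r) F i z).
Proof.
move=> bF; elim: r => [|i r IH].
  by under eq_fun do rewrite big_nil; exact: bounded_meas_cst.
by under eq_fun do rewrite big_cons; exact: bounded_measD.
Qed.

Lemma bounded_meas_indic D : measurable D -> bounded_meas (\1_D).
Proof.
move=> mD; split; first exact: measurable_indic.
exists 1 => z _; rewrite indicE; case: (_ \in _); rewrite ?normr1 ?normr0//.
Qed.

Lemma bounded_meas_integrable f D : measurable D -> D `<=` sq ->
  bounded_meas f -> (leb2 R).-integrable D (EFin \o f).
Proof.
move=> mD DS [mf [B fB]].
apply: measurable_bounded_integrable => //; first exact: leb2_sub_fin.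
  exact: measurable_funS mf.
exists B; split; first exact: num_real.
by move=> M BM z Dz; apply: le_trans (ltW BM); apply: fB; exact: DS.
Qed.

Definition L1norm f : R := \int[leb2 R]_(z in sq) `|f z|.

Lemma normr_int_le_L1norm f D : measurable D -> D `<=` sq -> bounded_meas f ->
  `|\int[leb2 R]_(z in D) f z| <= L1norm f.
Proof.
move=> mD DS bf; apply: (@le_trans _ _ (\int[leb2 R]_(z in D) `|f z|)).
  by apply: le_normr_Rintegral => //; exact: bounded_meas_integrable.
have bn := bounded_meas_norm bf.
have h1 := bounded_meas_integrable mD DS bn.
have h2 := bounded_meas_integrable measurable_unit_sq (@subset_refl _ _) bn.
rewrite /L1norm /Rintegral fine_le ?integrable_fin_num//.
apply: ge0_subset_integral => //.
  by have /measurable_EFinP := bn.1.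
Qed.

Lemma L1norm_ge0 f : 0 <= L1norm f.
Proof. by apply: Rintegral_ge0. Qed.

Lemma le_L1norm f g : bounded_meas f -> bounded_meas g ->
  (forall z, sq z -> `|f z| <= `|g z|) -> L1norm f <= L1norm g.
Proof.
move=> bf bg fg; apply: le_Rintegral => //; apply: bounded_meas_integrable => //;
  exact: bounded_meas_norm.
Qed.

Lemma eq_L1norm f g : (forall z, sq z -> f z = g z) -> L1norm f = L1norm g.
Proof. by move=> fg; apply: eq_Rintegral => z; rewrite inE => /fg ->. Qed.

Lemma L1norm_le_cst f c : bounded_meas f -> (forall z, sq z -> `|f z| <= c) ->
  L1norm f <= c.
Proof.
move=> bf fc; apply: (@le_trans _ _ (\int[leb2 R]_(z in sq) c)).
  apply: le_Rintegral => //; apply: bounded_meas_integrable => //.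
    exact: bounded_meas_norm.
  exact: bounded_meas_cst.
by rewrite Rintegral_cst// leb2_unit_sq mulr1.
Qed.

Lemma L1normD f g : bounded_meas f -> bounded_meas g ->
  L1norm (fun z => f z + g z) <= L1norm f + L1norm g.
Proof.
move=> bf bg; rewrite /L1norm -RintegralD//; last 2 first.
- by apply: bounded_meas_integrable => //; exact: bounded_meas_norm.
- by apply: bounded_meas_integrable => //; exact: bounded_meas_norm.
apply: le_Rintegral => //; last by move=> z _; exact: ler_normD.
- by apply: bounded_meas_integrable => //; apply: bounded_meas_norm; exact: bounded_measD.
- by apply: bounded_meas_integrable => //; apply: bounded_measD; exact: bounded_meas_norm.
Qed.

Lemma L1normZ c f : bounded_meas f -> L1norm (fun z => c * f z) = `|c| * L1norm f.
Proof.
move=> bf; rewrite /L1norm -RintegralZl//; last first.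
  by apply: bounded_meas_integrable => //; exact: bounded_meas_norm.
by apply: eq_Rintegral => z _; rewrite normrM.
Qed.

Lemma L1norm_distC f g : L1norm (fun z => f z - g z) = L1norm (fun z => g z - f z).
Proof. by apply: eq_Rintegral => z _; rewrite distrC. Qed.

Lemma L1norm_tri f g h : bounded_meas f -> bounded_meas g -> bounded_meas h ->
  L1norm (fun z => f z - h z) <= L1norm (fun z => f z - g z) + L1norm (fun z => g z - h z).
Proof.
move=> bf bg bh; have := L1normD (bounded_measB bf bg) (bounded_measB bg bh).
by under eq_fun do rewrite addrA subrK.
Qed.

(** The cut norm of f is at most e. As a predicate it avoids the side
    conditions of suprema. *)
Definition cut_le f (e : R) := forall S T, measurable S -> measurable T ->
  S `<=` I01 -> T `<=` I01 -> `| \int[leb2 R]_(z in S `*` T) f z | <= e.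

Lemma cut_le_L1 f : bounded_meas f -> cut_le f (L1norm f).
Proof.
move=> bf S T mS mT SI TI; apply: normr_int_le_L1norm => //; first exact: measurableX.
exact: setSX.
Qed.

Lemma cut_leW f e e' : e <= e' -> cut_le f e -> cut_le f e'.
Proof. by move=> ee fe S T *; apply: le_trans ee; exact: fe. Qed.

Lemma cut_le_ge0 f e : cut_le f e -> 0 <= e.
Proof.
move=> /(_ set0 set0 measurable0 measurable0 (@sub0set _ _) (@sub0set _ _)).
by apply: le_trans.
Qed.

Lemma cut_leD f g e e' : bounded_meas f -> bounded_meas g ->
  cut_le f e -> cut_le g e' -> cut_le (fun z => f z + g z) (e + e').
Proof.
move=> bf bg fe ge S T mS mT SI TI.
rewrite RintegralD; last 3 first.
- exact: measurableX.
- by apply: bounded_meas_integrable => //; [exact: measurableX|exact: setSX].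
- by apply: bounded_meas_integrable => //; [exact: measurableX|exact: setSX].
by apply: le_trans (ler_normD _ _) _; rewrite lerD ?fe ?ge.
Qed.

Lemma eq_cut_le f g e : (forall z, sq z -> f z = g z) -> cut_le f e -> cut_le g e.
Proof.
move=> fg fe S T mS mT SI TI; rewrite -(@eq_Rintegral _ _ _ _ _ _ f); first exact: fe.
by move=> z; rewrite inE => -[/= z1 z2]; rewrite fg//; split; [exact: SI|exact: TI].
Qed.

Lemma cut_le_distC f g e : bounded_meas f -> bounded_meas g ->
  cut_le (fun z => f z - g z) e -> cut_le (fun z => g z - f z) e.
Proof.
move=> bf bg fe S T mS mT SI TI.
under eq_Rintegral do rewrite -opprB -mulN1r.
rewrite RintegralZl; first by rewrite mulN1r normrN fe.
- exact: measurableX.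
- apply: bounded_meas_integrable (bounded_measB bf bg); [exact: measurableX|exact: setSX].
Qed.

Lemma cut_le_tri f g h e e' : bounded_meas f -> bounded_meas g -> bounded_meas h ->
  cut_le (fun z => f z - g z) e -> cut_le (fun z => g z - h z) e' ->
  cut_le (fun z => f z - h z) (e + e').
Proof.
move=> bf bg bh fg gh; have := cut_leD (bounded_measB bf bg) (bounded_measB bg bh) fg gh.
by apply: eq_cut_le => z _; rewrite addrA subrK.
Qed.

Lemma cut_dist_le f g e : 0 <= e -> cut_le (fun z => f z - g z) e -> cut_dist f g <= e.
Proof.
move=> e0 fg; apply: ge_sup.
  by exists `| \int[leb2 R]_(z in set0 `*` set0) (f z - g z) |, set0, set0; split.
by move=> _ [S [T [mS mT SI TI ->]]]; exact: fg.
Qed.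

Lemma cut_le_dist f g : bounded_meas f -> bounded_meas g ->
  cut_le (fun z => f z - g z) (cut_dist f g).
Proof.
move=> bf bg S T mS mT SI TI; apply: sup_upper_bound; last by exists S, T.
split; first by exists `| \int[leb2 R]_(z in S `*` T) (f z - g z) |, S, T; split.
exists (L1norm (fun z => f z - g z)) => _ [S' [T' [mS' mT' SI' TI' ->]]].
exact: cut_le_L1 (bounded_measB bf bg) _ _ mS' mT' SI' TI'.
Qed.

Lemma cut_dist_ge0 f g : bounded_meas f -> bounded_meas g -> 0 <= cut_dist f g.
Proof. by move=> bf bg; exact: cut_le_ge0 (cut_le_dist bf bg). Qed.

End bounded_measurable.
#[export] Hint Resolve measurable_unit_itv measurable_unit_sq : core.

(** * Step functions on a uniform grid *)

Section step_functions.
Variable R : realType.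
Local Notation I01 := (unit_itv R).
Local Notation sq := (unit_sq R).
Local Notation plane := (mR R * mR R)%type.
Implicit Types (f g : plane -> mR R) (S T : set (mR R)).

Lemma Rint_sum D (I : Type) (r : seq I) (F : I -> plane -> mR R) :
  measurable D -> D `<=` sq -> (forall i, bounded_meas (F i)) ->
  \int[leb2 R]_(z in D) (\sum_(i <- r) F i z) = \sum_(i <- r) \int[leb2 R]_(z in D) F i z.
Proof.
move=> mD DS bF; elim: r => [|i r IH].
  under eq_Rintegral do rewrite big_nil.
  by rewrite big_nil Rintegral_cst// mul0r.
under eq_Rintegral do rewrite big_cons.
rewrite big_cons RintegralD// ?IH//; apply: bounded_meas_integrable => //.
exact: bounded_meas_sum.
Qed.

Lemma Rint_indic D A : measurable D -> D `<=` sq -> measurable A ->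
  \int[leb2 R]_(z in D) \1_A z = fine (leb2 R (A `&` D)).
Proof. by move=> mD DS mA; rewrite /Rintegral integral_indic. Qed.

Lemma cellE N i x : cell R N i x <->
  (if i == 0%N then 0 <= x else i%:R / N%:R < x) && (x <= i.+1%:R / N%:R).
Proof.
by rewrite /cell; case: i => [|i] /=; rewrite in_itv/= ?mul1r.
Qed.

Lemma cell_ge N i x : cell R N i x -> i%:R / N%:R <= x.
Proof. by move=> /cellE; case: i => [|i] /andP[]; rewrite ?mul0r//= => /ltW. Qed.

Lemma cell_le N i x : cell R N i x -> x <= i.+1%:R / N%:R.
Proof. by move=> /cellE /andP[]. Qed.

Lemma cell_right N i : (i < N)%N -> cell R N i (i.+1%:R / N%:R).
Proof.
move=> iN; apply/cellE; rewrite lexx andbT; case: ifP => _; first by rewrite divr_ge0.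
by rewrite ltr_pM2r ?invr_gt0 ?ltr0n ?(leq_ltn_trans _ iN)// ltr_nat.
Qed.

Lemma measurable_cell N i : measurable (cell R N i).
Proof. exact: measurable_itv. Qed.
Hint Resolve measurable_cell : core.

Section fixed.
Variable N : nat.
Hypothesis N0 : (0 < N)%N.
Let N0R : 0 < N%:R :> R. Proof. by rewrite ltr0n. Qed.

Lemma cell_sub (i : 'I_N) : cell R N i `<=` I01.
Proof.
move=> x ix; rewrite /unit_itv /= in_itv /=; apply/andP; split.
  by apply: le_trans (cell_ge ix); rewrite divr_ge0.
by apply: le_trans (cell_le ix) _; rewrite ler_pdivrMr// mul1r ler_nat.
Qed.

Lemma cell_exists x : I01 x -> exists i : 'I_N, cell R N i x.
Proof.
rewrite /unit_itv /= in_itv /= => /andP[x0 x1].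
have ex : exists n, (x <= n.+1%:R / N%:R).
  by exists N.-1; rewrite prednK// divff ?gt_eqF.
case: (ex_minnP ex) => n xn nmin.
have nN : (n < N)%N.
  by rewrite -[ltnRHS]prednK// ltnS; apply: nmin; rewrite prednK// divff ?gt_eqF.
exists (Ordinal nN); apply/cellE => /=; rewrite xn andbT.
case: n xn nmin nN => [//|n] xn nmin nN /=.
by rewrite ltNge; apply/negP => /nmin; rewrite ltnn.
Qed.

Lemma cell_inj i j x : cell R N i x -> cell R N j x -> i = j.
Proof.
wlog ij : i j / (i < j)%N => [H ix jx|/cellE/andP[_ ix] /cellE].
  by case: (ltngtP i j) => // ij; [exact: H ix jx|exact/esym/(H _ _ ij jx ix)].
case: j ij => // j ij /= /andP[jx _].
have := lt_le_trans jx ix; rewrite ltr_pM2r ?invr_gt0// ltr_nat.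
by rewrite ltnNge ij.
Qed.

Lemma leb_cell i : leb R (cell R N i) = (N%:R^-1)%:E.
Proof.
transitivity (@lebesgue_measure R (cell R N i)) => //.
rewrite /cell lebesgue_measure_itv; case: i => [|i] /=.
  by rewrite lte_fin invr_gt0 N0R oppr0 adde0.
rewrite lte_fin ltr_pM2r ?invr_gt0// ltr_nat ltnSn -EFinB -mulrBl.
by rewrite -[i.+2]addn1 natrD addrAC subrr add0r mul1r.
Qed.

Definition cell_meas (S : set (mR R)) (i : nat) : R := fine (leb R (S `&` cell R N i)).

Lemma leb_cellI_fin S i : measurable S -> leb R (S `&` cell R N i) \is a fin_num.
Proof.
move=> mS; rewrite ge0_fin_numE//.
apply: le_lt_trans (_ : leb R (cell R N i) < _)%E; last by rewrite leb_cell ltry.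
by apply: le_measure; rewrite ?inE//; exact: measurableI.
Qed.

Lemma cell_meas_itv S i : measurable S -> 0 <= cell_meas S i <= N%:R^-1.
Proof.
move=> mS; rewrite /cell_meas fine_ge0//= -lee_fin fineK ?leb_cellI_fin//.
rewrite -(leb_cell i); apply: le_measure; rewrite ?inE//; exact: measurableI.
Qed.

Definition step (a : 'I_N -> 'I_N -> R) (z : plane) : mR R :=
  \sum_i \sum_j a i j * \1_(cell R N i `*` cell R N j) z.

Lemma bounded_meas_step a : bounded_meas (step a).
Proof.
apply: bounded_meas_sum => i; apply: bounded_meas_sum => j.
apply: bounded_measM; first exact: bounded_meas_cst.
by apply: bounded_meas_indic; exact: measurableX.
Qed.

Lemma stepE a (i j : 'I_N) x y : cell R N i x -> cell R N j y -> step a (x, y) = a i j.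
Proof.
move=> ix jy; rewrite /step (bigD1 i)//= (bigD1 j)//= indicE mem_set// mulr1.
rewrite big1 ?addr0 => [|j' j'j]; last first.
  rewrite indicE memNset ?mulr0// => -[_ /= j'y].
  by move/eqP: j'j; apply; apply/val_inj; exact: cell_inj j'y jy.
rewrite big1 ?addr0// => i' i'i; rewrite big1// => j' _.
rewrite indicE memNset ?mulr0// => -[/= i'x _].
by move/eqP: i'i; apply; apply/val_inj; exact: cell_inj i'x ix.
Qed.

Lemma sq_cell z : sq z -> exists i j : 'I_N, cell R N i z.1 /\ cell R N j z.2.
Proof. by case=> /cell_exists[i iz] /cell_exists[j jz]; exists i, j. Qed.

Lemma step_ind (P : R -> Prop) a z : sq z -> (forall i j, P (a i j)) -> P (step a z).
Proof.
by case: z => x y /sq_cell[i [j [/= ix jy]]] Pa; rewrite (stepE a ix jy).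
Qed.

Lemma step_itv a z : sq z -> (forall i j, 0 <= a i j <= 1) -> 0 <= step a z <= 1.
Proof. by move=> sz ha; apply: (@step_ind (fun u => 0 <= u <= 1)) => //. Qed.

Lemma stepB a b z : step a z - step b z = step (fun i j => a i j - b i j) z.
Proof.
rewrite /step -sumrB; apply: eq_bigr => i _; rewrite -sumrB; apply: eq_bigr => j _.
by rewrite mulrBl.
Qed.

Lemma step_sym a x y : (forall i j, a i j = a j i) -> sq (x, y) ->
  step a (x, y) = step a (y, x).
Proof.
move=> sa /sq_cell[i [j [/= ix jy]]].
by rewrite (stepE a ix jy) (stepE a jy ix).
Qed.

Lemma cellX_sub (i j : 'I_N) : cell R N i `*` cell R N j `<=` sq.
Proof. by apply: setSX; exact: cell_sub. Qed.

Lemma measurable_cellX (i j : nat) : measurable (cell R N i `*` cell R N j).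
Proof. exact: measurableX. Qed.

Lemma int_step a S T : measurable S -> measurable T -> S `<=` I01 -> T `<=` I01 ->
  \int[leb2 R]_(z in S `*` T) step a z =
  \sum_i \sum_j a i j * (cell_meas S i * cell_meas T j).
Proof.
move=> mS mT SI TI; have mST := measurableX mS mT; have STq := setSX TI SI.
have bij (i j : 'I_N) : bounded_meas (\1_(cell R N i `*` cell R N j) : plane -> mR R).
  by apply: bounded_meas_indic; exact: measurable_cellX.
rewrite Rint_sum//; last first.
  move=> i; apply: bounded_meas_sum => j; apply: bounded_measM => //.
  exact: bounded_meas_cst.
apply: eq_bigr => i _; rewrite Rint_sum//; last first.
  by move=> j; apply: bounded_measM => //; exact: bounded_meas_cst.
apply: eq_bigr => j _; rewrite RintegralZl//; last exact: bounded_meas_integrable.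
congr (_ * _); rewrite Rint_indic//; last exact: measurable_cellX.
rewrite setIC -setXI leb2X; [|exact: measurableI|exact: measurableI].
by rewrite fineM// leb_cellI_fin.
Qed.

(** The masses of S and T in the cells are weights in [0, 1/N], to which
    [mcut_bilinear] applies. *)
Lemma cut_le_step a e : mcut a e -> cut_le (step a) e.
Proof.
move=> ae S T mS mT SI TI; rewrite int_step//; apply: mcut_bilinear => // i; exact: cell_meas_itv.
Qed.

Lemma sum_cells (F : plane -> mR R) : bounded_meas F ->
  \int[leb2 R]_(z in sq) F z =
  \sum_(i < N) \sum_(j < N) \int[leb2 R]_(z in cell R N i `*` cell R N j) F z.
Proof.
move=> bF.
have bij (i j : 'I_N) : bounded_meas (fun z => F z * \1_(cell R N i `*` cell R N j) z).
  by apply: bounded_measM => //; apply: bounded_meas_indic; exact: measurable_cellX.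
transitivity (\int[leb2 R]_(z in sq)
    \sum_(i < N) \sum_(j < N) (F z * \1_(cell R N i `*` cell R N j) z)).
  apply: eq_Rintegral => z; rewrite inE => sz.
  have h1 := @step_ind (fun u => u = 1) (fun _ _ => 1) z sz (fun _ _ => erefl).
  rewrite -[LHS]mulr1 -[X in _ * X]h1 /step mulr_sumr; apply: eq_bigr => i _.
  by rewrite mulr_sumr; apply: eq_bigr => j _; rewrite mul1r.
rewrite Rint_sum//; last by move=> i; exact: bounded_meas_sum.
apply: eq_bigr => i _; rewrite Rint_sum//; apply: eq_bigr => j _.
rewrite -[in RHS](setIidr (@cellX_sub i j)) [in RHS]Rintegral_mkcondr.
apply: eq_Rintegral => z _; rewrite patchE indicE.
by case: ifPn; rewrite ?mulr1 ?mulr0.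
Qed.

Lemma int_cell_cst (i j : nat) (c : R) :
  \int[leb2 R]_(z in cell R N i `*` cell R N j) c = c / N%:R ^+ 2.
Proof.
rewrite Rintegral_cst; last exact: measurable_cellX.
by rewrite leb2X// !leb_cell -EFinM /= expr2 invfM.
Qed.

Definition cell_avg f (i j : 'I_N) : R :=
  N%:R ^+ 2 * \int[leb2 R]_(z in cell R N i `*` cell R N j) f z.

Lemma L1norm_step a : L1norm (step a) = (\sum_i \sum_j `|a i j|) / N%:R ^+ 2.
Proof.
rewrite /L1norm sum_cells; last exact/bounded_meas_norm/bounded_meas_step.
rewrite mulr_suml; apply: eq_bigr => i _; rewrite mulr_suml; apply: eq_bigr => j _.
rewrite -(int_cell_cst i j); apply: eq_Rintegral => -[x y]; rewrite inE => -[/= ix jy].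
by rewrite (stepE a ix jy).
Qed.

Lemma cell_avg_itv f i j : bounded_meas f -> (forall z, sq z -> 0 <= f z <= 1) ->
  0 <= cell_avg f i j <= 1.
Proof.
move=> bf hf; apply/andP; split.
  rewrite mulr_ge0 ?sqr_ge0//; apply: Rintegral_ge0 => z /cellX_sub /hf.
  by case/andP.
rewrite -ler_pdivlMl ?exprn_gt0// mulrC -(int_cell_cst i j).
have iS := @cellX_sub i j; have mS := @measurable_cellX i j.
apply: le_Rintegral => //.
- exact: bounded_meas_integrable.
- by apply: bounded_meas_integrable => //; exact: bounded_meas_cst.
- by move=> z /cellX_sub/hf/andP[].
Qed.

(** Averaging over the cells is an L1 contraction that fixes step functions. *)
Lemma L1norm_avg_step f a : bounded_meas f ->
  L1norm (fun z => step (cell_avg f) z - step a z) <= L1norm (fun z => f z - step a z).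
Proof.
move=> bf; have bs := bounded_meas_step a; have bB := bounded_measB bf bs.
rewrite (eq_L1norm (fun z _ => stepB _ _ z)) L1norm_step.
rewrite [leRHS]sum_cells; last exact: bounded_meas_norm.
rewrite mulr_suml; apply: ler_sum => i _; rewrite mulr_suml; apply: ler_sum => j _.
have iS := @cellX_sub i j; have mS := @measurable_cellX i j.
apply: le_trans (le_normr_Rintegral _ _) => //; last exact: bounded_meas_integrable.
rewrite RintegralB//; [|exact: bounded_meas_integrable..].
have -> : \int[leb2 R]_(z in cell R N i `*` cell R N j) step a z = a i j / N%:R ^+ 2.
  rewrite -(int_cell_cst i j); apply: eq_Rintegral => -[x y]; rewrite inE => -[/= ix jy].
  by rewrite (stepE a ix jy).
rewrite /cell_avg; set X := Rintegral _ _ _.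
have -> : X - a i j / N%:R ^+ 2 = (N%:R ^+ 2 * X - a i j) / N%:R ^+ 2.
  by field; rewrite gt_eqF.
by rewrite normrM normfV (ger0_norm (sqr_ge0 _)).
Qed.

(** The triangle inequality through the step function of a, which averaging
    fixes. *)
Lemma L1norm_avg f a : bounded_meas f ->
  L1norm (fun z => f z - step (cell_avg f) z) <= 2 * L1norm (fun z => f z - step a z).
Proof.
move=> bf; have bs := bounded_meas_step a; have bA := bounded_meas_step (cell_avg f).
apply: le_trans (L1norm_tri bf bs bA) _.
rewrite (L1norm_distC (step a)); have := L1norm_avg_step a bf; lra.
Qed.

End fixed.
End step_functions.
#[export] Hint Resolve measurable_cell : core.

(** * Density of step functions in L1 *)

Lemma le_natr_bound (R : realType) (x : R) n : 0 <= x -> (Num.bound x <= n)%N -> x <= n%:R.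
Proof.
by move=> x0 xn; apply: le_trans (ltW (archi_boundP x0)) _; rewrite ler_nat.
Qed.

Lemma natr_inv_le (R : realType) (e : R) n : 0 < e -> (Num.bound e^-1 < n)%N -> n%:R^-1 <= e.
Proof.
move=> e0 en; rewrite -[leRHS]invrK lef_pV2 ?posrE ?invr_gt0 ?ltr0n ?(leq_trans _ en)//.
by apply: le_natr_bound (ltnW en); rewrite invr_ge0 ltW.
Qed.

Section approximable_sets.
Context d (T : measurableType d) (R : realType) (mu : {measure set T -> \bar R}).
Variables (D : set T) (A_ : nat -> set (set T)).
Hypothesis mD : measurable D.
Hypothesis muD : (mu D < +oo)%E.
Hypothesis mA_ : forall N B, A_ N B -> measurable B.
Hypothesis A_0 : forall N, A_ N set0.
Hypothesis A_C : forall N B, A_ N B -> A_ N (~` B).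
Hypothesis A_U : forall N B C, A_ N B -> A_ N C -> A_ N (B `|` C).

(** The approximation is required for all large N, so that one N can serve both
    sets of a union. *)
Definition approximable (A : set T) := measurable A /\
  forall e : R, 0 < e -> exists M, forall N, (M <= N)%N ->
    exists2 B, A_ N B & (mu (D `&` (A `+` B)) <= e%:E)%E.

Let measurable_sd A B : measurable A -> measurable B -> measurable (D `&` (A `+` B)).
Proof. by move=> mA mB; apply: measurableI => //; apply: measurableU; exact: measurableD. Qed.

Lemma approximable0 : approximable set0.
Proof.
split=> // e e0; exists 0%N => N _; exists set0; first exact: A_0.
by rewrite /setY setD0 setU0 setI0 measure0 lee_fin ltW.
Qed.

Lemma approximableC A : approximable A -> approximable (~` A).
Proof.
move=> [mA hA]; split; first exact: measurableC.
move=> e /hA[M hM]; exists M => N /hM[B AB le]; exists (~` B); first exact: A_C.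
by rewrite (_ : (_ `+` _) = (A `+` B))// /setY !setDE !setCK setUC (setIC B) (setIC (~` B)).
Qed.

Lemma approximableU A A' : approximable A -> approximable A' -> approximable (A `|` A').
Proof.
move=> [mA hA] [mA' hA']; split; first exact: measurableU.
move=> e e0; have e2 : 0 < e / 2 by rewrite divr_gt0.
have [M hM] := hA _ e2; have [M' hM'] := hA' _ e2.
exists (maxn M M') => N; rewrite geq_max => /andP[/hM[B AB le] /hM'[B' AB' le']].
exists (B `|` B'); first exact: A_U.
have mB := mA_ AB; have mB' := mA_ AB'.
have h1 := measurable_sd mA mB; have h2 := measurable_sd mA' mB'.
apply: (@le_trans _ _ (mu ((D `&` (A `+` B)) `|` (D `&` (A' `+` B'))))).
  apply: le_measure; rewrite ?inE.
  - by apply: measurable_sd; exact: measurableU.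
  - exact: measurableU.
  - move=> x [Dx [[[Ax|A'x]]|[[Bx|B'x]]]] /not_orP[h h'].
    + by left; split => //; left.
    + by right; split => //; left.
    + by left; split => //; right.
    + by right; split => //; right.
apply: le_trans (measureU2 _ _ _) _ => //.
by rewrite [e]splitr EFinD; exact: leeD.
Qed.

(** Finite subunions exhaust the union up to e / 2, by continuity of the
    measure from above. *)
Lemma approximable_bigcup (F : (set T)^nat) : (forall n, approximable (F n)) ->
  approximable (\bigcup_n F n).
Proof.
move=> hF; have mF : measurable (\bigcup_n F n) by apply: bigcupT_measurable => n; case: (hF n).
split=> // e e0; have e2 : 0 < e / 2 by rewrite divr_gt0.
pose U m := \big[setU/set0]_(i < m) F i.
have aU m : approximable (U m).
  elim: m => [|m IH]; first by rewrite /U big_ord0; exact: approximable0.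
  by rewrite /U big_ord_recr; exact: approximableU.
pose E m := D `&` (\bigcup_n F n `\` U m).
have mE m : measurable (E m).
  by apply: measurableI => //; apply: measurableD => //; case: (aU m).
have ndE : nonincreasing_seq E.
  move=> m n mn; apply/subsetPset => x [Dx [Fx Ux]]; split => //; split => //.
  by apply: contra_not Ux; apply: subset_bigsetU.
have E0 : \bigcap_n E n = set0.
  apply/seteqP; split => // x Ex; have [_ [[n _ Fn] _]] := Ex 0%N I.
  have [_ [_]] := Ex n.+1 I; apply; rewrite /U big_ord_recr; by right.
have muE0 : (mu (E 0%N) < +oo)%E.
  apply: le_lt_trans muD; apply: le_measure; rewrite ?inE//.
  by move=> x [].
have := nonincreasing_cvg_mu muE0 mE; rewrite E0 measure0 => /(_ measurable0 ndE) cv.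
have [m Em] : exists m, (mu (E m) < (e / 2)%:E)%E.
  have [m _ hm] : \forall n \near \oo, (mu (E n) < (e / 2)%:E)%E.
    have /fine_cvgP[fin /cvgr_lt/(_ _ e2)] := cv.
    apply: filterS2 fin => n /= finn lt; rewrite -(fineK finn) lte_fin; exact: lt.
  by exists m; apply: hm => /=.
have [mU hU] := aU m; have [M hM] := hU _ e2.
exists M => N /hM[B AB le]; exists B => //; have mB := mA_ AB.
apply: (@le_trans _ _ (mu (E m `|` (D `&` ((U m) `+` B))))).
  apply: le_measure; rewrite ?inE.
  - exact: measurable_sd.
  - by apply: measurableU => //; exact: measurable_sd.
  - move=> x [Dx [[Fx nB]|[Bx nF]]].
      have [Ux|nU] := pselect (U m x); last by left.
      by right; split => //; left.
    right; split => //; right; split => // Ux; apply: nF.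
    by move: Ux; rewrite /U -bigcup_mkord => -[i _ Fi]; exists i.
apply: le_trans (measureU2 _ _ _) _ => //; first exact: measurable_sd.
by rewrite [e]splitr EFinD; apply: leeD => //; exact: ltW.
Qed.

Lemma sigma_algebra_approximable : sigma_algebra setT approximable.
Proof.
split; [exact: approximable0| |exact: approximable_bigcup].
by move=> A /approximableC; rewrite setTD.
Qed.

End approximable_sets.

Section density.
Variable R : realType.
Local Notation I01 := (unit_itv R).
Local Notation sq := (unit_sq R).
Local Notation plane := (mR R * mR R)%type.
Implicit Types (f g : plane -> mR R) (S T : set (mR R)).

Definition cellwise1 N (B : set (mR R)) := measurable B /\
  forall (i : 'I_N) x y, cell R N i x -> cell R N i y -> B x -> B y.

Definition cellwise2 N (B : set plane) := measurable B /\
  forall (i j : 'I_N) z z', (cell R N i `*` cell R N j) z ->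
    (cell R N i `*` cell R N j) z' -> B z -> B z'.

Let approx1 := @approximable _ (mR R) R (leb R) I01 cellwise1.
Let approx2 := @approximable _ plane R (leb2 R) sq cellwise2.

Let sigma1 : sigma_algebra setT approx1.
Proof.
apply: sigma_algebra_approximable => //.
- by rewrite leb_unit_itv ltry.
- by move=> N B [].
- move=> N B [mB hB]; split; first exact: measurableC.
  by move=> i x y ix iy nBx By; apply: nBx; exact: (hB i y x).
- move=> N B C [mB hB] [mC hC]; split; first exact: measurableU.
  by move=> i x y ix iy [/(hB _ _ _ ix iy)|/(hC _ _ _ ix iy)]; [left|right].
Qed.

Let sigma2 : sigma_algebra setT approx2.
Proof.
apply: sigma_algebra_approximable => //.
- by rewrite leb2_unit_sq ltry.
- by move=> N B [].
- move=> N B [mB hB]; split; first exact: measurableC.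
  by move=> i j x y ix iy nBx By; apply: nBx; exact: (hB i j y x).
- move=> N B C [mB hB] [mC hC]; split; first exact: measurableU.
  by move=> i j x y ix iy [/(hB _ _ _ _ ix iy)|/(hC _ _ _ _ ix iy)]; [left|right].
Qed.

Let ray_approx (x : R) : approx1 `]-oo, x[%classic.
Proof.
split; first exact: measurable_itv.
have near0 (e : R) : 0 < e -> exists M, forall N, (M <= N)%N -> (0 < N)%N /\ N%:R^-1 <= e.
  move=> e0; exists (Num.bound e^-1).+1 => N MN; split; first exact: leq_trans MN.
  exact: natr_inv_le.
move=> e /near0[M hM]; exists M => N /hM[N0 Ne].
have [x0|x0] := leP x 0.
  exists set0; first by split.
  rewrite (_ : _ `&` _ = set0) ?measure0 ?lee_fin ?(le_trans _ Ne)//.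
  apply/seteqP; split => // y [].
  rewrite /unit_itv /= in_itv /= => /andP[y0 _] [[/= + _]|[]//].
  by rewrite in_itv /= ltNge (le_trans x0 y0).
have [x1|x1] := ltP 1 x.
  exists setT; first by split.
  rewrite (_ : _ `&` _ = set0) ?measure0 ?lee_fin ?(le_trans _ Ne)//.
  apply/seteqP; split => // y [].
  rewrite /unit_itv /= in_itv /= => /andP[_ y1] [[_ []//]|[_]]; apply.
  by rewrite /= in_itv /= (le_lt_trans y1 x1).
have [j jx] := @cell_exists R N N0 x ltac:(by rewrite /unit_itv /= in_itv /= x1 ltW).
have N0R : 0 < N%:R :> R by rewrite ltr0n.
exists (if j == 0%N :> nat then set0 else `]-oo, j%:R / N%:R]%classic).
  case: eqP => j0; first by split.
  split; first exact: measurable_itv.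
  move=> i y z iy iz /=; rewrite !in_itv /= => yj.
  apply: le_trans (cell_le iz) _; rewrite ler_pM2r ?invr_gt0// ler_nat ltnNge.
  apply/negP => ji; have /cellE/andP[] := iy.
  case: ifPn => [/eqP i0|_ iy' _]; first by move: ji; rewrite i0 leqn0 => /eqP.
  have jiR : j%:R / N%:R <= i%:R / N%:R :> R by rewrite ler_pM2r ?invr_gt0// ler_nat.
  by have := le_lt_trans (le_trans yj jiR) iy'; rewrite ltxx.
apply: (@le_trans _ _ (leb R (cell R N j))); last by rewrite leb_cell// lee_fin.
apply: le_measure; rewrite ?inE//.
  apply: measurableI => //; apply: measurableU; apply: measurableD => //;
    by case: eqP => _ //; exact: measurable_itv.
move=> y [yI]; case: eqP => j0.
  move=> [[/= + _]|[]//]; rewrite in_itv /= => yx; apply/cellE; rewrite j0 /=.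
  move: yI; rewrite /unit_itv /= in_itv /= => /andP[-> _] /=.
  by apply: le_trans (ltW yx) _; have := cell_le jx; rewrite j0.
move=> [[/= + yj]|[/= + yx]]; rewrite in_itv /= => h.
  apply/cellE; case: ifPn => [/eqP//|_]; apply/andP; split.
    by rewrite ltNge; apply/negP; move: yj; rewrite /= in_itv.
  exact: le_trans (ltW h) (cell_le jx).
exfalso; move: yx; rewrite /= in_itv /=; apply.
apply: le_lt_trans h _; have /cellE/andP[] := jx.
by case: ifPn => // /eqP.
Qed.

Let measurable_approx1 S : measurable S -> approx1 S.
Proof.
move=> mS; have : (@RGenInftyO.G R).-sigma.-measurable S.
  by rewrite -(RGenInftyO.measurableE R).
apply: smallest_sub => //.
by move=> _ [x ->]; exact: ray_approx.
Qed.

Let rect_approx S T : measurable S -> measurable T -> approx2 (S `*` T).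
Proof.
move=> mS mT; split; first exact: measurableX.
have [_ hS] := measurable_approx1 mS; have [_ hT] := measurable_approx1 mT.
move=> e e0; have e2 : 0 < e / 2 by rewrite divr_gt0.
have [M hM] := hS _ e2; have [M' hM'] := hT _ e2.
exists (maxn M M') => N; rewrite geq_max => /andP[/hM[B [mB hB] le] /hM'[C [mC hC] le']].
exists (B `*` C).
  split; first exact: measurableX.
  move=> i j z z' [/= iz jz] [/= iz' jz'] [Bz Cz]; split.
    exact: hB iz iz' Bz.
  exact: hC jz jz' Cz.
have m1 : measurable (I01 `&` (S `+` B)).
  by apply: measurableI => //; apply: measurableU; exact: measurableD.
have m2 : measurable (I01 `&` (T `+` C)).
  by apply: measurableI => //; apply: measurableU; exact: measurableD.
apply: (@le_trans _ _ (leb2 R (((I01 `&` (S `+` B)) `*` I01) `|` (I01 `*` (I01 `&` (T `+` C)))))).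
  apply: le_measure; rewrite ?inE.
  - apply: measurableI => //; apply: measurableU; apply: measurableD => //; exact: measurableX.
  - by apply: measurableU; exact: measurableX.
  - move=> [x y] [[/= Ix Iy] [[[/= Sx Ty] n]|[[/= Bx Cy] n]]].
      have [Bx|nB] := pselect (B x); last by left; split => //; split => //; left.
      have [Cy|nC] := pselect (C y); last by right; split => //; split => //; left.
      by exfalso; apply: n.
    have [Bx'|nB] := pselect (S x); last by left; split => //; split => //; right.
    have [Cy'|nC] := pselect (T y); last by right; split => //; split => //; right.
    by exfalso; apply: n.
apply: le_trans (measureU2 _ _ _) _; [exact: measurableX|exact: measurableX|].
rewrite [e]splitr EFinD; apply: leeD.
  by apply: le_trans le; rewrite -[leRHS]mule1 -leb_unit_itv -leb2X.
by apply: le_trans le'; rewrite -[leRHS]mul1e -leb_unit_itv -leb2X.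
Qed.

Let measurable_approx2 (A : set plane) : measurable A -> approx2 A.
Proof.
move=> mA; have := mA; rewrite measurable_prod_measurableType.
apply: smallest_sub => //.
by move=> _ [S mS [T mT <-]]; exact: rect_approx.
Qed.

Definition approx_fun f := forall e, 0 < e -> exists M, forall N, (M <= N)%N ->
  exists a : 'I_N -> 'I_N -> R, L1norm (fun z => f z - step a z) <= e.

Let approx_indic (A : set plane) : measurable A -> approx_fun \1_A.
Proof.
move=> mA e e0; have [_ /(_ e e0)[M hM]] := measurable_approx2 mA.
exists M.+1 => N MN; have N0 : (0 < N)%N by exact: leq_trans MN.
have [B [mB hB] le] := hM _ (ltnW MN).
pose p (i : nat) : R := i.+1%:R / N%:R.
exists (fun i j => \1_B (p i, p j)).
have sE z : sq z -> step (fun i j : 'I_N => \1_B (p i, p j)) z = \1_B z.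
  case: z => x y sz; have [i [j [/= ix jy]]] := sq_cell N0 sz.
  rewrite (stepE N0 _ ix jy) // !indicE; congr (nat_of_bool _)%:R.
  apply/idP/idP; rewrite !inE; apply: (hB i j) => //; split => //=; exact: cell_right.
rewrite (@eq_L1norm _ _ (fun z => \1_A z - \1_B z)) => [|z /sE ->//].
have mD : measurable ((A `+` B)) by apply: measurableU; exact: measurableD.
rewrite /L1norm (@eq_Rintegral _ _ _ _ _ (\1_((A `+` B)))); last first.
  move=> z _; rewrite !indicE.
  have [Az|Az] := pselect (A z); have [Bz|Bz] := pselect (B z).
  - rewrite (mem_set Az) (mem_set Bz) memNset ?subrr ?normr0//.
    by move=> [[_ //]|[_ //]].
  - by rewrite (mem_set Az) (memNset Bz) mem_set ?subr0 ?normr1//; left.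
  - by rewrite (memNset Az) (mem_set Bz) mem_set ?sub0r ?normrN ?normr1//; right.
  - rewrite !memNset ?subrr ?normr0//.
    by move=> [[//]|[//]].
rewrite Rint_indic// setIC -lee_fin fineK// ge0_fin_numE//.
by apply: leb2_sub_fin; [exact: measurableI|exact: subIsetl].
Qed.

Let approx_funD f g : bounded_meas f -> bounded_meas g -> approx_fun f -> approx_fun g ->
  approx_fun (fun z => f z + g z).
Proof.
move=> bf bg hf hg e e0; have e2 : 0 < e / 2 by rewrite divr_gt0.
have [M hM] := hf _ e2; have [M' hM'] := hg _ e2.
exists (maxn M M').+1 => N MN.
have N0 : (0 < N)%N by exact: leq_trans MN.
move: (ltnW MN); rewrite geq_max => /andP[/hM[a ha] /hM'[b hb]].
exists (fun i j => a i j + b i j); rewrite [e]splitr; apply: le_trans (lerD ha hb).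
have ba := bounded_meas_step a; have bb := bounded_meas_step b.
apply: le_trans (L1normD (bounded_measB bf ba) (bounded_measB bg bb)).
rewrite le_eqVlt; apply/orP; left; apply/eqP/eq_L1norm => z sz.
have -> : step (fun i j => a i j + b i j) z = step a z + step b z.
  rewrite /step -big_split/=; apply: eq_bigr => i _; rewrite -big_split/=.
  by apply: eq_bigr => j _; rewrite mulrDl.
by rewrite opprD addrACA.
Qed.

Let approx_funZ c f : bounded_meas f -> approx_fun f -> approx_fun (fun z => c * f z).
Proof.
move=> bf hf e e0; have c0 : 0 < `|c| + 1 by rewrite ltr_wpDl.
have [M hM] := hf (e / (`|c| + 1)) (divr_gt0 e0 c0).
exists M => N /hM[a ha]; exists (fun i j => c * a i j).
have -> : (fun z => c * f z - step (fun i j => c * a i j) z) = (fun z => c * (f z - step a z)).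
  apply/funext => z; rewrite mulrBr; congr (_ - _).
  rewrite /step mulr_sumr; apply: eq_bigr => i _; rewrite mulr_sumr.
  by apply: eq_bigr => j _; rewrite mulrA.
rewrite L1normZ; last exact: bounded_measB bf (bounded_meas_step a).
have := ha; rewrite ler_pdivlMr// => h; apply: le_trans h.
by rewrite mulrC ler_wpM2l ?L1norm_ge0// lerDl.
Qed.

Let approx_fun_sum (I : Type) (r : seq I) (F : I -> plane -> mR R) :
  (forall i, bounded_meas (F i)) -> (forall i, approx_fun (F i)) ->
  approx_fun (fun z => \sum_(i <- r) F i z).
Proof.
move=> bF hF; elim: r => [|i r IH].
  move=> e e0; exists 0%N => N _; exists (fun _ _ => 0).
  rewrite (@eq_L1norm _ _ (fun z => 0 * cst 0 z)) ?L1normZ ?normr0 ?mul0r ?ltW//.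
    exact: bounded_meas_cst.
  move=> z _; rewrite big_nil /step big1 ?subrr ?mul0r// => i _; rewrite big1// => j _.
  by rewrite mul0r.
have -> : (fun z => \sum_(j <- i :: r) F j z) = (fun z => F i z + \sum_(j <- r) F j z).
  by apply/funext => z; rewrite big_cons.
by apply: approx_funD => //; exact: bounded_meas_sum.
Qed.

Let approx_fun_lim f : bounded_meas f -> (forall e, 0 < e -> exists g,
   [/\ bounded_meas g, approx_fun g & L1norm (fun z => f z - g z) <= e]) -> approx_fun f.
Proof.
move=> bf hf e e0; have e2 : 0 < e / 2 by rewrite divr_gt0.
have [g [bg hg fg]] := hf _ e2; have [M hM] := hg _ e2.
exists M => N /hM[a ha]; exists a; rewrite [e]splitr.
apply: le_trans (L1norm_tri bf bg (bounded_meas_step a)) _.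
by rewrite lerD.
Qed.

(** The function m^-1 * truncn (m * f) is a sum of indicators of level sets. *)
Let approx_unit f : measurable_fun sq f -> (forall z, sq z -> 0 <= f z <= 1) -> approx_fun f.
Proof.
move=> mf f01; have bf := bounded_meas_itv mf f01.
apply: approx_fun_lim => // e e0.
have [m m0 me] : exists2 m, (0 < m)%N & m%:R^-1 <= e.
  by exists (Num.bound e^-1).+1 => //; exact: natr_inv_le.
have m0R : 0 < m%:R :> R by rewrite ltr0n.
pose A (l : 'I_m) := sq `&` f @^-1` `[l.+1%:R / m%:R, +oo[%classic.
have mA l : measurable (A l) by apply: mf => //; exact: measurable_itv.
have bA l : bounded_meas (fun z : plane => m%:R^-1 * \1_(A l) z).
  by apply: bounded_measM; [exact: bounded_meas_cst|exact: bounded_meas_indic].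
exists (fun z => \sum_(l < m) m%:R^-1 * \1_(A l) z); split.
- exact: bounded_meas_sum.
- apply: approx_fun_sum => // l; apply: approx_funZ; first exact: bounded_meas_indic.
  exact: approx_indic.
apply: L1norm_le_cst; first by apply: bounded_measB => //; exact: bounded_meas_sum.
move=> z sz; have /andP[f0 f1] := f01 z sz.
pose t := Num.truncn (m%:R * f z).
have mf0 : 0 <= m%:R * f z by rewrite mulr_ge0.
have /andP[t1 t2] : t%:R <= m%:R * f z < t.+1%:R by exact: truncn_itv.
have tm : (t <= m)%N.
  by rewrite -(ler_nat R); apply: le_trans t1 _; rewrite ler_piMr.
have AE (l : 'I_m) : \1_(A l) z = (l < t)%N%:R :> R.
  rewrite indicE; congr (nat_of_bool _)%:R; apply/idP/idP; rewrite inE /A /=.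
    move=> [_]; rewrite in_itv /= andbT ler_pdivrMr// mulrC => h.
    by have := le_lt_trans h t2; rewrite ltr_nat ltnS.
  move=> lt; split => //; rewrite in_itv /= andbT ler_pdivrMr// mulrC.
  by apply: le_trans t1; rewrite ler_nat.
under eq_bigr do rewrite AE; rewrite -mulr_sumr.
have -> : \sum_(l < m) (l < t)%N%:R = t%:R :> R.
  have -> : \sum_(l < m) (l < t)%N%:R = \sum_(l < m | (l < t)%N) 1 :> R.
    by rewrite [RHS]big_mkcond; apply: eq_bigr => l _; case: ifP.
  by rewrite (big_ord_narrow tm) sumr_const card_ord.
have -> : f z - m%:R^-1 * t%:R = m%:R^-1 * (m%:R * f z - t%:R).
  by field; rewrite gt_eqF.
rewrite ger0_norm; last by rewrite mulr_ge0 ?invr_ge0 ?subr_ge0// ltW.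
apply: le_trans me; rewrite ler_piMr ?invr_ge0//.
by move: t2; rewrite -[t.+1]addn1 natrD; lra.
Qed.

(** Intervals, hence by a sigma-algebra argument all measurable subsets of the
    line, are approximated by unions of cells; so are rectangles, hence all
    measurable subsets of the square. Bounded functions follow, being uniform
    limits of combinations of indicators after an affine rescaling into [0,
    1]. *)
Theorem step_dense f : bounded_meas f -> approx_fun f.
Proof.
move=> bf; have [mf [B fB]] := bf; pose C := `|B| + 1.
have C0 : 0 < C by rewrite ltr_wpDl.
have fC z : sq z -> - C <= f z <= C.
  move=> /fB h; rewrite -ler_norml; apply: le_trans h _.
  by apply: le_trans (ler_norm _) _; rewrite lerDl.
pose g z := (2 * C)^-1 * f z + 2^-1.
have bg : bounded_meas g.
  by apply: bounded_measD; [apply: bounded_measM => //|]; exact: bounded_meas_cst.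
have g01 z : sq z -> 0 <= g z <= 1.
  move=> /fC/andP[h1 h2]; rewrite /g invfM -mulrA.
  have : -1 <= C^-1 * f z by rewrite -(ler_pM2l C0) mulrA divff ?gt_eqF// mul1r mulrN1.
  have : C^-1 * f z <= 1 by rewrite -(ler_pM2l C0) mulrA divff ?gt_eqF// mul1r mulr1.
  set u := C^-1 * _; lra.
have -> : f = (fun z => (2 * C) * g z + (- C) * cst 1 z).
  apply/funext => z; rewrite /g /=; field; rewrite gt_eqF//.
have b1 := @bounded_meas_cst R 1.
apply: approx_funD.
- by apply: bounded_measM => //; exact: bounded_meas_cst.
- by apply: bounded_measM => //; exact: bounded_meas_cst.
- by apply: approx_funZ => //; apply: approx_unit => //; case: bg.
apply: approx_funZ => //; apply: approx_unit => [|z _]; first by case: b1.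
by rewrite /= ler01 lexx.
Qed.

End density.

(** * Measure-preserving bijections and the cut metric *)

Section measure_preserving.
Variable R : realType.
Local Notation I01 := (unit_itv R).
Local Notation sq := (unit_sq R).
Local Notation plane := (mR R * mR R)%type.
Implicit Types (f g h : plane -> mR R) (S T : set (mR R)) (phi psi : mR R -> mR R).

(** The function f^phi of the cut metric. *)
Definition pull phi f (z : plane) : mR R := f (phi z.1, phi z.2).

Lemma mp_bij_fun phi x : mp_bij phi -> I01 x -> I01 (phi x).
Proof. by case=> -[+ _ _] _ _; exact. Qed.

Lemma mp_bij_id : @mp_bij R id.
Proof.
split.
- by split=> // x Ix; exists x.
- exact: measurable_id.
- by move=> A mA AI; congr (leb R _); apply/setIidr.
Qed.

Lemma mp_bij_comp phi psi : mp_bij phi -> mp_bij psi -> mp_bij (phi \o psi).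
Proof.
move=> [[ff fi fs] mf pf] [[gf gi gs] mg pg]; split.
- split.
  + by move=> x /gf /ff.
  + move=> x y xI yI /= e; apply: gi => //; apply: fi => //.
      by rewrite inE; apply: gf; rewrite -inE.
    by rewrite inE; apply: gf; rewrite -inE.
  + by move=> y /fs[x /gs[w wI <-] <-]; exists w.
- by apply: measurable_comp mf mg => //; move=> _ [x Ix <-]; exact: gf.
- move=> A mA AI.
  have mA' : measurable (I01 `&` phi @^-1` A) by exact: mf.
  rewrite -(pf A mA AI) -(pg _ mA'); last by move=> ? [].
  by congr (leb R _); apply/seteqP; split => x /= [Ix]; [move=> Ax; split => //; split => //; exact: gf|case].
Qed.

Lemma measurable_preim phi S : mp_bij phi -> measurable S -> measurable (I01 `&` phi @^-1` S).
Proof. by case=> _ mphi _ mS; exact: mphi. Qed.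

(** Completed by the identity outside the unit interval, a measure-preserving
    bijection preserves the measure of all Borel sets, which is the setting of
    pushforward measures. *)
Definition extend phi : mR R -> mR R := patch id I01 phi.

Lemma extendE phi x : I01 x -> extend phi x = phi x.
Proof. by move=> Ix; rewrite /extend /patch mem_set. Qed.

Lemma extendN phi x : ~ I01 x -> extend phi x = x.
Proof. by move=> Ix; rewrite /extend /patch memNset. Qed.

Lemma measurable_extend phi : mp_bij phi -> measurable_fun setT (extend phi).
Proof.
move=> [_ mphi _]; rewrite -(setUv I01); apply/measurable_funU => //.
  exact: measurableC.
split.
  by apply: eq_measurable_fun mphi => x; rewrite inE => /(extendE phi) ->.
apply: (@eq_measurable_fun _ _ _ _ _ id); last exact: measurable_id.
by move=> x; rewrite inE => /(extendN phi) ->.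
Qed.

Lemma leb_extend phi A : mp_bij phi -> measurable A -> leb R (extend phi @^-1` A) = leb R A.
Proof.
move=> mpphi mA; have [_ mphi pphi] := mpphi.
have mAI : measurable (A `&` I01) by exact: measurableI.
have -> : extend phi @^-1` A = (I01 `&` phi @^-1` (A `&` I01)) `|` (A `\` I01).
  apply/seteqP; split => x /=.
    have [Ix|nIx] := pselect (I01 x).
      by rewrite extendE// => Ax; left; split => //; split => //; exact: mp_bij_fun.
    by rewrite extendN// => Ax; right.
  by move=> [[Ix [Ax _]]|[Ax nIx]]; [rewrite extendE|rewrite extendN].
rewrite measureU; first last.
- by apply/seteqP; split => // x [[Ix _] []].
- exact: measurableD.
- exact: mphi.
rewrite [RHS](measureDI _ mA (@measurable_unit_itv R)) addeC.
by congr (_ + _)%E; exact: (pphi _ mAI (@subIsetr _ _ _)).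
Qed.

Definition extend2 phi (z : plane) : plane := (extend phi z.1, extend phi z.2).

Lemma measurable_extend2 phi : mp_bij phi -> measurable_fun setT (extend2 phi).
Proof.
move=> mp; apply: measurable_fun_pair.
  exact: (measurableT_comp (measurable_extend mp) measurable_fst).
exact: (measurableT_comp (measurable_extend mp) measurable_snd).
Qed.

(** By uniqueness of the product measure it is enough to look at rectangles. *)
Lemma leb2_extend2 phi (A : set plane) : mp_bij phi -> measurable A ->
  leb2 R (extend2 phi @^-1` A) = leb2 R A.
Proof.
move=> mp mA; have mE := measurable_extend2 mp.
pose m' := measure_function_pushforward__canonical__measure_function_Measure (leb2 R) mE.
have := @product_measure_unique _ _ (mR R) (mR R) R (@lebesgue_measure R) (@lebesgue_measure R) m'.
move=> h; apply/esym; apply: (h _ A mA) => B C mB mC.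
transitivity (leb2 R ((extend phi @^-1` B) `*` (extend phi @^-1` C))) => //.
have mpre (D : set (mR R)) : measurable D -> measurable (extend phi @^-1` D).
  by move=> mD; rewrite -[X in measurable X]setTI; exact: measurable_extend.
by rewrite leb2X; [rewrite (leb_extend mp mB) (leb_extend mp mC)|exact: mpre|exact: mpre].
Qed.

Lemma extend2_sq phi : mp_bij phi -> extend2 phi @^-1` sq = sq.
Proof.
move=> mp; have H x : I01 (extend phi x) <-> I01 x.
  have [Ix|nIx] := pselect (I01 x); first by rewrite extendE//; split=> // _; exact: mp_bij_fun.
  by rewrite extendN.
by apply/seteqP; split => -[x y] [/= /H ? /H ?].
Qed.

Lemma bounded_meas_pull phi f : mp_bij phi -> bounded_meas f -> bounded_meas (pull phi f).
Proof.
move=> mp [mf [B fB]]; split; last first.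
  by exists B => -[x y] [/= Ix Iy]; apply: fB; split; exact: mp_bij_fun.
apply: (@eq_measurable_fun _ _ _ _ _ (f \o extend2 phi)).
  by move=> [x y]; rewrite inE => -[/= Ix Iy]; rewrite /pull /extend2 /= !extendE.
apply: (measurable_comp (F := sq)) => //.
  by move=> _ [z zs <-]; have : (extend2 phi @^-1` sq) z by rewrite extend2_sq.
exact: measurable_funTS (measurable_extend2 mp).
Qed.

Lemma L1norm_pull phi f : mp_bij phi -> bounded_meas f -> L1norm (pull phi f) = L1norm f.
Proof.
move=> mp bf; rewrite /L1norm /Rintegral; congr fine.
have mE := measurable_extend2 mp.
transitivity (\int[pushforward (leb2 R) (extend2 phi)]_(z in sq) (`|f z|)%:E)%E.
  rewrite ge0_integral_pushforward//; last by have /measurable_EFinP := (bounded_meas_norm bf).1.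
  rewrite extend2_sq//; apply: eq_integral => -[x y]; rewrite inE => -[/= Ix Iy].
  by rewrite /pull /extend2 /= !extendE.
apply: eq_measure_integral => A mA _; exact: leb2_extend2.
Qed.

(** Reduces statements on systems of weights, such as the masses in the
    preimages of the cells, to statements on sets. *)
Lemma subset_with_cell_meas N (sigma : 'I_N -> R) : (0 < N)%N ->
  (forall i, 0 <= sigma i <= N%:R^-1) ->
  exists S', [/\ measurable S', S' `<=` I01 & forall i : 'I_N, cell_meas N S' i = sigma i].
Proof.
move=> N0 hs; have N0R : 0 < N%:R :> R by rewrite ltr0n.
pose P (i : 'I_N) := cell R N i `&` `]-oo, (i%:R / N%:R + sigma i)]%classic.
have mP i : measurable (P i) by apply: measurableI => //; exact: measurable_itv.
exists (\bigcup_(i in [set: 'I_N]) P i); split.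
- by apply: fin_bigcup_measurable.
- by move=> x [i _ [/(cell_sub N0)]].
move=> i; have /andP[s0 s1] := hs i; rewrite /cell_meas.
have -> : \bigcup_(i in [set: 'I_N]) P i `&` cell R N i =
    [set` if i == 0%N :> nat then `[0, sigma i] else `]i%:R / N%:R, i%:R / N%:R + sigma i]].
  apply/seteqP; split => [x [[j _ [jx xj]] ix]|x xP].
    have {jx} ji : j = i by apply: val_inj; exact: cell_inj jx ix.
    rewrite ji /= in_itv /= in xj; move/cellE : ix => /andP[+ _].
    case: ifPn => [/eqP i0 x0|_ ix]; rewrite /= in_itv /=.
      by move: xj; rewrite i0 mul0r add0r x0.
    by rewrite ix xj.
  suff ix : cell R N i x /\ x <= i%:R / N%:R + sigma i.
    by case: ix => ix xi; split => //; exists i => //; split => //; rewrite /= in_itv.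
  have -> : cell R N i x <-> (if i == 0%N :> nat then 0 <= x else i%:R / N%:R < x) && (x <= i.+1%:R / N%:R) by exact: cellE.
  have -> : i.+1%:R / N%:R = i%:R / N%:R + N%:R^-1 :> R by rewrite -addn1 natrD mulrDl mul1r.
  move: xP; case: ifPn => [/eqP -> |_]; rewrite /= in_itv /= => /andP[h1 h2].
    by rewrite h1 mul0r !add0r h2; split => //; exact: le_trans h2 _.
  by rewrite h1 h2; split => //; apply: le_trans h2 _; rewrite lerD2l.
transitivity (fine (@lebesgue_measure R [set` if i == 0%N :> nat then `[0, sigma i] else `]i%:R / N%:R, i%:R / N%:R + sigma i]])) => //.
case: ifPn => _; rewrite lebesgue_measure_itv /=.
  rewrite lte_fin; move: s0; rewrite le_eqVlt => /orP[/eqP <-|s0]; first by rewrite ltxx.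
  by rewrite s0 /= oppr0 addr0.
rewrite lte_fin; move: s0; rewrite le_eqVlt => /orP[/eqP <-|s0]; first by rewrite addr0 ltxx.
by rewrite ltrDl s0 /= addrAC subrr add0r.
Qed.

(** Up to a small L1 error f is a step function. The integral over S x T of
    such a function composed with phi depends on the masses of S and T in the
    preimages of the cells; these are at most 1/N, so S' and T' with the same
    masses in the cells themselves give the same integral. *)
Lemma cut_le_pull phi f e : mp_bij phi -> bounded_meas f -> cut_le f e ->
  cut_le (pull phi f) e.
Proof.
move=> mp bf fe S T mS mT SI TI; apply/ler_addgt0Pr => d d0.
have d2 : 0 < d / 2 by rewrite divr_gt0.
have [N hN] := step_dense bf d2.
have N0 := ltn0Sn N; have [a fa] := hN _ (leqnSn N).
move: N.+1 N0 a fa {hN} => {}N N0 a fa.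
have ba := bounded_meas_step a; have bp := bounded_meas_pull mp bf.
have bpa := bounded_meas_pull mp ba.
have mST := measurableX mS mT; have STq := setSX TI SI.
have hpre U (i : 'I_N) : measurable U -> U `<=` I01 ->
    measurable (U `&` phi @^-1` cell R N i) /\
    0 <= fine (leb R (U `&` phi @^-1` cell R N i)) <= N%:R^-1.
  move=> mU UI.
  have E : U `&` phi @^-1` cell R N i = U `&` (I01 `&` phi @^-1` cell R N i).
    by rewrite setIA (setIidl UI).
  have mpre := measurable_preim mp (measurable_cell N i).
  have mm : measurable (U `&` phi @^-1` cell R N i) by rewrite E; exact: measurableI.
  split => //; have le : (leb R (U `&` phi @^-1` cell R N i) <= (N%:R^-1)%:E)%E.
    have [_ _ pphi] := mp; have ci : cell R N i `<=` I01 by exact: cell_sub.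
    rewrite -(leb_cell R N0 i) -(pphi _ (@measurable_cell R N i) ci).
    by apply: le_measure; rewrite ?inE// E; exact: subIsetr.
  have fin : leb R (U `&` phi @^-1` cell R N i) \is a fin_num by apply: leb_sub_fin => // x [/UI].
  by rewrite fine_ge0//= -lee_fin fineK.
have [S' [mS' SI' hS']] := subset_with_cell_meas N0 (fun i => (hpre S i mS SI).2).
have [T' [mT' TI' hT']] := subset_with_cell_meas N0 (fun i => (hpre T i mT TI).2).
have key : \int[leb2 R]_(z in S `*` T) pull phi (step a) z = \int[leb2 R]_(z in S' `*` T') step a z.
  rewrite (int_step N0)//; under [RHS]eq_bigr do under eq_bigr do rewrite hS' hT'.
  have bij (i j : 'I_N) : bounded_meas (pull phi (\1_(cell R N i `*` cell R N j))).
    by apply: bounded_meas_pull => //; apply: bounded_meas_indic; exact: measurableX.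
  rewrite /pull /step Rint_sum//; last first.
    move=> i; apply: bounded_meas_sum => j; apply: bounded_measM => //; last exact: bij.
    exact: bounded_meas_cst.
  apply: eq_bigr => i _; rewrite Rint_sum//; last first.
    by move=> j; apply: bounded_measM => //; [exact: bounded_meas_cst|exact: bij].
  apply: eq_bigr => j _; rewrite RintegralZl//; last by apply: bounded_meas_integrable => //; exact: bij.
  congr (_ * _).
  have [m1 /andP[l1 u1]] := hpre S i mS SI; have [m2 /andP[l2 u2]] := hpre T j mT TI.
  pose D := (S `&` phi @^-1` cell R N i) `*` (T `&` phi @^-1` cell R N j).
  transitivity (\int[leb2 R]_(z in S `*` T) \1_D z).
    apply: eq_Rintegral => -[x y]; rewrite inE => -[/= Sx Ty].
    rewrite !indicE; congr (nat_of_bool _)%:R; apply/idP/idP; rewrite !inE /D /=.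
      by move=> [/= ? ?].
    by move=> [/= [_ ?] [_ ?]].
  rewrite Rint_indic//; last exact: measurableX.
  rewrite setIidl; last by move=> [x y] [/= [? _] [? _]].
  rewrite leb2X// fineM//; first by apply: leb_sub_fin => // x [/SI].
  by apply: leb_sub_fin => // x [/TI].
have h1 : `|\int[leb2 R]_(z in S `*` T) pull phi f z - \int[leb2 R]_(z in S `*` T) pull phi (step a) z| <= d / 2.
  rewrite -RintegralB//; [|exact: bounded_meas_integrable..].
  apply: le_trans (normr_int_le_L1norm mST STq (bounded_measB bp bpa)) _.
  by rewrite -[X in X <= _](L1norm_pull mp (bounded_measB bf ba)) in fa.
have h2 : `|\int[leb2 R]_(z in S' `*` T') f z - \int[leb2 R]_(z in S' `*` T') step a z| <= d / 2.
  have mST' := measurableX mS' mT'; have STq' := setSX TI' SI'.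
  rewrite -RintegralB//; [|exact: bounded_meas_integrable..].
  exact: le_trans (normr_int_le_L1norm mST' STq' (bounded_measB bf ba)) fa.
have h3 := fe S' T' mS' mT' SI' TI'.
rewrite key in h1.
have aux (X Y Z : R) : `|X - Y| <= d / 2 -> `|Z - Y| <= d / 2 -> `|Z| <= e -> `|X| <= e + d.
  by rewrite !ler_norml => /andP[? ?] /andP[? ?] /andP[? ?]; lra.
exact: aux h1 h2 h3.
Qed.

Section metric.
Implicit Types F G H : graphon R.

Lemma bounded_meas_pull_graphon phi G : mp_bij phi -> bounded_meas (pull phi G).
Proof. by move=> mp; apply: bounded_meas_pull => //; exact: bounded_meas_graphon. Qed.

Let has_inf_metric F G : has_inf [set cut_dist F (pull phi G) | phi in @mp_bij R].
Proof.
split; first by exists (cut_dist F (pull id G)), id => //; exact: mp_bij_id.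
exists 0 => _ [phi mp <-]; apply: cut_dist_ge0; first exact: bounded_meas_graphon.
exact: bounded_meas_pull_graphon.
Qed.

Lemma cut_metric_le F G phi e : 0 <= e -> mp_bij phi ->
  cut_le (fun z => F z - pull phi G z) e -> cut_metric F G <= e.
Proof.
move=> e0 mp h; apply: le_trans (cut_dist_le e0 h).
have [_ lb] := has_inf_metric F G.
by apply: ge_inf => //; exists phi.
Qed.

Lemma cut_metric_ge0 F G : 0 <= cut_metric F G.
Proof.
apply: lb_le_inf; first by case: (has_inf_metric F G).
move=> _ [phi mp <-]; apply: cut_dist_ge0; first exact: bounded_meas_graphon.
exact: bounded_meas_pull_graphon.
Qed.

Lemma cut_metric_lt F G e : cut_metric F G < e ->
  exists2 phi, mp_bij phi & cut_le (fun z => F z - pull phi G z) e.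
Proof.
move=> /inf_lt[|_ [phi mp <-] /ltW le]; first by case: (has_inf_metric F G).
exists phi => //; apply: cut_leW le _; apply: cut_le_dist; first exact: bounded_meas_graphon.
exact: bounded_meas_pull_graphon.
Qed.

(** The maps that nearly realize the two distances are composed. By
    [cut_le_pull] the second estimate survives composition with the first map,
    so that inverses of measure-preserving maps do not occur. *)
Lemma cut_metric_tri F G H : cut_metric F H <= cut_metric F G + cut_metric G H.
Proof.
apply/ler_addgt0Pr => d d0; have d2 : 0 < d / 2 by rewrite divr_gt0.
have [phi mphi hphi] := @cut_metric_lt F G (cut_metric F G + d / 2) ltac:(lra).
have [psi mpsi hpsi] := @cut_metric_lt G H (cut_metric G H + d / 2) ltac:(lra).
rewrite [d in leRHS]splitr addrACA.
have g1 := cut_metric_ge0 F G; have g2 := cut_metric_ge0 G H.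
have e1 : 0 <= cut_metric F G + d / 2 by exact: addr_ge0 g1 (ltW d2).
have e2 : 0 <= cut_metric G H + d / 2 by exact: addr_ge0 g2 (ltW d2).
have mpc := mp_bij_comp mpsi mphi.
apply: (cut_metric_le (addr_ge0 e1 e2) mpc).
have bF := bounded_meas_graphon F; have bG := bounded_meas_graphon G.
have bH := bounded_meas_pull_graphon H mpsi.
have bG' := bounded_meas_pull_graphon G mphi.
have bH' := bounded_meas_pull_graphon H mpc.
apply: (cut_le_tri bF bG' bH' hphi).
exact: (cut_le_pull mphi (bounded_measB bG bH) hpsi).
Qed.

Lemma cut_metric_refl F : cut_metric F F = 0.
Proof.
apply/eqP; rewrite eq_le cut_metric_ge0 andbT.
apply: (@cut_metric_le F F id); [exact: lexx|exact: mp_bij_id|].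
move=> S T mS mT SI TI; rewrite (@eq_Rintegral _ _ _ _ _ (cst 0)).
  by rewrite Rintegral_cst ?mul0r ?normr0//; exact: measurableX.
by move=> -[x y] _; rewrite /pull /= subrr.
Qed.

(** The two directions replace the symmetry of the cut metric. *)
Lemma class_repr_sim F : cut_metric F (class_repr (to_class F)) = 0 /\
  cut_metric (class_repr (to_class F)) F = 0.
Proof.
rewrite /class_repr; case: cid => G /= E; split.
  have : [set g | graphon_sim G g] G by exact: cut_metric_refl.
  by rewrite -E.
have : [set g | graphon_sim F g] F by exact: cut_metric_refl.
by rewrite E.
Qed.

End metric.

End measure_preserving.

(** * Completeness of the cut norm *)

Section ultralimit.
Variables (R : realType) (G : set_system nat).
Context {uG : UltraFilter G}.

(** The limit along the ultrafilter G of a bounded sequence. *)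
Definition ulim (u : nat -> R) : R := sup [set r | G [set j | r <= u j]].

(** Either ulim u + e <= u j for G-many j or the opposite inequality holds for
    G-many j; the first contradicts the definition as a supremum. *)
Lemma ulimP (u : nat -> R) a b : (forall j, a <= u j <= b) -> u @ G --> ulim u.
Proof.
move=> ub; pose E := [set r | G [set j | r <= u j]].
have hsE : has_sup E.
  split; first by exists a; apply: filterS filterT => j _ /=; case/andP: (ub j).
  exists b => r Gr; rewrite leNgt; apply/negP => br.
  have /filter_ex[j /= rj] := Gr.
  by have := lt_le_trans br rj; rewrite ltNge; case/andP: (ub j) => _ ->.
apply/cvgrPdist_le => e e0.
have [r Gr hr] := sup_adherent e0 hsE.
have nG : ~ E (ulim u + e).
  by move=> /(sup_upper_bound hsE); rewrite gerDl leNgt e0.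
have [//|Gn] := in_ultra_setVsetC (F := G) [set j | ulim u + e <= u j].
apply: filterS2 Gr Gn => j /= rj /negP; rewrite -ltNge => uj.
rewrite ler_norml; apply/andP; split; first by rewrite lerBrDl; lra.
have := lt_le_trans hr rj; rewrite -/(ulim u); lra.
Qed.

Lemma ulim_unique (u : nat -> R) l : u @ G --> l -> (exists a b, forall j, a <= u j <= b) -> ulim u = l.
Proof.
by move=> ul [a [b ab]]; apply: (cvg_unique _ _ ul); [exact: norm_hausdorff|exact: ulimP ab].
Qed.

Lemma ulim_le (u : nat -> R) a b c : (forall j, a <= u j <= b) ->
  G [set j | u j <= c] -> ulim u <= c.
Proof.
move=> ub Gc; have h := ulimP ub.
rewrite -(cvg_lim _ h); last exact: norm_hausdorff.
by apply: limr_le => //; apply/cvg_ex; exists (ulim u).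
Qed.

Lemma ulim_ge (u : nat -> R) a b c : (forall j, a <= u j <= b) ->
  G [set j | c <= u j] -> c <= ulim u.
Proof.
move=> ub Gc; have h := ulimP ub.
rewrite -(cvg_lim _ h); last exact: norm_hausdorff.
by apply: limr_ge => //; apply/cvg_ex; exists (ulim u).
Qed.

Lemma ulimD (u v : nat -> R) a b a' b' : (forall j, a <= u j <= b) ->
  (forall j, a' <= v j <= b') -> ulim (fun j => u j + v j) = ulim u + ulim v.
Proof.
move=> hu hv; apply: ulim_unique.
  exact: cvgD (ulimP hu) (ulimP hv).
exists (a + a'), (b + b') => j; have /andP[? ?] := hu j; have /andP[? ?] := hv j.
by rewrite !lerD.
Qed.

End ultralimit.

Section completeness.
Variable R : realType.
Local Notation I01 := (unit_itv R).
Local Notation sq := (unit_sq R).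
Local Notation plane := (mR R * mR R)%type.
Implicit Types (f g : plane -> mR R) (S T : set (mR R)).

Definition swap (z : plane) : plane := (z.2, z.1).

Lemma measurable_swap : measurable_fun setT swap.
Proof. by apply: measurable_fun_pair. Qed.

Lemma leb2_swap (A : set plane) : measurable A -> leb2 R (swap @^-1` A) = leb2 R A.
Proof.
move=> mA.
pose m' := measure_function_pushforward__canonical__measure_function_Measure (leb2 R) measurable_swap.
have := @product_measure_unique _ _ (mR R) (mR R) R (@lebesgue_measure R) (@lebesgue_measure R) m'.
move=> h; apply/esym; apply: (h _ A mA) => B C mB mC.
transitivity (leb2 R (C `*` B)).
  by congr (leb2 R _); apply/seteqP; split => -[x y] [/= ? ?].
by rewrite leb2X// muleC.
Qed.

Lemma int_swap f S T : measurable S -> measurable T -> S `<=` I01 -> T `<=` I01 ->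
  bounded_meas f -> (forall z, sq z -> 0 <= f z) ->
  \int[leb2 R]_(z in S `*` T) f (swap z) = \int[leb2 R]_(z in T `*` S) f z.
Proof.
move=> mS mT SI TI bf f0; rewrite /Rintegral; congr fine.
have mST := measurableX mT mS; have STq := setSX SI TI.
transitivity (\int[pushforward (leb2 R) swap]_(z in T `*` S) (f z)%:E)%E.
  rewrite ge0_integral_pushforward//.
  - congr integral; apply/seteqP; split => -[x y] [/= ? ?]; by split.
  - exact: measurable_swap.
  - by apply/measurable_EFinP; apply: measurable_funS bf.1.
  - by move=> z; rewrite inE => /STq /f0; rewrite lee_fin.
have mE := measurable_swap; by apply: eq_measure_integral => A mA _; exact: (leb2_swap mA).
Qed.

Lemma leb2_sigma_finite : sigma_finite setT (leb2 R).
Proof.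
pose J (n : nat) : set (mR R) := `[- n%:R, n%:R]%classic.
have mJ n : measurable (J n) by exact: measurable_itv.
exists (fun n => J n `*` J n).
  apply/seteqP; split => // -[x y] _.
  exists (Num.bound (`|x| + `|y|)) => //=.
  have h : `|x| + `|y| < (Num.bound (`|x| + `|y|))%:R by apply: archi_boundP; exact: addr_ge0.
  rewrite /J /= !in_itv /= -!ler_norml; split; apply: ltW; apply: le_lt_trans h.
    by rewrite lerDl.
  by rewrite lerDr.
move=> n; split; first exact: measurableX.
have fJ : leb R (J n) \is a fin_num.
  rewrite (_ : leb R (J n) = @lebesgue_measure R (J n))// lebesgue_measure_itv /=.
  by case: ifP.
by rewrite leb2X// ltey_eq fin_numM.
Qed.

(** A copy of the plane measure that carries the sigma-finite structure
    required by the Radon-Nikodym theorem. *)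
Definition plane_measure : set plane -> \bar R := leb2 R.

HB.instance Definition _ := isMeasure.Build _ plane R plane_measure
  (measure0 (leb2 R)) (measure_ge0 (leb2 R)) (@measure_semi_sigma_additive _ _ _ (leb2 R)).

HB.instance Definition _ := Measure_isSigmaFinite.Build _ plane R plane_measure
  leb2_sigma_finite.

Section limit.
Variables (w : nat -> plane -> mR R) (G : set_system nat).
Context {uG : UltraFilter G}.
Hypothesis w_meas : forall j, measurable_fun sq (w j).
Hypothesis w_itv : forall j z, sq z -> 0 <= w j z <= 1.

Let bw j : bounded_meas (w j). Proof. exact: bounded_meas_itv (w_meas j) (w_itv j). Qed.

Let u (B : set plane) (j : nat) : R := \int[leb2 R]_(z in B `&` sq) w j z.

Let m (B : set plane) : R := fine (leb2 R (B `&` sq)).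

Let mI (B : set plane) : measurable B -> measurable (B `&` sq).
Proof. by move=> mB; exact: measurableI. Qed.

Let u_itv B j : measurable B -> 0 <= u B j <= m B.
Proof.
move=> mB; apply/andP; split.
  by apply: Rintegral_ge0 => z [_ /(w_itv j)/andP[]].
rewrite -[m B]mul1r -Rintegral_cst; last exact: mI.
apply: le_Rintegral; first exact: mI.
- by apply: bounded_meas_integrable => //; exact: mI.
- by apply: bounded_meas_integrable => //; [exact: mI|exact: bounded_meas_cst].
- by move=> z [_ /(w_itv j)/andP[]].
Qed.

Let nuR (B : set plane) : R := ulim G (u B).

Let nuR_itv B : measurable B -> 0 <= nuR B <= m B.
Proof.
move=> mB; apply/andP; split.
  by apply: (ulim_ge (fun j => u_itv j mB)); apply: filterS filterT => j _ /=; case/andP: (u_itv j mB).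
by apply: (ulim_le (fun j => u_itv j mB)); apply: filterS filterT => j _ /=; case/andP: (u_itv j mB).
Qed.

Let nuRU A B : measurable A -> measurable B -> A `&` B = set0 ->
  nuR (A `|` B) = nuR A + nuR B.
Proof.
move=> mA mB AB; rewrite /nuR -(ulimD (fun j => u_itv j mA) (fun j => u_itv j mB)).
congr ulim; apply/funext => j; rewrite /u setIUl Rintegral_setU//; try exact: mI.
  apply: bounded_meas_integrable => //; first by apply: measurableU; exact: mI.
  by move=> z [] [].
apply/disj_setPS => z [[Az _] [Bz _]].
by have : (A `&` B) z by []; rewrite AB.
Qed.

(** The ultralimit of the measures of density w j on the square. The absolute
    value changes nothing on measurable sets and keeps the function nonnegative
    on the other ones. *)
Definition limit_measure (B : set plane) : \bar R := `|nuR B|%:E.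

Let nuE B : measurable B -> limit_measure B = (nuR B)%:E.
Proof. by move=> mB; rewrite /limit_measure ger0_norm//; case/andP: (nuR_itv mB). Qed.

Let limit_measure0 : limit_measure set0 = 0%E.
Proof.
rewrite nuE//; congr (_%:E); apply/eqP; rewrite eq_le.
have := nuR_itv measurable0; rewrite /m set0I measure0 /= => /andP[-> ->]//.
Qed.

Let limit_measure_ge0 B : (0 <= limit_measure B)%E.
Proof. by rewrite lee_fin. Qed.

Let limit_measure_sigma_additive : semi_sigma_additive limit_measure.
Proof.
move=> F mF tF mUF; rewrite nuE//.
have nuS n : nuR (\big[setU/set0]_(i < n) F i) = \sum_(0 <= i < n) nuR (F i).
  elim: n => [|n IH].
    rewrite big_ord0 big_nil; have := nuR_itv measurable0.
    by rewrite /m set0I measure0 /= -eq_le => /eqP.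
  rewrite big_ord_recr big_nat_recr//= -IH nuRU//; first exact: bigsetU_measurable.
  apply/seteqP; split => // z [].
  rewrite -bigcup_mkord => -[i /= ltin Fiz] Fnz.
  have /trivIsetP/(_ i n I I) := tF; rewrite neq_ltn ltin => /(_ isT) e.
  by have : (F i `&` F n) z by []; rewrite e.
rewrite (_ : (fun n => _) = EFin \o (fun n => \sum_(0 <= i < n) nuR (F i))); last first.
  by apply/funext => n /=; rewrite -sumEFin; apply: eq_bigr => i _; exact: nuE.
apply: cvg_EFin; first by apply: nearW.
rewrite (_ : fine \o _ = (fun n => \sum_(0 <= i < n) nuR (F i)))//.
(* nu is at most the Lebesgue measure, so it is small on the tails E n *)
pose E n := (\bigcup_i F i `\` \big[setU/set0]_(i < n) F i) `&` sq.
have mB n : measurable (\big[setU/set0]_(i < n) F i) by exact: bigsetU_measurable.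
have mE n : measurable (E n) by apply: measurableI => //; exact: measurableD.
have ndE : nonincreasing_seq E.
  move=> k n kn; apply/subsetPset => x [[Fx Ux] sx]; split => //; split => //.
  by apply: contra_not Ux; apply: subset_bigsetU.
have E0 : \bigcap_n E n = set0.
  apply/seteqP; split => // x Ex; have [[[n _ Fn] _] _] := Ex 0%N I.
  have [[_ +] _] := Ex n.+1 I; apply; rewrite big_ord_recr; by right.
have muE0 : (leb2 R (E 0%N) < +oo)%E by apply: leb2_sub_fin => //; exact: subIsetr.
have := nonincreasing_cvg_mu muE0 mE; rewrite E0 measure0 => /(_ measurable0 ndE) cv.
have /fine_cvgP[_ /cvgrPdist_le cv'] := cv.
apply/cvgrPdist_le => e e0; have := cv' e e0; apply: filterS => n /=.
rewrite -nuS sub0r normrN => hn; apply: le_trans hn.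
have mD : measurable (\bigcup_i F i `\` \big[setU/set0]_(i < n) F i) by exact: measurableD.
have sub : \big[setU/set0]_(i < n) F i `<=` \bigcup_i F i.
  by rewrite -bigcup_mkord; apply: bigcup_sub => i _; exact: bigcup_sup.
have -> : nuR (\bigcup_i F i) = nuR (\big[setU/set0]_(i < n) F i) + nuR (\bigcup_i F i `\` \big[setU/set0]_(i < n) F i).
  rewrite -nuRU//; first by rewrite setDUK.
  by apply/seteqP; split => // z [? []].
rewrite addrAC subrr add0r; have /andP[h1 h2] := nuR_itv mD.
by rewrite ger0_norm// (le_trans h2)// ler_norm.
Qed.

HB.instance Definition _ := isMeasure.Build _ plane R limit_measure
  limit_measure0 limit_measure_ge0 limit_measure_sigma_additive.

Let limit_measure_fin : fin_num_fun limit_measure.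
Proof. by []. Qed.

HB.instance Definition _ := Measure_isFinite.Build _ plane R limit_measure limit_measure_fin.

(** The ultralimit is dominated by the Lebesgue measure, and g is its
    Radon-Nikodym derivative. *)
Lemma limit_density : exists g : plane -> mR R,
  [/\ measurable_fun setT g, (leb2 R).-integrable setT (EFin \o g) &
   forall A, measurable A -> A `<=` sq ->
     (0 <= \int[leb2 R]_(z in A) g z <= fine (leb2 R A)) /\
     \int[leb2 R]_(z in A) g z = ulim G (fun j => \int[leb2 R]_(z in A) w j z)].
Proof.
pose mu := [the {sigma_finite_measure set plane -> \bar R} of plane_measure].
pose nu := [the {charge set plane -> \bar R} of charge_of_finite_measure limit_measure].
have dom : null_dominates mu nu.
  apply/null_content_dominatesP => A mA A0.
  have hA : limit_measure A = 0%E.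
    rewrite nuE//; have /andP[h1 h2] := nuR_itv mA.
    congr (_%:E); apply/eqP; rewrite eq_le h1 andbT (le_trans h2)// /m.
    rewrite (_ : leb2 R _ = 0%E)//; apply/eqP; rewrite eq_le measure_ge0 andbT.
    have A0' : leb2 R A = 0%E by [].
    by rewrite -A0'; apply: le_measure; rewrite ?inE//; exact: mI.
  exact: hA.
pose g0 := Radon_Nikodym nu mu.
have ig0 : (leb2 R).-integrable setT g0 by have h := Radon_Nikodym_integrable dom.
have fing z : g0 z \is a fin_num by exact: (Radon_Nikodym_fin_num z dom).
have g0E : EFin \o (fine \o g0) = g0 by apply/funext => z /=; rewrite fineK.
exists (fine \o g0); split.
- apply/measurable_EFinP; rewrite g0E; exact: measurable_int ig0.
- by rewrite g0E.
- move=> A mA Asq.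
  have E : \int[leb2 R]_(z in A) (fine \o g0) z = nuR A.
    have : nu A = (\int[leb2 R]_(z in A) g0 z)%E by exact: (Radon_Nikodym_integral dom mA).
    move=> h; transitivity (fine (nu A)); last by rewrite -[nu A]/(limit_measure A) nuE.
    by rewrite h /Rintegral; congr fine; apply: eq_integral => z _; rewrite /= fineK.
  rewrite E; split; first by have := nuR_itv mA; rewrite /m setIidl.
  by rewrite /nuR /u setIidl.
Qed.

End limit.

Lemma Rint_setID f A P : measurable A -> measurable P ->
  (leb2 R).-integrable A (EFin \o f) ->
  \int[leb2 R]_(z in A) f z = \int[leb2 R]_(z in A `&` P) f z + \int[leb2 R]_(z in A `\` P) f z.
Proof.
move=> mA mP fi; have E : A = (A `&` P) `|` (A `\` P).
  apply/seteqP; split => z; last by case=> [] [].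
  by have [Pz|nPz] := pselect (P z) => Az; [left|right].
rewrite {1}E Rintegral_setU//.
- exact: measurableI.
- exact: measurableD.
- by rewrite -E.
by apply/disj_setPS => z [[_ ?] [_ ?]].
Qed.

(** Along an ultrafilter the integrals of the functions over every set
    converge, and the density of the limit measure, clipped to [0, 1] and
    symmetrized, is the limit: the distance to w j over S x T is an ultralimit
    of distances between w i and w j, uniformly small by the Cauchy
    property. *)
Theorem cut_complete (w : nat -> plane -> mR R) :
  (forall j, measurable_fun sq (w j)) ->
  (forall j z, sq z -> 0 <= w j z <= 1) ->
  (forall j x y, sq (x, y) -> w j (x, y) = w j (y, x)) ->
  (forall e, 0 < e -> exists M, forall i j, (M <= i)%N -> (M <= j)%N ->
     cut_le (fun z => w i z - w j z) e) ->
  exists g : graphon R, forall e, 0 < e -> exists M, forall j, (M <= j)%N ->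
    cut_le (fun z => g z - w j z) e.
Proof.
move=> w_meas w_itv w_sym w_cauchy.
have bw j := bounded_meas_itv (w_meas j) (w_itv j).
have [G [uG Goo]] := @ultraFilterLemma nat \oo _.
have [g [mg ig hg]] := limit_density w_meas w_itv.
have igA A : measurable A -> (leb2 R).-integrable A (EFin \o g).
  by move=> mA; apply: integrableS ig => //; exact: measurableT.
(* the density lies in [0, 1] only almost everywhere, hence the clipping *)
pose c z : mR R := Num.min 1 (Num.max 0 (g z)).
have c01 z : 0 <= c z <= 1.
  by rewrite /c le_min ler01 le_max lexx /= ge_min lexx.
have mc : measurable_fun setT c.
  apply: measurable_minr; first exact: measurable_cst.
  by apply: measurable_maxr => //; exact: measurable_cst.
have bc : bounded_meas c by apply: bounded_meas_itv => //; exact: measurable_funTS.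
pose P1 : set plane := g @^-1` `[1, +oo[%classic.
pose P0 : set plane := g @^-1` `]-oo, 0]%classic.
have mP1 : measurable P1 by rewrite -[P1]setTI; apply: mg => //; exact: measurable_itv.
have mP0 : measurable P0 by rewrite -[P0]setTI; apply: mg => //; exact: measurable_itv.
have int_c A : measurable A -> A `<=` sq -> \int[leb2 R]_(z in A) c z = \int[leb2 R]_(z in A) g z.
  move=> mA Asq; have ic := bounded_meas_integrable mA Asq bc.
  have mA1 : measurable (A `&` P1) by exact: measurableI.
  have mA' : measurable (A `\` P1) by exact: measurableD.
  have mA0 : measurable ((A `\` P1) `&` P0) by exact: measurableI.
  have mA2 : measurable (A `\` P1 `\` P0) by exact: measurableD.
  have sA' : A `\` P1 `<=` sq by move=> z [/Asq].
  have sA1 : A `&` P1 `<=` sq by move=> z [/Asq].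
  have sA0 : (A `\` P1) `&` P0 `<=` sq by move=> z [[/Asq]].
  rewrite (Rint_setID mA mP1 ic) (Rint_setID mA mP1 (igA _ mA)).
  rewrite (Rint_setID mA' mP0 (bounded_meas_integrable mA' sA' bc)).
  rewrite (Rint_setID mA' mP0 (igA _ mA')).
  congr (_ + (_ + _)).
  - transitivity (fine (leb2 R (A `&` P1))).
      rewrite -[RHS]mul1r -Rintegral_cst//; apply: eq_Rintegral => z; rewrite inE => -[_].
      by rewrite /P1 /= in_itv /= andbT /c => h; rewrite max_r ?min_l// (le_trans ler01).
    apply/eqP; rewrite eq_le; have [/andP[_ ->] _] := hg _ mA1 sA1; rewrite andbT.
    rewrite -[leLHS]mul1r -Rintegral_cst//; apply: le_Rintegral => //.
    + by apply: bounded_meas_integrable => //; exact: bounded_meas_cst.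
    + exact: igA.
    + by move=> z [_]; rewrite /P1 /= in_itv /= andbT.
  - transitivity (0 : R).
      rewrite -[RHS](mul0r (fine (leb2 R ((A `\` P1) `&` P0)))) -Rintegral_cst//.
      apply: eq_Rintegral => z; rewrite inE => -[_].
      by rewrite /P0 /= in_itv /= /c => h; rewrite max_l// min_r.
    apply/eqP; rewrite eq_le; have [/andP[-> _] _] := hg _ mA0 sA0; rewrite /=.
    rewrite -[leRHS](mul0r (fine (leb2 R ((A `\` P1) `&` P0)))) -Rintegral_cst//.
    apply: le_Rintegral => //.
    + exact: igA.
    + by apply: bounded_meas_integrable => //; exact: bounded_meas_cst.
    + by move=> z [_]; rewrite /P0 /= in_itv /=.
  - apply: eq_Rintegral => z; rewrite inE => -[[_ +]]; rewrite /P1 /P0 /= !in_itv /= andbT.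
    by move=> /negP; rewrite -ltNge => h1 /negP; rewrite -ltNge => h0; rewrite /c max_r ?min_r ?ltW.
pose f z : mR R := 2^-1 * (c z + c (swap z)).
have mcs : measurable_fun setT (c \o swap) by apply: measurableT_comp mc measurable_swap.
have mf : measurable_fun sq f.
  apply: measurable_funM; first exact: measurable_cst.
  by apply: measurable_funD; exact: measurable_funTS.
have f01 z : sq z -> 0 <= f z <= 1.
  move=> _; have := c01 z; have := c01 (swap z); rewrite /f => /andP[? ?] /andP[? ?].
  by apply/andP; split; lra.
have fsym x y : sq (x, y) -> f (x, y) = f (y, x) by move=> _; rewrite /f /swap /= addrC.
exists (Graphon mf f01 fsym) => e e0; have [M hM] := w_cauchy e e0.
exists M => j Mj S T mS mT SI TI.
have mST := measurableX mS mT; have STq := setSX TI SI.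
have mTS := measurableX mT mS; have TSq := setSX SI TI.
have u01 i : 0 <= \int[leb2 R]_(z in S `*` T) w i z <= 1.
  apply/andP; split; first by apply: Rintegral_ge0 => z /STq /(w_itv i)/andP[].
  apply: le_trans (ler_norm _) _; apply: le_trans (normr_int_le_L1norm mST STq (bw i)) _.
  by apply: L1norm_le_cst => // z /(w_itv i)/andP[h1 h2]; rewrite ger0_norm.
have c_ST : \int[leb2 R]_(z in S `*` T) f z = ulim G (fun i => \int[leb2 R]_(z in S `*` T) w i z).
  have bcs : bounded_meas (c \o swap).
    by apply: bounded_meas_itv => [|z _ /=]; [exact: measurable_funTS|].
  rewrite RintegralZl//; last by apply: bounded_meas_integrable => //; exact: bounded_measD.
  rewrite RintegralD//; try exact: bounded_meas_integrable.
  rewrite int_swap//; last by move=> z _; case/andP: (c01 z).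
  rewrite !int_c//; have [_ ->] := hg _ mST STq; have [_ ->] := hg _ mTS TSq.
  have -> : (fun i => \int[leb2 R]_(z in T `*` S) w i z) = (fun i => \int[leb2 R]_(z in S `*` T) w i z).
    apply/funext => i; rewrite -int_swap//; last by move=> z /(w_itv i)/andP[].
    by apply: eq_Rintegral => -[x y]; rewrite inE => /STq/w_sym ->.
  by set X := ulim _ _; lra.
have bf : bounded_meas f by exact: (bounded_meas_graphon (Graphon mf f01 fsym)).
rewrite RintegralB//; try exact: bounded_meas_integrable.
rewrite /= c_ST.
have near_e : G [set i | `|\int[leb2 R]_(z in S `*` T) w i z - \int[leb2 R]_(z in S `*` T) w j z| <= e].
  apply: Goo; exists M => //= i Mi /=.
  rewrite -RintegralB//; try exact: bounded_meas_integrable.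
  exact: hM.
rewrite ler_norml; apply/andP; split; [rewrite lerBrDl|rewrite lerBlDl].
  apply: (ulim_ge u01); apply: filterS near_e => i /=; rewrite ler_norml => /andP[h _]; lra.
apply: (ulim_le u01); apply: filterS near_e => i /=; rewrite ler_norml => /andP[_ h]; lra.
Qed.

End completeness.

(** * Permutations of the cells of a grid *)

Section sorting.
Variable N : nat.

Lemma sorting_perm (c : 'I_N -> nat) :
  exists s : 'S_N, forall i j : 'I_N, (i <= j)%N -> (c (s i) <= c (s j))%N.
Proof.
pose t := [tuple c i | i < N].
have srt : perm_eq (sort leq t) t by rewrite perm_sort.
have sz : size (sort leq t) == N by rewrite size_sort size_tuple.
have /tuple_permP[s Es] := srt.
exists s => i j ij.
have nthE (k : 'I_N) : nth 0%N (sort leq t) k = c (s k).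
  rewrite Es.
  by rewrite -[nth _ _ _](tnth_nth 0%N) !tnth_mktuple.
rewrite -!nthE; apply: (sorted_leq_nth leq_trans leqnn) => //.
- exact: (sort_sorted leq_total).
- by rewrite inE (eqP sz).
- by rewrite inE (eqP sz).
Qed.

(** Both b and its composite with s enumerate the same multiset in increasing
    order. *)
Lemma sorted_perm_fix (b : 'I_N -> nat) (s : 'S_N) :
  (forall i j : 'I_N, (i <= j)%N -> (b i <= b j)%N) ->
  (forall i j : 'I_N, (i <= j)%N -> (b (s i) <= b (s j))%N) ->
  forall i, b (s i) = b i.
Proof.
move=> hb hbs.
have srt (f : 'I_N -> nat) : (forall i j : 'I_N, (i <= j)%N -> (f i <= f j)%N) ->
    sorted leq [tuple f i | i < N].
  move=> hf; apply/(sortedP 0%N) => i; rewrite size_tuple => iN.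
  have iN' := ltn_trans (ltnSn i) iN.
  have -> : nth 0%N [tuple f i | i < N] i = f (Ordinal iN').
    by rewrite -[i]/(nat_of_ord (Ordinal iN')) -[nth _ _ _](tnth_nth 0%N) tnth_mktuple.
  have -> : nth 0%N [tuple f i | i < N] i.+1 = f (Ordinal iN).
    by rewrite -[i.+1]/(nat_of_ord (Ordinal iN)) -[nth _ _ _](tnth_nth 0%N) tnth_mktuple.
  by apply: hf => /=.
have E : [tuple b (s i) | i < N] = [tuple b i | i < N].
  apply: val_inj; apply: (sorted_eq leq_trans anti_leq).
  - exact: (srt (fun i => b (s i))).
  - exact: srt.
  apply/tuple_permP; exists s; apply: (congr1 val).
  by apply: eq_from_tnth => i; rewrite !tnth_mktuple.
by move=> i; have := congr1 (fun t => tnth t i) E; rewrite !tnth_mktuple.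
Qed.

End sorting.

Section interval_permutation.
Variable R : realType.
Local Notation I01 := (unit_itv R).
Local Notation sq := (unit_sq R).
Local Notation plane := (mR R * mR R)%type.

Lemma leb_shift (c : R) (A : set (mR R)) : measurable A ->
  leb R ((fun x => x + c) @^-1` A) = leb R A.
Proof.
move=> mA; have ms : measurable_fun setT (fun x : mR R => (x + c : mR R)).
  by apply: measurable_funD; [exact: measurable_id|exact: measurable_cst].
pose m' := measure_function_pushforward__canonical__measure_function_Measure (leb R) ms.
apply/esym; apply: (@lebesgue_measure_unique R m' _ A mA) => _ [[a b]] _ <-.
rewrite /=; transitivity (@lebesgue_measure R `]a - c, b - c]%classic); last first.
  apply: (congr1 (leb R)); apply/seteqP; split => x /=; rewrite !in_itv /= ltrBlDr lerBrDr//.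
rewrite !lebesgue_measure_itv /= !lte_fin ltrD2r; case: ifP => // _.
by rewrite -EFinB -EFinB; congr (_%:E); ring.
Qed.

(** The half-open cells avoid the point 0 of the first closed cell, so that
    they are translates of each other. *)
Definition hcell N i : set (mR R) := `]i%:R / N%:R, i.+1%:R / N%:R]%classic.

Lemma hcellP N i x : hcell N i x = (i%:R / N%:R < x <= i.+1%:R / N%:R).
Proof. by rewrite /hcell /= in_itv. Qed.

Lemma measurable_hcell N i : measurable (hcell N i).
Proof. exact: measurable_itv. Qed.

Lemma hcell_sub N i : hcell N i `<=` cell R N i.
Proof.
move=> x; rewrite hcellP => /andP[h1 h2]; apply/cellE; rewrite h2 andbT.
by case: ifP => // /eqP i0; apply: ltW; move: h1; rewrite i0 mul0r.
Qed.

Lemma cell_hcell N i x : cell R N i x -> x != 0 -> hcell N i x.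
Proof.
move=> /cellE/andP[h1 h2] x0; rewrite hcellP h2 andbT; move: h1.
case: ifP => // /eqP -> h; by rewrite mul0r lt_neqAle eq_sym x0.
Qed.

Section fixed.
Variable N : nat.
Hypothesis N0 : (0 < N)%N.
Let N0R : 0 < N%:R :> R. Proof. by rewrite ltr0n. Qed.

Lemma hcell_pos i x : hcell N i x -> 0 < x.
Proof. by rewrite hcellP => /andP[h _]; apply: le_lt_trans h; rewrite divr_ge0. Qed.

Lemma hcell_inj i j x : hcell N i x -> hcell N j x -> i = j.
Proof. by move=> /hcell_sub hi /hcell_sub hj; exact: cell_inj hi hj. Qed.

Lemma hcell_exists x : I01 x -> x != 0 -> exists i : 'I_N, hcell N i x.
Proof. by move=> /(cell_exists N0)[i ix] x0; exists i; exact: cell_hcell. Qed.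

Lemma leb_hcells (B : set (mR R)) : measurable B -> B `<=` I01 ->
  leb R B = (\sum_(i < N) leb R (B `&` hcell N i))%E.
Proof.
move=> mB BI.
have tri : trivIset setT (fun i => B `&` hcell N i).
  apply/trivIsetP => i j _ _ ij; apply/seteqP; split => // x [[_ ix] [_ jx]].
  by move/eqP: ij; apply; exact: hcell_inj ix jx.
have mF i : measurable (B `&` hcell N i) by apply: measurableI => //; exact: measurable_hcell.
rewrite -(measure_bigsetU (leb R) mF tri).
have m0 : measurable [set (0 : mR R)] by exact: measurable_set1.
rewrite (measureDI _ mB m0) [X in (_ + X)%E](_ : _ = 0%E) ?adde0; last first.
  apply/eqP; rewrite eq_le measure_ge0 andbT.
  have z : leb R [set (0 : mR R)] = 0%E by exact: (lebesgue_measure_set1 0).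
  by rewrite -z; apply: le_measure; rewrite ?inE//; exact: measurableI.
apply: (congr1 (leb R)); rewrite -(bigcup_mkord N (fun i => B `&` hcell N i)); apply/seteqP; split => x.
  move=> [Bx /eqP x0]; have [i ix] := hcell_exists (BI _ Bx) x0.
  by exists i => //=.
move=> [i iN [Bx ix]]; split => //= x0.
by have := hcell_pos ix; rewrite x0 ltxx.
Qed.

(** The interval permutation: it fixes 0 and translates the i-th half-open cell
    onto the cell of index s i. *)
Definition iperm (s : 'S_N) (x : mR R) : mR R :=
  x + \sum_(i < N) ((s i)%:R - i%:R) / N%:R * \1_(hcell N i) x.

Lemma iperm0 s : iperm s 0 = 0.
Proof.
rewrite /iperm big1 ?addr0// => i _; rewrite indicE memNset ?mulr0//.
by move=> /hcell_pos; rewrite ltxx.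
Qed.

Lemma ipermE s (i : 'I_N) x : hcell N i x -> iperm s x = x + ((s i)%:R - i%:R) / N%:R.
Proof.
move=> ix; rewrite /iperm (bigD1 i)//= indicE mem_set// mulr1 big1 ?addr0// => j ji.
rewrite indicE memNset ?mulr0// => jx; move/eqP: ji; apply; apply: val_inj.
exact: hcell_inj jx ix.
Qed.

Lemma iperm_hcell (s : 'S_N) (i : 'I_N) x : hcell N i x -> hcell N (s i) (iperm s x).
Proof.
move=> ix; rewrite (ipermE s ix) hcellP; move: ix; rewrite hcellP.
rewrite -[in X in _ -> X](addn1 (s i)) -(addn1 i) !natrD !mulrDl mulNr => /andP[h1 h2].
by apply/andP; split; lra.
Qed.

Lemma ipermK s x : I01 x -> iperm s^-1 (iperm s x) = x.
Proof.
move=> Ix; have [->|x0] := eqVneq x 0; first by rewrite !iperm0.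
have [i ix] := hcell_exists Ix x0.
rewrite (ipermE _ (iperm_hcell s ix)) (ipermE s ix) permK !mulrDl !mulNr; lra.
Qed.

Lemma measurable_iperm s : measurable_fun I01 (iperm s).
Proof.
apply: measurable_funTS; apply: measurable_funD; first exact: measurable_id.
apply: measurable_sum => i; apply: measurable_funM; first exact: measurable_cst.
by apply: measurable_indic; exact: measurable_hcell.
Qed.

Lemma iperm_itv s x : I01 x -> I01 (iperm s x).
Proof.
move=> Ix; have [x0|x0] := eqVneq x 0; first by rewrite x0 iperm0 -x0.
have [i ix] := hcell_exists Ix x0.
by have /hcell_sub := iperm_hcell s ix; apply: cell_sub.
Qed.

Lemma mp_bij_iperm s : mp_bij (iperm s).
Proof.
split.
- split.
  + exact: iperm_itv.
  + move=> x y; rewrite !inE => Ix Iy e; by rewrite -(ipermK s Ix) -(ipermK s Iy) e.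
  + move=> x Ix; exists (iperm s^-1 x); first exact: iperm_itv.
    by have := ipermK s^-1 Ix; rewrite invgK.
- exact: measurable_iperm.
move=> A mA AI.
have mpre : measurable (I01 `&` iperm s @^-1` A) by exact: measurable_iperm.
rewrite (leb_hcells mpre); last exact: subIsetl.
rewrite (leb_hcells mA AI) [RHS](reindex_inj (@perm_inj _ s))/=.
apply: eq_bigr => i _.
rewrite -[RHS](leb_shift (((s i)%:R - i%:R) / N%:R)); last by apply: measurableI => //; exact: measurable_hcell.
congr (leb R _); apply/seteqP; split => x /=.
  by move=> [[Ix Ax] ix]; rewrite -(ipermE s ix); split => //; exact: iperm_hcell.
move=> [Ax sx]; have ix : hcell N i x.
  move: sx; rewrite !hcellP -(addn1 (s i)) -(addn1 i) !natrD !mulrDl mulNr => /andP[h1 h2].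
  by apply/andP; split; lra.
split => //; split; first by apply: (cell_sub N0 (hcell_sub ix)).
by rewrite (ipermE s ix).
Qed.

(** The two functions differ only where a coordinate is 0. *)
Lemma pull_iperm_step s (a : 'I_N -> 'I_N -> R) :
  L1norm (fun z => pull (iperm s) (step a) z - step (fun i j => a (s i) (s j)) z) = 0.
Proof.
pose Z : set plane := ([set 0] `*` I01) `|` (I01 `*` [set 0]).
have m0 : measurable [set (0 : mR R)] by exact: measurable_set1.
have mZ : measurable Z by apply: measurableU; exact: measurableX.
have Z0 : leb2 R Z = 0%E.
  have z : leb R [set (0 : mR R)] = 0%E by exact: (lebesgue_measure_set1 0).
  apply/eqP; rewrite eq_le measure_ge0 andbT; apply: le_trans (measureU2 _ _ _) _; try exact: measurableX.
  have -> : 0%E = (0 + 0 : \bar R)%E by rewrite adde0.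
  apply: leeD.
    have h : (leb2 R ([set (0%R : mR R)] `*` I01) <= 0)%E by rewrite leb2X// z mul0e.
    exact: h.
  have h : (leb2 R (I01 `*` [set (0%R : mR R)]) <= 0)%E by rewrite leb2X// z mule0.
  exact: h.
have bs := bounded_meas_step a; have mp := mp_bij_iperm s.
have bF : bounded_meas (fun z => pull (iperm s) (step a) z - step (fun i j => a (s i) (s j)) z).
  by apply: bounded_measB; [exact: bounded_meas_pull|exact: bounded_meas_step].
have [_ [B FB]] := bF; set F := (fun z => _) in bF FB *.
have B0 : 0 <= `|B| by [].
apply/eqP; rewrite eq_le L1norm_ge0 andbT.
have bI := @bounded_meas_indic R _ mZ.
have b2 : bounded_meas (fun z => `|B| * \1_Z z) by apply: bounded_measM => //; exact: bounded_meas_cst.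
apply: (@le_trans _ _ (L1norm (fun z => `|B| * \1_Z z))).
  apply: le_L1norm => // -[x y] [/= Ix Iy].
  have [Zz|nZ] := pselect (Z (x, y)).
    rewrite indicE mem_set// mulr1 normr_id; apply: le_trans (FB _ _) _ => //.
    exact: ler_norm.
  have x0 : x != 0 by apply/eqP => x0; apply: nZ; left.
  have y0 : y != 0 by apply/eqP => y0; apply: nZ; right.
  have [i ix] := hcell_exists Ix x0; have [j jy] := hcell_exists Iy y0.
  rewrite /F /pull /=.
  rewrite (stepE N0 a (hcell_sub (iperm_hcell s ix)) (hcell_sub (iperm_hcell s jy))).
  by rewrite (stepE N0 _ (hcell_sub ix) (hcell_sub jy)) subrr normr0.
rewrite L1normZ// /L1norm.
have -> : \int[leb2 R]_(z in sq) `|\1_Z z| = \int[leb2 R]_(z in sq) \1_Z z.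
  by apply: eq_Rintegral => z _; rewrite ger0_norm// indicE.
rewrite Rint_indic// (_ : leb2 R _ = 0%E) ?mulr0//.
apply/eqP; rewrite eq_le measure_ge0 andbT -Z0.
by apply: le_measure; rewrite ?inE//; exact: measurableI.
Qed.

End fixed.
End interval_permutation.

(** * A finite net for block-structured matrices *)

Section blocks.
Variable R : realType.

(** Maps that respect the partition on which W0 is constant. *)
Definition blockwise (k : nat) (phi : mR R -> mR R) :=
  forall (a : 'I_k) x, cell R k a x -> cell R k a (phi x).

Lemma natr_frac (a k n : nat) : (0 < k)%N -> (0 < n)%N ->
  a%:R / k%:R = (a * n)%:R / (k * n)%:R :> R.
Proof.
by move=> k0 n0; rewrite !natrM -mulf_div divff ?mulr1// pnatr_eq0 -lt0n.
Qed.

Lemma hcell_block k n (i : nat) x : (0 < k)%N -> (0 < n)%N ->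
  hcell (k * n) i x -> hcell k (i %/ n) (x : mR R).
Proof.
move=> k0 n0; rewrite !hcellP => /andP[h1 h2].
have kn0 : 0 < (k * n)%:R :> R by rewrite ltr0n muln_gt0 k0.
rewrite (natr_frac _ k0 n0) (natr_frac (i %/ n).+1 k0 n0); apply/andP; split.
  by apply: le_lt_trans h1; rewrite ler_pM2r ?invr_gt0// ler_nat leq_divM.
apply: le_trans h2 _; rewrite ler_pM2r ?invr_gt0// ler_nat.
exact: ltn_ceil.
Qed.

Lemma block_ltn k n (i : 'I_(k * n)) : (i %/ n < k)%N.
Proof.
have n0 : (0 < n)%N.
  by have := leq_ltn_trans (leq0n i) (ltn_ord i); rewrite muln_gt0 => /andP[].
by rewrite ltn_divLR.
Qed.

Lemma blockwise_iperm k n (s : 'S_(k * n)) : (0 < k)%N -> (0 < n)%N ->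
  (forall i, s i %/ n = i %/ n)%N -> blockwise k (iperm s : mR R -> mR R).
Proof.
move=> k0 n0 hs a x ax; have kn0 : (0 < k * n)%N by rewrite muln_gt0 k0.
have [x0|x0] := eqVneq x 0; first by rewrite x0 iperm0// -x0.
have [i ix] := hcell_exists kn0 (cell_sub k0 ax) x0.
have := hcell_block k0 n0 (iperm_hcell kn0 s ix); rewrite hs => /hcell_sub.
suff -> : (i %/ n)%N = a by [].
exact: (cell_inj k0 (hcell_sub (hcell_block k0 n0 ix)) ax).
Qed.

Lemma blockwise_id k : blockwise k id. Proof. by []. Qed.

Lemma blockwise_comp k phi psi : blockwise k phi -> blockwise k psi -> blockwise k (phi \o psi).
Proof. by move=> h h' a x /h' /h. Qed.

Lemma mcut_perm N (s : 'S_N) (B : 'I_N -> 'I_N -> R) e : mcut B e ->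
  mcut (fun i j => B (s i) (s j)) e.
Proof.
move=> h S T; have := h (s @: S)%SET (s @: T)%SET.
rewrite big_imset/=; last by move=> ? ? _ _; exact: perm_inj.
set X := \sum_(i in S) _; set Y := (X in _ -> `|X| <= _); suff -> : X = Y by [].
by apply: eq_bigr => i _; rewrite big_imset//= => ? ? _ _; exact: perm_inj.
Qed.

End blocks.

Section colours.
Variables (R : realType) (T : nat).

(** The colour of a vertex records the left and right sides of T rectangles to
    which it belongs. A rectangle sum at (i, j) depends on the colours of i and
    j only. *)
Definition colour := T.-tuple (bool * bool)%type.

Definition mark N (w : T.-tuple (signed_rect N)) (i : 'I_N) : colour :=
  [tuple ((i \in (tnth w l).1.2), (i \in (tnth w l).2)) | l < T].

Definition signs N (w : T.-tuple (signed_rect N)) : T.-tuple bool :=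
  [tuple (tnth w l).1.1 | l < T].

Definition colour_val (eps : R) (b : T.-tuple bool) (s t : colour) : R :=
  eps * \sum_(l < T) (-1) ^+ (tnth b l) * (tnth s l).1%:R * (tnth t l).2%:R.

Lemma rect_sum_colour N (eps : R) (w : T.-tuple (signed_rect N)) i j :
  rect_sum eps w i j = colour_val eps (signs w) (mark w i) (mark w j).
Proof.
rewrite /rect_sum /colour_val big_tuple; congr (_ * _); apply: eq_bigr => l _.
by rewrite !tnth_mktuple.
Qed.

Lemma colour_val_le (eps : R) b s t : 0 <= eps -> `|colour_val eps b s t| <= eps * T%:R.
Proof.
move=> e0; rewrite normrM ger0_norm// ler_wpM2l//.
apply: le_trans (ler_norm_sum _ _ _) _.
have -> : T%:R = \sum_(l < T) 1 :> R by rewrite sumr_const card_ord.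
apply: ler_sum => l _; rewrite !normrM normrX normrN1 expr1n mul1r.
by case: (tnth s l).1; case: (tnth t l).2; rewrite /= ?normr1 ?normr0 ?mulr1 ?mul0r ?mulr0 ?ler01.
Qed.

End colours.

Section sampling.
Variable R : realType.
Local Notation I01 := (unit_itv R).
Local Notation plane := (mR R * mR R)%type.

(** A monotone colouring of a fine grid is replaced by its samples on a coarse
    grid with M cells. Only the coarse cells in which the colour increases
    contribute to the error, and since the colours are bounded by K there are
    at most K of them. *)
Lemma sample_colouring (C : finType) (N M K : nat) (col : 'I_N -> nat) (th : 'I_N -> C)
    (V : C -> C -> R) (B : R) : (0 < N)%N -> (0 < M)%N ->
  (forall i j : 'I_N, (i <= j)%N -> (col i <= col j)%N) ->
  (forall i, (col i <= K)%N) ->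
  (forall i j, col i = col j -> th i = th j) ->
  0 <= B -> (forall s t, `|V s t| <= B) ->
  exists eta : {ffun 'I_M -> C},
    L1norm (fun z => step (fun i j => V (th i) (th j)) z -
                     step (fun i j => V (eta i) (eta j)) z : mR R) <= 4 * B * K%:R / M%:R.
Proof.
move=> N0 M0 colmono colK colth B0 VB.
have M0R : 0 < M%:R :> R by rewrite ltr0n.
pose pt (j : nat) : R := j%:R / M%:R.
have ptI (j : nat) : (j <= M)%N -> I01 (pt j).
  move=> jM; rewrite /unit_itv /= in_itv /= divr_ge0//=.
  by rewrite ler_pdivrMr// mul1r ler_nat.
have [iota hiota] : {f : 'I_M.+1 -> 'I_N & forall j : 'I_M.+1, cell R N (f j) (pt j)}.
  apply: (@choice _ _ (fun (j : 'I_M.+1) (i : 'I_N) => cell R N i (pt j))) => j.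
  by apply: cell_exists => //; apply: ptI; rewrite -ltnS.
pose io (j : nat) := iota (inord j).
have hio (j : nat) : (j <= M)%N -> cell R N (io j) (pt j).
  by move=> jM; have := hiota (inord j); rewrite inordK.
have mono x y (i j : 'I_N) : cell R N i x -> cell R N j y -> x <= y -> (col i <= col j)%N.
  move=> ix jy xy; apply: colmono; rewrite leqNgt; apply/negP => ji.
  have /cellE/andP[+ _] := ix; case: ifPn => [/eqP i0|_ h]; first by move: ji; rewrite i0.
  have := lt_le_trans h (le_trans xy (cell_le jy)).
  by rewrite ltr_pM2r ?invr_gt0 ?ltr0n// ltr_nat ltnNge ji.
pose f (j : nat) : R := (col (io j))%:R.
pose d (j : nat) := f j.+1 - f j.
have d0 (j : 'I_M) : 0 <= d j.
  rewrite subr_ge0 ler_nat; apply: (mono (pt j) (pt j.+1)); first exact: hio (ltnW _).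
    exact: hio.
  by rewrite ler_pM2r ?invr_gt0// ler_nat.
have d1 (j : 'I_M) (i : 'I_N) x : cell R M j x -> cell R N i x -> th i != th (io j.+1) -> 1 <= d j.
  move=> jx ix neq.
  have h1 : (col (io j) <= col i)%N by apply: (mono (pt j) x) => //; [exact: hio (ltnW _)|exact: cell_ge jx].
  have h2 : (col i <= col (io j.+1))%N by apply: (mono x (pt j.+1)) => //; [exact: hio|exact: cell_le jx].
  have h3 : col i != col (io j.+1) by apply: contra neq => /eqP/colth ->.
  have h4 : (col (io j) < col (io j.+1))%N by apply: leq_ltn_trans h1 _; rewrite ltn_neqAle h3.
  by rewrite /d /f -natrB ?(ltnW h4)// ler1n subn_gt0.
exists [ffun j : 'I_M => th (io j.+1)].
have sumd : \sum_(j < M) d j <= K%:R.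
  rewrite -(big_mkord xpredT d) telescope_sumr// /f lerBlDr.
  by apply: (@le_trans _ _ K%:R); [rewrite ler_nat|rewrite lerDl].
have bs a := @bounded_meas_step R N a; have bs' a := @bounded_meas_step R M a.
apply: le_trans (_ : _ <= L1norm (step (fun i j : 'I_M => 2 * B * (d i + d j)))) _.
  apply: le_L1norm => //; first exact: bounded_measB.
  move=> [x y] sz.
  have [i [i' [/= ix iy]]] := sq_cell N0 sz; have [j [j' [/= jx jy]]] := sq_cell M0 sz.
  rewrite (stepE N0 _ ix iy) !(stepE M0 _ jx jy) !ffunE.
  have dd : 0 <= d j + d j' by rewrite addr_ge0.
  rewrite [leRHS]ger0_norm; last by rewrite !mulr_ge0.
  have [/andP[/eqP-> /eqP->]|] := boolP ((th i == th (io j.+1)) && (th i' == th (io j'.+1))).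
    by rewrite subrr normr0 !mulr_ge0.
  rewrite negb_and => neq; have big : 1 <= d j + d j'.
    case/orP: neq => neq; first by have := d1 _ _ _ jx ix neq; have := d0 j'; lra.
    by have := d1 _ _ _ jy iy neq; have := d0 j; lra.
  apply: le_trans (ler_normB _ _) _; apply: le_trans (lerD (VB _ _) (VB _ _)) _.
  have -> : B + B = 2 * B by rewrite mulr_natl mulr2n.
  by rewrite ler_peMr ?mulr_ge0.
rewrite L1norm_step//.
have -> : \sum_(i < M) \sum_(j < M) `|2 * B * (d i + d j)| = 4 * B * M%:R * \sum_(j < M) d j.
  have BB : 0 <= 2 * B by exact: mulr_ge0.
  have -> : 4 * B = 2 * (2 * B) by ring.
  move: (2 * B) BB => x x0.
  transitivity (\sum_(i < M) \sum_(j < M) (x * d i + x * d j)).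
    apply: eq_bigr => i _; apply: eq_bigr => j _; rewrite -mulrDr ger0_norm//.
    by apply: mulr_ge0 => //; exact: addr_ge0 (d0 i) (d0 j).
  have Ms (y : R) : \sum_(j < M) y = M%:R * y by rewrite sumr_const card_ord mulr_natl.
  under eq_bigr do rewrite big_split/= Ms -mulr_sumr.
  by rewrite big_split/= Ms -!mulr_sumr; ring.
rewrite ler_pdivrMr ?exprn_gt0//.
have -> : 4 * B * K%:R / M%:R * M%:R ^+ 2 = 4 * B * M%:R * K%:R by field; rewrite gt_eqF.
by rewrite ler_wpM2l// !mulr_ge0.
Qed.

(** By regularity q is close to a sum of a bounded number of rectangles. Once
    the vertices are sorted by block and then by colour, the colours along the
    grid change a bounded number of times, so that a sample on a grid whose
    size does not depend on n is enough. The samples range over a finite set.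
    As blocks come first in the order, sorting keeps each vertex in its
    block. *)
Theorem totally_bounded (k : nat) (e : R) : (0 < k)%N -> 0 < e ->
  exists (I : finType) (u : I -> plane -> mR R),
    (forall i, bounded_meas (u i)) /\
    forall n (q : 'I_(k * n) -> 'I_(k * n) -> R), (0 < n)%N ->
      (forall i j, `|q i j| <= 1) ->
      exists i (s : 'S_(k * n)), (forall a, s a %/ n = a %/ n)%N /\
        cut_le (fun z => pull (iperm s) (step q) z - u i z) e.
Proof.
move=> k0 e0; pose eps := e / 2; have eps0 : 0 < eps by rewrite divr_gt0.
pose T := (Num.bound (eps ^+ 2)^-1).
have hT : 1 <= T%:R * eps ^+ 2.
  rewrite -ler_pdivrMr ?exprn_gt0// mul1r; apply: ltW; apply: archi_boundP.
  by rewrite invr_ge0 sqr_ge0.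
pose L := #|{: colour T}|; pose K := (k * L)%N; pose B := eps * T%:R.
have B0 : 0 <= B by rewrite mulr_ge0// ltW.
pose M := (Num.bound (eps^-1 * (4 * B * K%:R))).+1.
have M0 : (0 < M)%N by [].
have hM : 4 * B * K%:R / M%:R <= eps.
  rewrite ler_pdivrMr ?ltr0n// -ler_pdivrMl//.
  by apply: le_natr_bound => //; rewrite mulr_ge0 ?invr_ge0 ?mulr_ge0// ltW.
exists (T.-tuple bool * {ffun 'I_M -> colour T})%type.
exists (fun x : T.-tuple bool * {ffun 'I_M -> colour T} =>
  step (fun i j => colour_val eps x.1 (x.2 i) (x.2 j))).
split; first by move=> x; exact: bounded_meas_step.
move=> n q n0 hq; have N0 : (0 < k * n)%N by rewrite muln_gt0 k0.
have [w hw] := regularity eps0 hT hq.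
pose c (i : 'I_(k * n)) := (i %/ n * L + enum_rank (mark w i))%N.
have cL i : (enum_rank (mark w i) < L)%N by exact: ltn_ord.
have L0 : (0 < L)%N.
  by rewrite /L; apply/card_gt0P; exists [tuple (false, false) | l < T].
have cdiv i : (c i %/ L = i %/ n)%N by rewrite /c divnMDl// (divn_small (cL i)) addn0.
have cmod i : (c i %% L = enum_rank (mark w i))%N by rewrite /c modnMDl (modn_small (cL i)).
have [s hs] := sorting_perm c.
have hblock a : (s a %/ n = a %/ n)%N.
  apply: (sorted_perm_fix (b := fun i => (i %/ n)%N)) => i j ij.
    exact: leq_div2r.
  by rewrite -!cdiv leq_div2r// hs.
have cK i : (c (s i) <= K)%N.
  by apply: ltnW; rewrite /K -ltn_divLR// cdiv block_ltn.
have cth i j : c (s i) = c (s j) -> mark w (s i) = mark w (s j).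
  by move=> /(congr1 (modn^~ L)); rewrite !cmod => /ord_inj/enum_rank_inj.
have [eta heta] := sample_colouring N0 M0 hs cK cth B0
  (fun s t => colour_val_le (signs w) s t (ltW eps0)).
exists (signs w, eta), s; split=> //=.
have mp := mp_bij_iperm R N0 s.
pose r := fun i j => rect_sum eps w (s i) (s j).
have b1 := bounded_meas_pull mp (bounded_meas_step q).
have b2 := bounded_meas_step (fun i j => q (s i) (s j)).
have b3 := bounded_meas_step r.
have b4 := bounded_meas_step (fun i j => colour_val eps (signs w) (eta i) (eta j)).
have h1 := cut_le_L1 (bounded_measB b1 b2); rewrite pull_iperm_step// in h1.
have h2 : cut_le (fun z => step (fun i j => q (s i) (s j)) z - step r z) eps.
  apply: (eq_cut_le (fun z _ => esym (stepB _ _ z))).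
  by apply: cut_le_step => //; exact: (mcut_perm s hw).
have h3 : cut_le (fun z => step r z - step (fun i j => colour_val eps (signs w) (eta i) (eta j)) z) eps.
  apply: cut_leW (cut_le_L1 (bounded_measB b3 b4)); apply: le_trans hM; apply: le_trans heta.
  rewrite le_eqVlt; apply/orP; left; apply/eqP; apply: eq_L1norm => z _.
  by congr (step _ z - _); apply/funext => i; apply/funext => j; rewrite /r rect_sum_colour.
have := cut_le_tri b1 b2 b4 h1 (cut_le_tri b2 b3 b4 h2 h3).
by rewrite add0r -splitr.
Qed.

End sampling.

(** * Compactness modulo blockwise bijections *)

Section compactness.
Variable R : realType.
Local Notation I01 := (unit_itv R).
Local Notation sq := (unit_sq R).
Local Notation plane := (mR R * mR R)%type.

Lemma cauchy_geometric (w : nat -> plane -> mR R) :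
  (forall j, bounded_meas (w j)) ->
  (forall j, cut_le (fun z => w j z - w j.+1 z) (2^-1 ^+ j)) ->
  forall e, 0 < e -> exists M, forall i j, (M <= i)%N -> (M <= j)%N ->
    cut_le (fun z => w i z - w j z) e.
Proof.
move=> bw hw; have step_le i l : cut_le (fun z => w i z - w (i + l)%N z) (2 * 2^-1 ^+ i - 2 * 2^-1 ^+ (i + l)).
  elim: l => [|l IH].
    rewrite addn0 subrr => S T mS mT SI TI.
    rewrite (@eq_Rintegral _ _ _ _ _ (cst 0)) => [|z _]; last by rewrite /= subrr.
    by rewrite Rintegral_cst ?mul0r ?normr0//; exact: measurableX.
  rewrite addnS.
  have -> : 2 * 2^-1 ^+ i - 2 * 2^-1 ^+ (i + l).+1 = 2 * 2^-1 ^+ i - 2 * 2^-1 ^+ (i + l) + 2^-1 ^+ (i + l) :> R.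
    by rewrite exprS; set x := 2^-1 ^+ (i + l); set y := 2^-1 ^+ i; field.
  exact: (cut_le_tri (bw i) (bw (i + l)%N) (bw (i + l).+1) IH (hw (i + l)%N)).
have pow_le i : (2^-1 ^+ i : R) <= i.+1%:R^-1.
  rewrite exprVn lef_pV2 ?posrE ?exprn_gt0 ?ltr0n// -natrX ler_nat.
  exact: ltn_expl.
move=> e e0; exists (Num.bound (2 / e)) => i j Mi Mj.
wlog ij : i j Mi Mj / (i <= j)%N => [H|].
  have /orP[ij|ji] := leq_total i j; first exact: H.
  by apply: cut_le_distC; [exact: bw|exact: bw|exact: H].
rewrite -(subnKC ij); apply: cut_leW (step_le _ _).
apply: (@le_trans _ _ (2 * 2^-1 ^+ i)).
  by rewrite gerBl mulr_ge0// exprn_ge0// invr_ge0.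
apply: (@le_trans _ _ (2 * i.+1%:R^-1)); first by rewrite ler_wpM2l.
rewrite ler_pdivrMr ?ltr0n// -ler_pdivrMl// mulrC.
by apply: le_natr_bound; [rewrite divr_ge0// ltW|exact: leq_trans Mi _].
Qed.

(** Along an ultrafilter, for each j, almost all q m are close to one centre of
    the finite net of radius 2^-(j+1), after a permutation of the cells within
    the blocks. A term m j close to both the j-th and the next centre is chosen
    for each j; two consecutive terms are then linked by a blockwise
    measure-preserving map. Composed with the products of these maps the
    sequence is Cauchy in cut norm, and [cut_complete] gives the limit. *)
Theorem block_compactness (k : nat) (n : nat -> nat)
    (q : forall m, 'I_(k * n m) -> 'I_(k * n m) -> R) :
  (0 < k)%N -> (forall m, 0 < n m)%N ->
  (forall m i j, 0 <= q m i j <= 1) -> (forall m i j, q m i j = q m j i) ->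
  exists g : graphon R, forall e, 0 < e -> forall M, exists m phi,
    [/\ (M <= m)%N, mp_bij phi, blockwise k phi &
        cut_le (fun z => g z - pull phi (step (q m)) z) e].
Proof.
move=> k0 n0 q01 qsym.
have N0 m : (0 < k * n m)%N by rewrite muln_gt0 k0 n0.
have [G [uG Goo]] := @ultraFilterLemma nat \oo _.
have FG : Filter G by typeclasses eauto.
pose h m : plane -> mR R := step (q m).
have bh m : bounded_meas (h m) by exact: bounded_meas_step.
pose near_to (u : plane -> mR R) (e : R) (m : nat) := exists s : 'S_(k * n m),
  (forall a, s a %/ n m = a %/ n m)%N /\ cut_le (fun z => pull (iperm s) (h m) z - u z) e.
have half0 j : 0 < (2^-1 ^+ j.+1 : R) by rewrite exprn_gt0.
have ultra_center j : exists u, bounded_meas u /\ G [set m | near_to u (2^-1 ^+ j.+1) m].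
  have [I [u [bu hu]]] := totally_bounded k0 (half0 j).
  apply: contrapT => nex.
  have nG i : G (~` [set m | near_to (u i) (2^-1 ^+ j.+1) m]).
    by have [Gi|//] := in_ultra_setVsetC (F := G) [set m | near_to (u i) (2^-1 ^+ j.+1) m]; exfalso; apply: nex; exists (u i).
  have /filter_ex[m hm] := filter_forall FG nG.
  have q1 i i' : `|q m i i'| <= 1 by have /andP[h1 h2] := q01 m i i'; rewrite ger0_norm.
  have [i [s [hs cs]]] := hu (n m) (q m) (n0 m) q1.
  by apply: (hm i); exists s.
have [u hu] := choice ultra_center.
have pick_m j : exists m, [/\ (j <= m)%N, near_to (u j) (2^-1 ^+ j.+1) m &
    near_to (u j.+1) (2^-1 ^+ j.+2) m].
  have Gj : G [set m | (j <= m)%N] by apply: Goo; exists j.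
  have h12 := @filterI _ G FG _ _ Gj (hu j).2.
  have /filter_ex[m [[h1 h2] h3]] := @filterI _ G FG _ _ h12 (hu j.+1).2.
  by exists m.
have [m hm] := choice pick_m.
have link j : exists psi, [/\ mp_bij psi, blockwise k psi &
    cut_le (fun z => h (m j) z - pull psi (h (m j.+1)) z) (2^-1 ^+ j.+1)].
  have [_ _ [s [hs cs]]] := hm j; have [_ [s' [hs' cs']] _] := hm j.+1.
  have mp := mp_bij_iperm R (N0 (m j)) s; have mpV := mp_bij_iperm R (N0 (m j)) s^-1.
  have mp' := mp_bij_iperm R (N0 (m j.+1)) s'.
  have hsV a : (s^-1 a %/ n (m j) = a %/ n (m j))%N%g.
    by rewrite -{2}(permKV s a) hs.
  exists (iperm s' \o iperm s^-1); split.
  - exact: mp_bij_comp.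
  - by apply: blockwise_comp; apply: blockwise_iperm.
  have bu := (hu j.+1).1.
  have b1 := bounded_meas_pull mp (bh (m j)); have b2 := bounded_meas_pull mp' (bh (m j.+1)).
  have c := cut_le_tri b1 bu b2 cs (cut_le_distC b2 bu cs').
  have -> : 2^-1 ^+ j.+1 = 2^-1 ^+ j.+2 + 2^-1 ^+ j.+2 :> R.
    by rewrite [2^-1 ^+ j.+2]exprS; set x := 2^-1 ^+ j.+1; field.
  have := cut_le_pull mpV (bounded_measB b1 b2) c.
  apply: eq_cut_le => -[x y] [/= Ix Iy]; rewrite /pull /=.
  have K t : I01 t -> iperm s (iperm s^-1 t) = t.
    by move=> It; have := ipermK (N0 (m j)) s^-1 It; rewrite invgK.
  by rewrite !K.
have [psi hpsi] := choice link.
pose Phi := fix Phi j := if j is j'.+1 then psi j' \o Phi j' else id.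
have mpPhi j : mp_bij (Phi j) /\ blockwise k (Phi j).
  elim: j => [|j [IH1 IH2]]; first by split; [exact: mp_bij_id|exact: blockwise_id].
  have [h1 h2 _] := hpsi j.
  by split; [exact: mp_bij_comp|exact: blockwise_comp].
pose w j := pull (Phi j) (h (m j)).
have bw j : bounded_meas (w j) by apply: bounded_meas_pull => //; case: (mpPhi j).
have sqPhi j x y : sq (x, y) -> sq (Phi j x, Phi j y).
  by move=> [/= Ix Iy]; split; apply: mp_bij_fun => //; case: (mpPhi j).
have wstep j : cut_le (fun z => w j z - w j.+1 z) (2^-1 ^+ j).
  have [h1 h2 h3] := hpsi j.
  apply: (@cut_leW _ _ (2^-1 ^+ j.+1)).
    by rewrite exprS ler_piMl ?exprn_ge0 ?invr_ge0// invf_le1 ?ler1n.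
  have b2 := bounded_meas_pull h1 (bh (m j.+1)).
  exact: (cut_le_pull (mpPhi j).1 (bounded_measB (bh (m j)) b2) h3).
have [g hg] := cut_complete
  (fun j => (bw j).1)
  (fun j => fun '(x, y) => fun s => step_itv (N0 (m j)) (sqPhi j x y s) (q01 (m j)))
  (fun j x y s => step_sym (N0 (m j)) (qsym (m j)) (sqPhi j x y s))
  (cauchy_geometric bw wstep).
exists g => e e0 M; have [M' hM'] := hg e e0.
pose j := maxn M M'; exists (m j), (Phi j).
have [h1 _ _] := hm j; have [mp bl] := mpPhi j; split => //.
  exact: leq_trans (leq_maxl M M') h1.
exact: hM' (leq_maxr M M').
Qed.

End compactness.

(** * The rate function and step graphons *)

Section relative_entropy.
Variable R : realType.
Implicit Types (p u q a b : R).

Lemma rel_entropyE p u : dominated p u -> rel_entropy p u = (ent p u)%:E.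
Proof.
move=> [d0 d1]; rewrite /rel_entropy; case: ifPn => // /andP[/orP[]/eqP p_ /eqP[]].
  by rewrite d0.
by rewrite d1.
Qed.

Lemma rel_entropyN p u : ~ dominated p u -> rel_entropy p u = +oo%E.
Proof.
move=> nd; rewrite /rel_entropy; case: ifPn => // /nandP[|/negPn/eqP up].
  by move=> /norP[/eqP p0 /eqP p1]; exfalso; apply: nd; split.
by exfalso; apply: nd; rewrite up; split.
Qed.

Lemma rel_entropy_ge0 p u : 0 <= p <= 1 -> 0 <= u <= 1 -> (0 <= rel_entropy p u)%E.
Proof.
move=> hp hu; have [d|nd] := pselect (dominated p u); last by rewrite rel_entropyN.
by rewrite rel_entropyE// lee_fin ent_ge0.
Qed.

Lemma measurable_rel_entropy p : measurable_fun [set: mR R] (rel_entropy p).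
Proof.
rewrite /rel_entropy; apply: measurable_fun_ifT.
- apply: measurable_and => //; apply: measurable_neg.
  by apply: measurable_fun_eqr => //; exact: measurable_cst.
- exact: measurable_cst.
- apply/measurable_EFinP; apply: measurable_funD; apply: measurable_funM => //.
  + by apply: measurableT_comp => //; apply: measurable_funM.
  + exact: measurable_funB.
  + apply: measurableT_comp => //; apply: measurable_funM => //.
    exact: measurable_funB.
Qed.

(** The affine functions below the relative entropy. Integrating them gives
    Jensen's inequality without regularity of the entropy, infinite values
    included. *)
Definition minorant p a b := forall u, 0 <= u <= 1 -> ((a + b * u)%:E <= rel_entropy p u)%E.

(** The tangent of ent p at r: the difference of the two sides is ent r u. *)
Lemma ln_ratio_minorant p (r : R) : 0 < p < 1 -> 0 < r < 1 ->
  minorant p (ln ((1 - r) / (1 - p))) (ln (r / p) - ln ((1 - r) / (1 - p))).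
Proof.
move=> /andP[p0 p1] /andP[r0 r1] u hu.
have d (x y : R) : 0 < x -> x < 1 -> dominated x y by move=> *; split=> ?; lra.
rewrite rel_entropyE; last exact: d.
rewrite lee_fin; have := ent_ge0 _ hu (d r u r0 r1).
rewrite /ent => /(_ ltac:(lra)).
have hln (x y z : R) : 0 <= x -> 0 < y -> 0 < z -> x * ln (x / y) = x * ln (x / z) - x * ln (y / z).
  rewrite le_eqVlt => /orP[/eqP <-|x0] y0 z0; first by rewrite !mul0r subrr.
  rewrite !ln_div ?posrE// ; ring.
have /andP[u0 u1] := hu.
rewrite (hln u r p)// (hln (1 - u) (1 - r) (1 - p)) ?subr_ge0 ?subr_gt0//.
lra.
Qed.

(** The relative entropy is the supremum of its minorants. When p is 0 or 1
    these are the lines of arbitrary slope through (p, 0); otherwise the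
    tangents at points that approach q from within ]0, 1[. *)
Lemma minorant_sup p q (Y : R) : 0 <= p <= 1 -> 0 <= q <= 1 ->
  (forall a b, minorant p a b -> a + b * q <= Y) -> dominated p q /\ ent p q <= Y.
Proof.
move=> hp hq hm.
have deg : p = 0 \/ p = 1 -> dominated p q /\ ent p q <= Y.
  move=> pp; have line (b : R) : b * (q - p) <= Y.
    rewrite mulrBr addrC; apply: hm => u hu; have [d|nd] := pselect (dominated p u); last first.
      by rewrite rel_entropyN// leey.
    have -> : u = p by case: d => d0 d1; case: pp => E; rewrite E; [exact: d0|exact: d1].
    by rewrite addNr; exact: rel_entropy_ge0.
  have qp : q = p.
    apply: contrapT => /eqP; rewrite -subr_eq0 => qp.
    by have := line ((Y + 1) / (q - p)); rewrite divfK//; lra.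
  by rewrite qp ent_self; split; [split|have := line 0; rewrite mul0r].
have [/or_introl/deg//|pn0] := eqVneq p 0; have [/or_intror/deg//|pn1] := eqVneq p 1.
have /andP[p0 p1] := hp; have /andP[q0 q1] := hq.
have hp' : 0 < p < 1 by rewrite lt_neqAle eq_sym pn0 p0 lt_neqAle pn1 p1.
split; first by split=> E; rewrite E eqxx in pn0 pn1.
(* r := (1 - s) q + s / 2 lies in ]0, 1[ even when q does not; then s -> 0 *)
have key s : 0 < s < 1 -> ent p q + ln (1 - s) <= Y.
  move=> /andP[s0 s1]; pose r := (1 - s) * q + s / 2.
  have hsq : 0 <= (1 - s) * q by rewrite mulr_ge0//; lra.
  have hsq' : 0 <= (1 - s) * (1 - q) by rewrite mulr_ge0//; lra.
  have hr : 0 < r < 1 by rewrite /r; lra.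
  apply: le_trans (hm _ _ (ln_ratio_minorant hp' hr)).
  have h (x y z : R) : 0 <= x -> 0 < z -> (1 - s) * x <= y -> 0 < y ->
      x * ln (x / z) + x * ln (1 - s) <= x * ln (y / z).
    rewrite le_eqVlt => /orP[/eqP <-|x0] z0 xy y0; first by rewrite !mul0r addr0.
    rewrite -mulrDr ler_pM2l// -lnM ?posrE ?divr_gt0//; last lra.
    rewrite ler_ln ?posrE ?mulr_gt0 ?divr_gt0 ?invr_gt0//; last lra.
    by rewrite mulrAC ler_pM2r ?invr_gt0// mulrC.
  have h1 := h q r p q0; have h2 := h (1 - q) (1 - r) (1 - p).
  have {}h1 := h1 ltac:(lra) ltac:(rewrite /r; lra) ltac:(lra).
  have {}h2 := h2 ltac:(lra) ltac:(lra) ltac:(rewrite /r; lra) ltac:(lra).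
  rewrite /ent; lra.
apply/ler_addgt0Pr => e e0.
pose s := 1 - expR (- e).
have es : expR (- e) < 1 by rewrite expR_lt1; lra.
have := key s; rewrite /s => /(_ ltac:(rewrite subr_gt0 es/=; have := expR_gt0 (- e); lra)).
by rewrite subKr expRK; lra.
Qed.

End relative_entropy.

Section cells_integral.
Variables (R : realType) (N : nat).
Local Notation sq := (unit_sq R).
Local Notation plane := (mR R * mR R)%type.
Hypothesis N0 : (0 < N)%N.
Local Notation cellX i j := (cell R N i `*` cell R N j).

Lemma trivIset_cellX (D : set ('I_N * 'I_N)) : trivIset D (fun ij => cellX ij.1 ij.2).
Proof.
move=> [i j] [i' j'] _ _ [[x y] [[/= ix jy] [/= ix' jy']]].
congr (_, _); apply: val_inj; first exact: cell_inj ix ix'.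
exact: cell_inj jy jy'.
Qed.

Lemma ge0_integral_cells (f : plane -> \bar R) :
  (forall i j : 'I_N, measurable_fun (cellX i j) f) -> (forall z, sq z -> (0 <= f z)%E) ->
  (\int[leb2 R]_(z in sq) f z = \sum_(i < N) \sum_(j < N) \int[leb2 R]_(z in cellX i j) f z)%E.
Proof.
move=> mf f0; rewrite pair_bigA/=.
have sqE : sq = \big[setU/set0]_(ij : 'I_N * 'I_N) cellX ij.1 ij.2.
  apply/seteqP; split => [z /(sq_cell N0)[i [j zij]]|z].
    by rewrite -bigcup_seq; exists (i, j) => //=; rewrite mem_index_enum.
  by rewrite -bigcup_seq => -[ij _]; exact: cellX_sub.
rewrite [in LHS]sqE (ge0_integral_bigsetU _ (fun ij : 'I_N * 'I_N => measurable_cellX N ij.1 ij.2)) => //.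
- exact: index_enum_uniq.
- exact: trivIset_cellX.
- have -> : \big[setU/set0]_(ij <- index_enum ('I_N * 'I_N)%type) cellX ij.1 ij.2 =
     \bigcup_(ij in [set: 'I_N * 'I_N]) cellX ij.1 ij.2.
    by rewrite -bigcup_seq; apply: eq_bigcupl; split => // x _ /=; rewrite mem_index_enum.
  move=> mD Y mY; rewrite setI_bigcupl; apply: fin_bigcup_measurable => // ij _.
  by apply: mf => //; exact: measurable_cellX.
- by rewrite -sqE.
Qed.

(** Jensen's inequality on one cell: the minorants are integrated. *)
Lemma int_cell_ent (g : graphon R) (i j : 'I_N) (p Y : R) : 0 <= p <= 1 ->
  (\int[leb2 R]_(z in cellX i j) rel_entropy p (g z) <= (Y / N%:R ^+ 2)%:E)%E ->
  dominated p (cell_avg g i j) /\ ent p (cell_avg g i j) <= Y.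
Proof.
move=> hp hY; have bg := bounded_meas_graphon g.
have g01 z : sq z -> 0 <= g z <= 1 by exact: graphon_itv.
have iS := @cellX_sub R N N0 i j; have mS := (measurable_cellX N i j : measurable (cellX i j)).
have N2 : 0 < N%:R ^+ 2 :> R by rewrite exprn_gt0// ltr0n.
apply: minorant_sup => //; first by apply: cell_avg_itv.
move=> a b hab.
have bab : bounded_meas (fun z => a + b * g z).
  by apply: bounded_measD; [exact: bounded_meas_cst|apply: bounded_measM => //; exact: bounded_meas_cst].
have -> : a + b * cell_avg g i j = N%:R ^+ 2 * \int[leb2 R]_(z in cellX i j) (a + b * g z).
  rewrite RintegralD//; [|by apply: bounded_meas_integrable => //; exact: bounded_meas_cst|]; last first.
    by apply: bounded_meas_integrable => //; apply: bounded_measM => //; exact: bounded_meas_cst.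
  rewrite (int_cell_cst N0) RintegralZl//; last exact: bounded_meas_integrable.
  by rewrite /cell_avg; field; rewrite gt_eqF// ltr0n.
rewrite mulrC -ler_pdivlMr// -lee_fin; apply: (le_trans _ hY).
have ib : (leb2 R).-integrable (cellX i j) (EFin \o (fun z => a + b * g z)).
  exact: bounded_meas_integrable.
rewrite /Rintegral fineK; last exact: integrable_fin_num.
have mr : measurable_fun (cellX i j) (fun z => rel_entropy p (g z)).
  apply: (measurableT_comp (measurable_rel_entropy p)).
  by apply: measurable_funS (graphon_meas g).
have r0 z : cellX i j z -> (0 <= rel_entropy p (g z))%E.
  by move=> /iS sz; apply: rel_entropy_ge0 => //; exact: g01.
apply: le_integral => //.
  apply/integrableP; split => //.
  rewrite (@eq_integral _ _ _ _ _ (fun z => rel_entropy p (g z))) => [|z].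
    exact: le_lt_trans hY (ltry _).
  by rewrite inE => /r0; exact: gee0_abs.
by move=> z; rewrite inE => /iS sz; apply: hab; exact: g01.
Qed.

End cells_integral.

Section graphon_of_step.
Variables (R : realType) (N : nat) (q : 'I_N -> 'I_N -> R).
Hypotheses (N0 : (0 < N)%N) (qsym : forall i j, q i j = q j i) (q01 : forall i j, 0 <= q i j <= 1).

Definition step_graphon : graphon R :=
  Graphon (bounded_meas_step q).1 (fun z sz => step_itv N0 sz q01)
    (fun x y sxy => step_sym N0 qsym sxy).

End graphon_of_step.

Section block_model.
Variables (R : realType) (k n : nat) (W0 : graphon R) (p : 'I_k -> 'I_k -> R).
Hypotheses (k0 : (0 < k)%N) (n0 : (0 < n)%N) (p01 : forall a b, 0 <= p a b <= 1).
Hypothesis W0p : forall (a b : 'I_k) x y, cell R k a x -> cell R k b y -> W0 (x, y) = p a b.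
Local Notation N := (k * n)%N.
Local Notation cellX i j := (cell R N i `*` cell R N j).

Let N0 : (0 < N)%N. Proof. by rewrite muln_gt0 k0. Qed.

Definition block (i : 'I_N) : 'I_k := Ordinal (block_ltn i).

Definition block_prob i j := p (block i) (block j).

Lemma cell_block (i : 'I_N) x : cell R N i x -> cell R k (block i) x.
Proof.
move=> ix; have [x0|x0] := eqVneq x 0.
  have i0 : i = 0%N :> nat.
    apply: (cell_inj N0 ix); rewrite x0; apply/cellE => /=.
    by rewrite lexx/= divr_ge0.
  by rewrite /= i0 div0n x0; apply/cellE; rewrite /= lexx divr_ge0.
have [j jx] := hcell_exists N0 (cell_sub N0 ix) x0.
have -> : i = j by apply: val_inj; apply: (cell_inj N0 ix); exact: hcell_sub.
exact: hcell_sub (hcell_block k0 n0 jx).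
Qed.

Lemma W0_block (i j : 'I_N) x y : cell R N i x -> cell R N j y -> W0 (x, y) = block_prob i j.
Proof. by move=> /cell_block ix /cell_block jy; exact: W0p. Qed.

Lemma edge_prob_block (e : edge N) : edge_prob W0 e = block_prob (val e).1 (val e).2.
Proof. by apply: W0_block; exact: cell_right. Qed.

Lemma rate_I_cells (g : graphon R) : rate_I W0 g = ((2^-1)%:E *
  \sum_(i < N) \sum_(j < N) \int[leb2 R]_(z in cellX i j) rel_entropy (block_prob i j) (g z))%E.
Proof.
have E (i j : 'I_N) z : z \in cellX i j -> rel_entropy (W0 z) (g z) = rel_entropy (block_prob i j) (g z).
  by case: z => x y; rewrite inE => -[/= ix jy]; rewrite (W0_block ix jy).
rewrite /rate_I; congr (_ * _)%E; rewrite (ge0_integral_cells N0).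
- by apply: eq_bigr => i _; apply: eq_bigr => j _; apply: eq_integral => z; exact: E.
- move=> i j; apply: (eq_measurable_fun (fun z => rel_entropy (block_prob i j) (g z))).
    by move=> z /E.
  apply: (measurableT_comp (measurable_rel_entropy _)).
  by apply: measurable_funS (graphon_meas g) => //; exact: cellX_sub.
- by move=> z sz; apply: rel_entropy_ge0; exact: graphon_itv.
Qed.

Lemma rate_I_step (g : graphon R) (q : 'I_N -> 'I_N -> R) :
  (forall z, g z = step q z) -> (forall i j, dominated (block_prob i j) (q i j)) ->
  rate_I W0 g = (2^-1 * (\sum_i \sum_j ent (block_prob i j) (q i j)) / N%:R ^+ 2)%:E.
Proof.
move=> gq dom; rewrite rate_I_cells -mulrA EFinM; congr (_ * _)%E.
rewrite mulr_suml -sumEFin; apply: eq_bigr => i _.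
rewrite mulr_suml -sumEFin; apply: eq_bigr => j _.
rewrite (@eq_integral _ _ _ _ _ (cst (ent (block_prob i j) (q i j))%:E)).
  rewrite integral_cst; last exact: measurable_cellX.
  by rewrite leb2X// !(leb_cell R N0) -!EFinM expr2 invfM.
by case=> x y; rewrite inE => -[/= ix jy]; rewrite gq (stepE N0 q ix jy) rel_entropyE.
Qed.

(** Averaging over the cells does not increase the rate, by convexity and
    because W0 is constant on each cell. *)
Lemma rate_I_avg (g : graphon R) (c : R) : (rate_I W0 g <= c%:E)%E ->
  (forall i j : 'I_N, dominated (block_prob i j) (cell_avg g i j)) /\
  2^-1 * (\sum_i \sum_j ent (block_prob i j) (cell_avg g i j)) / N%:R ^+ 2 <= c.
Proof.
rewrite rate_I_cells; set X := fun i j : 'I_N => (\int[leb2 R]_(z in cellX i j) rel_entropy (block_prob i j) (g z))%E.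
have X0 i j : (0 <= X i j)%E.
  apply: integral_ge0 => z /(cellX_sub N0) sz; apply: rel_entropy_ge0; first exact: p01.
  exact: graphon_itv.
move=> hc; have hc2 : (\sum_(i < N) \sum_(j < N) X i j <= (2 * c)%:E)%E.
  by rewrite EFinM -lee_pdivrMl.
have Xfin i j : X i j \is a fin_num.
  rewrite ge0_fin_numE//; apply: le_lt_trans (ltry (2 * c)); apply: le_trans hc2.
  rewrite (bigD1 i)//= (bigD1 j)//= -addeA leeDl// adde_ge0//.
    by apply: sume_ge0 => *.
  by apply: sume_ge0 => *; apply: sume_ge0.
have N2 : 0 < N%:R ^+ 2 :> R by rewrite exprn_gt0// ltr0n.
have hX i j : dominated (block_prob i j) (cell_avg g i j) /\
    ent (block_prob i j) (cell_avg g i j) <= fine (X i j) * N%:R ^+ 2.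
  apply: int_cell_ent => //; first exact: p01.
  by rewrite mulfK ?gt_eqF// fineK.
split=> [i j|]; first exact: (hX i j).1.
have {hc2} : \sum_(i < N) \sum_(j < N) fine (X i j) <= 2 * c.
  rewrite -lee_fin -sumEFin; apply: le_trans hc2; apply: lee_sum => i _.
  by rewrite -sumEFin; apply: lee_sum => j _; rewrite fineK.
rewrite -mulrA ler_pdivrMl// => h; apply: le_trans h.
rewrite ler_pdivrMr// mulr_suml; apply: ler_sum => i _.
by rewrite mulr_suml; apply: ler_sum => j _; exact: (hX i j).2.
Qed.

End block_model.

(** * Symmetric matrices indexed by edges *)

Section mcut_calculus.
Variables (R : realType) (N : nat).
Implicit Types (A B : 'I_N -> 'I_N -> R) (e : R).

Lemma mcutD A B e e' : mcut A e -> mcut B e' -> mcut (fun i j => A i j + B i j) (e + e').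
Proof.
move=> hA hB S T; rewrite mulrDl; under eq_bigr do rewrite big_split/=.
by rewrite big_split/=; apply: le_trans (ler_normD _ _) (lerD (hA S T) (hB S T)).
Qed.

Lemma mcutN A e : mcut A e -> mcut (fun i j => - A i j) e.
Proof.
move=> hA S T; under eq_bigr do rewrite sumrN.
by rewrite sumrN normrN.
Qed.

Lemma mcutW A e e' : e <= e' -> mcut A e -> mcut A e'.
Proof. by move=> ee hA S T; apply: le_trans (hA S T) _; rewrite ler_wpM2r// exprn_ge0. Qed.

(** The diagonal has only N of the N^2 entries. *)
Lemma mcut_diag (d : 'I_N -> R) e : (0 < N)%N -> (forall i, `|d i| <= 1) -> N%:R^-1 <= e ->
  mcut (fun i j => (i == j)%:R * d i) e.
Proof.
move=> N0 hd eN S T; have N0R : 0 < N%:R :> R by rewrite ltr0n.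
apply: (@le_trans _ _ N%:R); last first.
  apply: (@le_trans _ _ (N%:R^-1 * N%:R ^+ 2)); last by rewrite ler_wpM2r// exprn_ge0.
  by rewrite expr2 mulrA mulVf ?gt_eqF// mul1r.
apply: le_trans (ler_norm_sum _ _ _) _.
apply: (@le_trans _ _ (\sum_(i < N) 1)); last by rewrite sumr_const card_ord.
rewrite big_mkcond/=; apply: ler_sum => i _; case: ifPn => // _.
rewrite -mulr_suml normrM.
apply: (@le_trans _ _ (1 * 1)); last by rewrite mulr1.
apply: ler_pM => //; rewrite big_mkcond/= (bigD1 i)//= eqxx big1 ?addr0.
  by case: ifPn; rewrite ?normr1 ?normr0.
by move=> j /negbTE ji; rewrite eq_sym ji; case: ifPn.
Qed.

End mcut_calculus.

Section symmetric_matrices.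
Variables (R : realType) (N : nat).
Local Notation E := (edge N).
Implicit Types (q : E -> R) (d : 'I_N -> R) (S T : {set 'I_N}).

Definition inc (e : E) (i j : 'I_N) : bool := (val e == (i, j)) || (val e == (j, i)).

(** The symmetric matrix with entries q off the diagonal and d on it, as an
    expression that is linear in q. *)
Definition sym_mx q d (i j : 'I_N) : R := \sum_e q e * (inc e i j)%:R + (i == j)%:R * d i.

Lemma inc_val (e e' : E) : inc e' (val e).1 (val e).2 = (e' == e).
Proof.
rewrite /inc -surjective_pairing val_eqE; have [//|ne] := eqVneq e' e.
apply/eqP => E; have := valP e'; have := valP e; rewrite /= E /= => h.
by rewrite ltnNge ltnW.
Qed.

Lemma inc_sym (e : E) i j : inc e i j = inc e j i. Proof. exact: orbC. Qed.

Lemma inc_diag (e : E) i : inc e i i = false.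
Proof.
by rewrite /inc orbb; apply/eqP => E; have := valP e; rewrite /= E /= ltnn.
Qed.

Lemma sym_mx_edge q d e : sym_mx q d (val e).1 (val e).2 = q e.
Proof.
rewrite /sym_mx (bigD1 e)//= inc_val eqxx mulr1 big1 ?addr0 => [|e' ne]; last first.
  by rewrite inc_val (negbTE ne) mulr0.
have : (val e).1 != (val e).2 by have := valP e; rewrite /= ltn_neqAle => /andP[].
by move=> /negbTE ->; rewrite mul0r addr0.
Qed.

Lemma sym_mx_diag q d i : sym_mx q d i i = d i.
Proof.
by rewrite /sym_mx eqxx mul1r big1 ?add0r// => e _; rewrite inc_diag mulr0.
Qed.

Lemma sym_mx_sym q d i j : sym_mx q d i j = sym_mx q d j i.
Proof.
rewrite /sym_mx; congr (_ + _); first by apply: eq_bigr => e _; rewrite inc_sym.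
by case: (eqVneq i j) => [->//|_]; rewrite !mul0r.
Qed.

Lemma sym_ind (P : 'I_N -> 'I_N -> Prop) :
  (forall i j, P i j -> P j i) -> (forall e : E, P (val e).1 (val e).2) ->
  (forall i, P i i) -> forall i j, P i j.
Proof.
move=> Psym Pe Pd i j; have [ij|ij|/val_inj ->//] := ltngtP i j.
  exact: (Pe (exist _ (i, j) ij)).
by apply: Psym; exact: (Pe (exist _ (j, i) ij)).
Qed.

Lemma sym_mxE (F : 'I_N -> 'I_N -> R) : (forall i j, F i j = F j i) -> forall i j,
  F i j = sym_mx (fun e => F (val e).1 (val e).2) (fun i => F i i) i j.
Proof.
move=> Fsym; apply: sym_ind => [i j h|e|i].
- by rewrite Fsym h sym_mx_sym.
- by rewrite sym_mx_edge.
- by rewrite sym_mx_diag.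
Qed.

Lemma sum_sym (F : 'I_N -> 'I_N -> R) : (forall i j, F i j = F j i) ->
  \sum_i \sum_j F i j = 2 * \sum_(e : E) F (val e).1 (val e).2 + \sum_i F i i.
Proof.
move=> Fsym; under eq_bigr do under eq_bigr do rewrite (sym_mxE Fsym).
under eq_bigr do rewrite big_split/=.
rewrite big_split/=; congr (_ + _); last first.
  apply: eq_bigr => i _; rewrite (bigD1 i)//= eqxx mul1r big1 ?addr0// => j ji.
  by rewrite eq_sym (negbTE ji) mul0r.
under eq_bigr do rewrite exchange_big/=.
rewrite exchange_big/= mulr_sumr; apply: eq_bigr => e _.
rewrite pair_bigA/= -mulr_sumr mulrC; congr (_ * _).
have ne : val e != ((val e).2, (val e).1).
  by apply/eqP => /(congr1 fst) /= h; have := valP e; rewrite /= -h ltnn.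
rewrite (bigD1 (val e))//= (bigD1 ((val e).2, (val e).1)); last by rewrite eq_sym.
rewrite inc_val eqxx inc_sym inc_val eqxx big1 => [|[i j] /andP[h1 h2]].
  by rewrite /= addr0.
rewrite /inc /= eq_sym (negbTE h1)/=; case: eqP => // E.
by move: h2; rewrite /= E /= eqxx.
Qed.

Lemma adj_sym_mx (G : sgraph N) i j :
  (adj G i j)%:R = sym_mx (fun e => (e \in (G : {set E}))%:R) (fun=> 0) i j.
Proof.
rewrite /sym_mx mulr0 addr0 /adj; case: (boolP [exists e, _]) => [/existsP[e /andP[eG ie]]|/existsPn h].
  rewrite (bigD1 e)//= /inc ie eG mulr1 big1 ?addr0// => e' ne.
  case: (boolP (inc e' i j)) => [ie'|]; last by rewrite /inc => /negbTE ->; rewrite mulr0.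
  suff E : e' = e by rewrite E eqxx in ne.
  have {ie}ie : inc e i j by [].
  move: ie ie' => /orP[]/eqP ee.
    by rewrite -[i]/(i, j).1 -[X in inc _ _ X]/(i, j).2 -ee inc_val => /eqP.
  by rewrite inc_sym -[j]/(j, i).1 -[X in inc _ _ X]/(j, i).2 -ee inc_val => /eqP.
rewrite big1// => e _; have := h e; rewrite -/(inc e i j).
by case: (e \in _) => /=; [move/negbTE=> ->; rewrite mulr0|rewrite mul0r].
Qed.

Definition rect_weight S T (e : E) : R := \sum_(i in S) \sum_(j in T) (inc e i j)%:R.

Lemma sum_sym_mx S T q :
  \sum_(i in S) \sum_(j in T) sym_mx q (fun=> 0) i j = \sum_e rect_weight S T e * q e.
Proof.
rewrite /sym_mx; under eq_bigr do under eq_bigr do rewrite mulr0 addr0.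
under eq_bigr do rewrite exchange_big/=.
rewrite exchange_big/=; apply: eq_bigr => e _.
by rewrite /rect_weight mulr_suml; apply: eq_bigr => i _; rewrite mulr_suml; apply: eq_bigr => j _; rewrite mulrC.
Qed.

Lemma rect_weight_itv S T e : 0 <= rect_weight S T e <= 2.
Proof.
apply/andP; split; first by apply: sumr_ge0 => i _; apply: sumr_ge0.
have <- : \sum_i \sum_j (inc e i j)%:R = 2 :> R.
  rewrite sum_sym => [|i j]; last by rewrite inc_sym.
  rewrite [X in _ + X]big1 => [|i _]; last by rewrite inc_diag.
  rewrite (bigD1 e)//= inc_val eqxx big1 ?addr0 ?mulr1// => e' ne.
  by rewrite inc_val eq_sym (negbTE ne).
rewrite /rect_weight big_mkcond/=; apply: ler_sum => i _; case: ifPn => _.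
  by rewrite big_mkcond/=; apply: ler_sum => j _; case: ifPn.
exact: sumr_ge0.
Qed.

Lemma card_edge : (2 * #|{: E}|%:R <= N%:R ^+ 2 :> R).
Proof.
have := @sum_sym (fun _ _ => 1) (fun _ _ => erefl).
rewrite sum_sq1 sumr_const => ->.
rewrite lerDl; apply: sumr_ge0 => //.
Qed.

End symmetric_matrices.

(** * Probability estimates for finite graphs *)

Section tail.
Variables (R : realType) (E : finType) (q : E -> R).
Hypothesis hq : forall e, 0 <= q e <= 1.

(** A Chernoff bound. The conditional edge probabilities given A deviate from q
    by at least eta M in the direction b, so that the sum of their squared
    deviations is of order eta^2 M; by [ent_ge_sqr] this bounds below the
    entropy of [ln_bprob_le]. *)
Lemma tail_bound (A : pred {set E}) (b : E -> R) (eta M : R) :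
  (forall e, `|b e| <= 2) -> #|E|%:R <= M -> 0 < eta ->
  (forall G, A G -> eta * M <= \sum_e b e * ((e \in G)%:R - q e)) ->
  bprob q A <= expR (- (eta ^+ 2 * M / 16)).
Proof.
move=> hb EM eta0 hA; have [PA|] := ltP 0 (bprob q A); last first.
  by move=> h; apply: le_trans h _; exact: expR_ge0.
rewrite -ler_ln ?posrE ?expR_gt0// expRK; apply: le_trans (ln_bprob_le hq PA) _.
rewrite lerN2; set m := cond_mean q A.
have [w [w0 w1 wA wE]] := cond_mean_weights hq PA.
have h1 : eta * M <= \sum_e b e * (m e - q e).
  have -> : \sum_e b e * (m e - q e) = \sum_G w G * \sum_e b e * ((e \in G)%:R - q e).
    rewrite (eq_bigr (fun e => b e * m e - b e * q e)) => [|e _]; last by rewrite mulrBr.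
    rewrite sumrB wE -[X in _ - X]mul1r -[X in _ - X * _]w1 mulr_suml -sumrB; apply: eq_bigr => G _.
    by rewrite -mulrBr -sumrB; congr (_ * _); apply: eq_bigr => e _; rewrite mulrBr.
  rewrite -[leLHS]mul1r -[X in X * _ <= _]w1 mulr_suml; apply: ler_sum => G _.
  have [AG|nAG] := boolP (A G); first by rewrite ler_wpM2l// hA.
  by rewrite wA// !mul0r.
(* Young: b x <= (2 / eta) x^2 + eta / 2 when |b| <= 2 *)
have h2 : \sum_e b e * (m e - q e) <= 2 / eta * \sum_e (m e - q e) ^+ 2 + eta / 2 * M.
  apply: (@le_trans _ _ (\sum_e (2 / eta * (m e - q e) ^+ 2 + eta / 2))); last first.
    rewrite big_split/= -mulr_sumr lerD2l sumr_const -[X in X <= _]mulr_natr ler_wpM2l//.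
    by rewrite divr_ge0// ltW.
  apply: ler_sum => e _; set x := m e - q e.
  have := hb e; rewrite ler_norml => /andP[b1 b2].
  have b4 : b e ^+ 2 <= 4 by nra.
  have : 0 <= 2 / eta * (x - eta / 4 * b e) ^+ 2 by rewrite mulr_ge0 ?sqr_ge0// divr_ge0// ltW.
  have -> : 2 / eta * (x - eta / 4 * b e) ^+ 2 = 2 / eta * x ^+ 2 - b e * x + eta / 8 * b e ^+ 2.
    by field; rewrite gt_eqF.
  have : eta / 8 * b e ^+ 2 <= eta / 8 * 4 by rewrite ler_wpM2l// divr_ge0// ltW.
  by move: (eta / 8 * b e ^+ 2) (2 / eta * x ^+ 2) (b e * x) => u v w'; lra.
have h3 : \sum_e (m e - q e) ^+ 2 <= 4 * \sum_e ent (q e) (m e).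
  rewrite mulr_sumr; apply: ler_sum => e _; rewrite mulrC -ler_pdivrMr//.
  by apply: ent_ge_sqr; [exact: hq|exact: cond_mean_itv|exact: cond_mean_dominated].
have {h2} := le_trans h1 h2.
move: h3; set X := \sum_e _ ^+ 2; set Y := \sum_e ent _ _ => XY h2.
have : eta / 2 * (eta * M) <= eta / 2 * (2 / eta * X + eta / 2 * M).
  by rewrite ler_wpM2l// divr_ge0// ltW.
have -> : eta / 2 * (2 / eta * X + eta / 2 * M) = X + eta ^+ 2 * M / 4 by field; rewrite gt_eqF.
have -> : eta / 2 * (eta * M) = eta ^+ 2 * M / 2 by field.
by move: (eta ^+ 2 * M) => Z; lra.
Qed.

End tail.

Section graphs.
Variables (R : realType) (N : nat).
Local Notation E := (edge N).
Implicit Types (p q : E -> R) (A : pred (sgraph N)).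

Definition adjR (G : sgraph N) (i j : 'I_N) : R := (adj G i j)%:R.

Definition zdiag q := sym_mx q (fun=> 0).

Lemma sym_mx_zdiag q d i j : sym_mx q d i j = zdiag q i j + (i == j)%:R * d i.
Proof. by rewrite /zdiag /sym_mx mulr0 addr0. Qed.

Lemma card_signed_rect : #|{: signed_rect N}| = (2 * 4 ^ N)%N.
Proof. have cs : #|{: {set 'I_N}}| = (2 ^ N)%N.
  by rewrite -cardsT -powersetT card_powerset cardsT card_ord.
by rewrite !card_prod card_bool !cs -mulnA -expnMn. Qed.

Lemma sum_adj_zdiag (G : sgraph N) q (S T : {set 'I_N}) :
  \sum_(i in S) \sum_(j in T) (adjR G i j - zdiag q i j) =
  \sum_e rect_weight R S T e * ((e \in (G : {set E}))%:R - q e).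
Proof.
under eq_bigr do rewrite sumrB.
under eq_bigr do under eq_bigr do rewrite /adjR adj_sym_mx.
rewrite sumrB !sum_sym_mx -sumrB; apply: eq_bigr => e _.
by rewrite mulrBr.
Qed.

(** A union bound over the signed rectangles, with [tail_bound] for each of
    them. *)
Lemma concentration q (eta : R) : (forall e, 0 <= q e <= 1) -> 0 < eta ->
  bprob q (fun G => ~~ `[< mcut (fun i j => adjR G i j - zdiag q i j) eta >]) <=
  (2 * 4 ^ N)%:R * expR (- (eta ^+ 2 / 16 * N%:R ^+ 2)).
Proof.
move=> hq eta0; pose B (w : signed_rect N) : pred {set E} := fun G =>
  eta * N%:R ^+ 2 <= \sum_e ((-1) ^+ w.1.1 * rect_weight R w.1.2 w.2 e) * ((e \in G)%:R - q e).
apply: (@le_trans _ _ (\sum_(w : signed_rect N) bprob q (B w))).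
  apply: bprob_or => // G /asboolPn h.
  have [S [T hST]] : exists S T : {set 'I_N}, eta * N%:R ^+ 2 <
      `|\sum_(i in S) \sum_(j in T) (adjR G i j - zdiag q i j)|.
    apply: contrapT => nex; apply: h => S T; rewrite leNgt; apply/negP => hST.
    by apply: nex; exists S, T.
  move: hST; rewrite sum_adj_zdiag => hST.
  exists (\sum_e rect_weight R S T e * ((e \in (G : {set E}))%:R - q e) < 0, S, T).
  rewrite /B /=; under eq_bigr do rewrite -mulrA.
  rewrite -mulr_sumr; apply: ltW; apply: (lt_le_trans hST).
  case: ltP => [h0|h0]; first by rewrite ltr0_norm// expr1 mulN1r.
  by rewrite ger0_norm// expr0 mul1r.
apply: (@le_trans _ _ (\sum_(w : signed_rect N) expR (- (eta ^+ 2 / 16 * N%:R ^+ 2)))).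
  apply: ler_sum => w _; rewrite mulrAC.
  apply: (tail_bound (b := fun e => (-1) ^+ w.1.1 * rect_weight R w.1.2 w.2 e) hq) => //.
  - move=> e; rewrite normrM normrX normrN1 expr1n mul1r.
    by have /andP[h1 h2] := rect_weight_itv R w.1.2 w.2 e; rewrite ger0_norm.
  - by have := card_edge R N; have : 0 <= #|{: E}|%:R :> R by []; lra.
by rewrite sumr_const card_signed_rect mulr_natl.
Qed.

(** Change of measure to the product law of parameters q, under which A has
    probability at least 1 - delta by [concentration]. Since delta may be taken
    small, the entropy appears with a factor close to 1. *)
Lemma bprob_lower p q A (eta delta : R) :
  (forall e, 0 <= p e <= 1) -> (forall e, 0 <= q e <= 1) ->
  (forall e, dominated (p e) (q e)) -> 0 < eta -> delta <= 2^-1 ->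
  (2 * 4 ^ N)%:R * expR (- (eta ^+ 2 / 16 * N%:R ^+ 2)) <= delta ->
  (forall G, mcut (fun i j => adjR G i j - zdiag q i j) eta -> A G) ->
  0 < bprob p A /\
  - ((1 + 2 * delta) * \sum_e ent (p e) (q e) + 4) <= ln (bprob p A).
Proof.
move=> hp hq dom eta0 d2 hd hA.
have d0 : 0 <= delta by apply: le_trans hd; rewrite mulr_ge0// expR_ge0.
have QA : 1 - delta <= bprob q A.
  apply: (@le_trans _ _ (bprob q (fun G => `[< mcut (fun i j => adjR G i j - zdiag q i j) eta >]))).
    have := bprobC q (fun G => `[< mcut (fun i j => adjR G i j - zdiag q i j) eta >]).
    by have := le_trans (concentration hq eta0) hd; lra.
  by apply: le_bprob => // G /asboolP; exact: hA.
have QA0 : 0 < bprob q A by lra.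
have [PA le] := ln_bprob_ge hp hq dom QA0; split => //; apply: le_trans le.
have X0 : 0 <= \sum_e ent (p e) (q e) by apply: sumr_ge0 => e _; exact: ent_ge0.
move: X0; set X := \sum_e ent _ _ => X0.
have h1 : - 1 <= ln (bprob q A).
  apply: (@le_trans _ _ (ln (2^-1))); last by rewrite ler_ln ?posrE; lra.
  rewrite lnV ?posrE// lerN2.
  by have := @ln_le_subr1 R 2 ltac:(lra); lra.
have h2 : (X + 1) / bprob q A <= (1 + 2 * delta) * (X + 1).
  rewrite mulrC ler_wpM2r//; first lra.
  rewrite -[leLHS]mul1r ler_pdivrMr//.
  apply: (@le_trans _ _ ((1 + 2 * delta) * (1 - delta))); first nra.
  by rewrite ler_wpM2l//; lra.
have : (1 + 2 * delta) * (X + 1) <= (1 + 2 * delta) * X + 2 by lra.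
by move: (_ / _) h2 => Z; lra.
Qed.

(** The balls around the rectangle sums cover all graphs, so one of them
    carries enough of the mass of A. The ball is convex, so it contains the
    vector q of conditional edge probabilities given A and the ball, and also
    some graph of A. *)
Lemma bprob_upper p A (eps beta : R) m : (forall e, 0 <= p e <= 1) ->
  0 < eps -> 1 <= m%:R * eps ^+ 2 -> 0 < beta ->
  ((2 * 4 ^ N) ^ m)%:R * beta < bprob p A ->
  exists q, [/\ forall e, 0 <= q e <= 1, forall e, dominated (p e) (q e),
    \sum_e ent (p e) (q e) <= - ln beta &
    exists2 G, A G & mcut (fun i j => zdiag q i j - adjR G i j) (eps + eps)].
Proof.
move=> hp eps0 meps beta0 hA.
pose B (w : m.-tuple (signed_rect N)) : pred {set E} := fun G =>
  A G && `[< mcut (fun i j => adjR G i j - rect_sum eps w i j) eps >].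
have [w hw] : exists w, beta < bprob p (B w).
  apply: contrapT => nex; move: hA; apply/negP; rewrite -leNgt.
  apply: (@le_trans _ _ (\sum_w bprob p (B w))).
    apply: bprob_or => // G AG.
    have a1 i j : `|adjR G i j| <= 1 by rewrite /adjR; case: adj; rewrite ?normr1 ?normr0.
    have [w hw] := regularity eps0 meps a1.
    by exists w; rewrite /B AG; apply/asboolP.
  apply: (@le_trans _ _ (\sum_(w : m.-tuple (signed_rect N)) beta)).
    by apply: ler_sum => w _; rewrite leNgt; apply/negP => h; apply: nex; exists w.
  by rewrite sumr_const card_tuple card_signed_rect -[leLHS]mulr_natl.
have PB : 0 < bprob p (B w) by exact: lt_trans hw.
exists (cond_mean p (B w)); split.
- by move=> e; exact: cond_mean_itv.
- by move=> e; exact: cond_mean_dominated.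
- have := ln_bprob_le hp PB; have : ln beta <= ln (bprob p (B w)) by rewrite ler_ln ?posrE// ltW.
  by lra.
have [v [v0 v1 vB vE]] := cond_mean_weights hp PB.
have hmean : mcut (fun i j => zdiag (cond_mean p (B w)) i j - rect_sum eps w i j) eps.
  move=> S T.
  have -> : \sum_(i in S) \sum_(j in T) (zdiag (cond_mean p (B w)) i j - rect_sum eps w i j) =
      \sum_G v G * \sum_(i in S) \sum_(j in T) (adjR G i j - rect_sum eps w i j).
    under eq_bigr do rewrite sumrB.
    rewrite sumrB /zdiag sum_sym_mx vE -[X in _ - X]mul1r -[X in _ - X * _]v1 mulr_suml -sumrB.
    apply: eq_bigr => G _; rewrite -mulrBr; congr (_ * _).
    under [in RHS]eq_bigr do rewrite sumrB.
    under [in RHS]eq_bigr do under eq_bigr do rewrite /adjR adj_sym_mx.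
    by rewrite sumrB sum_sym_mx.
  apply: le_trans (ler_norm_sum _ _ _) _.
  rewrite -[leRHS]mul1r -[X in _ <= X * _]v1 mulr_suml; apply: ler_sum => G _.
  rewrite normrM ger0_norm//; have [/andP[_ /asboolP BG]|nBG] := boolP (B w G).
    by rewrite ler_wpM2l.
  by rewrite vB// !mul0r.
have [G BG] : exists G, B w G.
  apply: contrapT => nex; move: PB; rewrite /bprob big1 ?ltxx// => G BG.
  by exfalso; apply: nex; exists G.
move: BG => /andP[AG /asboolP hG]; exists G => //.
apply: eq_mcut (mcutD hmean (mcutN hG)) => i j /=.
ring.
Qed.

End graphs.

Section growth.
Variable R : realType.

(** The size of the nets and of the union bounds is the exponential of O(N),
    which is negligible at speed N^2. *)
Lemma growth (m : nat) (K delta : R) : 0 < K -> 0 < delta -> exists M, forall N, (M <= N)%N ->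
  ((2 * 4 ^ N) ^ m)%:R * expR (- (K * N%:R ^+ 2)) <= delta.
Proof.
move=> K0 d0; pose L := m%:R * ln (8 : R).
exists (maxn 1 (maxn (Num.bound ((L + 1) / K)) (Num.bound (delta^-1)))) => N.
rewrite !geq_max => /and3P[N1 NL Nd].
have L0 : 0 <= L by rewrite mulr_ge0// ln_ge0// ler1n.
have hL : L + 1 <= K * N%:R.
  rewrite mulrC -ler_pdivrMr//; apply: le_natr_bound NL.
  by rewrite divr_ge0// ?ltW//; lra.
have hd : delta^-1 <= N%:R by apply: le_natr_bound Nd; rewrite invr_ge0 ltW.
have h8 : ((2 * 4 ^ N) ^ m)%:R <= expR (L * N%:R).
  have -> : L * N%:R = (N * m)%:R * ln 8 by rewrite /L natrM; ring.
  rewrite expRM_natl lnK ?posrE// -natrX ler_nat expnM.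
    by case: (posnP m) => [->//|m0]; rewrite leq_exp2r// (expnMn 2 4) leq_mul2r (@leq_exp2l 2 1) ?N1 ?orbT.
apply: (@le_trans _ _ (expR (L * N%:R) * expR (- (K * N%:R ^+ 2)))).
  by rewrite ler_wpM2r// expR_ge0.
rewrite -expRD.
apply: (@le_trans _ _ (expR (- N%:R))).
  rewrite ler_expR; have : (L + 1) * N%:R <= K * N%:R * N%:R by rewrite ler_wpM2r.
  by rewrite expr2 mulrA; lra.
rewrite expRN -[leRHS]invrK lef_pV2 ?posrE ?expR_gt0 ?invr_gt0//.
by apply: le_trans hd _; apply: le_trans (expR_ge1Dx _); lra.
Qed.

End growth.

(** * Extended real limits and the law of the class *)

Section ereal_limits.
Variable R : realType.
Implicit Types (u : nat -> \bar R) (x y b : \bar R).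
Local Open Scope ereal_scope.

Lemma ereal_between x y : x < y -> exists2 r : R, x < r%:E & r%:E < y.
Proof.
case: x y => [x||] [y||] //= xy.
- by exists ((x + y) / 2)%R; rewrite lte_fin; move: xy; rewrite lte_fin => xy; lra.
- by exists (x + 1)%R; rewrite ?ltry// lte_fin; lra.
- by exists (y - 1)%R; rewrite ?ltNyr// lte_fin; lra.
- by exists 0%R; rewrite ?ltNyr// ltry.
Qed.

Lemma limn_esup_le u b M : (forall n, (M <= n)%N -> u n <= b) -> limn_esup u <= b.
Proof.
move=> ub; rewrite limn_esup_lim (cvg_lim _ (cvg_esups_inf (u := u)))//.
apply: ge_ereal_inf; exists (esups u M); first by exists M.
by apply: ge_ereal_sup => _ [n /= Mn <-]; exact: ub.
Qed.

Lemma limn_einf_ge u b M : (forall n, (M <= n)%N -> b <= u n) -> b <= limn_einf u.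
Proof.
move=> ub; rewrite -leeN2 -limn_esupN; apply: (@limn_esup_le _ _ M) => n Mn /=.
by rewrite leeN2 ub.
Qed.

End ereal_limits.

Section class_law.
Variables (R : realType) (W0 : graphon R) (N : nat).

Lemma class_lawE (U : set (graphon_class R)) :
  class_law W0 N U = (bprob (edge_prob W0 (N:=N)) (fun G => `[< U (empirical_class R G) >]))%:E.
Proof.
rewrite /class_law /distribution /pushforward /= /sgraph_law /bprob.
rewrite [in RHS]big_mkcond/= -sumEFin; apply: eq_bigr => G _.
rewrite diracE; case: (asboolP (U _)) => h.
  by rewrite mem_set// mule1.
by rewrite memNset// mule0.
Qed.

Lemma empirical_step (G : sgraph N) z : (0 < N)%N -> unit_sq R z ->
  empirical R G z = step (adjR R G) z :> R.
Proof.
move=> N0; case: z => x y /(sq_cell N0)[i [j [/= ix jy]]].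
rewrite (stepE N0 (adjR R G) ix jy) /empirical_fun indicE /adjR; congr (nat_of_bool _)%:R.
apply/idP/idP => [|ij]; rewrite inE => //=; last by exists i, j.
move=> [i' [j' [/= ix' jy' ij]]].
have -> : i = i' by apply: val_inj; exact: cell_inj N0 _ _ _ ix ix'.
by have -> : j = j' by apply: val_inj; exact: cell_inj N0 _ _ _ jy jy'.
Qed.

End class_law.

(** * The lower bound *)

Section approximation.
Variable R : realType.
Local Notation sq := (unit_sq R).

Lemma cell_avg_sym N (h : graphon R) (i j : 'I_N) : (0 < N)%N ->
  cell_avg h i j = cell_avg h j i.
Proof.
move=> N0; rewrite /cell_avg; congr (_ * _).
have hsub := @cell_sub R N N0; have h0 z : sq z -> 0 <= h z by move=> /(graphon_itv h) /andP[].
rewrite -(int_swap _ _ (hsub i) (hsub j) (bounded_meas_graphon h) h0)//.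
apply: eq_Rintegral => -[x y]; rewrite inE => /(cellX_sub N0) /graphon_sym.
by rewrite /swap.
Qed.

Lemma cell_avg_approx (h : graphon R) (e : R) : 0 < e -> exists M, forall N, (M <= N)%N -> (0 < N)%N ->
  L1norm (fun z => h z - step (cell_avg (N := N) h) z) <= e.
Proof.
move=> e0; have bh := bounded_meas_graphon h.
have [M hM] := step_dense bh (divr_gt0 e0 (ltr0n R 2)).
exists M => N MN N0; have [a ha] := hM N MN.
apply: le_trans (L1norm_avg N0 a bh) _.
by rewrite mulrC -ler_pdivlMr.
Qed.

Lemma cut_metric_empirical N (G : sgraph N) (q : 'I_N -> 'I_N -> R) (h : graphon R) (d e : R) :
  (0 < N)%N -> L1norm (fun z => h z - step q z) <= d ->
  mcut (fun i j => q i j - adjR R G i j) e ->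
  cut_metric h (empirical R G) <= d + e.
Proof.
move=> N0 hL hq; have bh := bounded_meas_graphon h; have bq := bounded_meas_step q.
have be := bounded_meas_graphon (empirical R G).
have h1 := cut_leW hL (cut_le_L1 (bounded_measB bh bq)).
have h2 : cut_le (fun z => step q z - empirical R G z) e.
  apply: eq_cut_le (cut_le_step N0 hq) => z sz.
  by rewrite -stepB empirical_step.
apply: (@cut_metric_le _ _ _ id).
- by apply: addr_ge0; exact: cut_le_ge0 h1 || exact: cut_le_ge0 h2.
- exact: mp_bij_id.
- have := cut_le_tri bh bq be h1 h2.
  by apply: eq_cut_le => -[x y].
Qed.

Lemma class_metric_to_class (C : graphon_class R) (F : graphon R) :
  class_metric C (to_class F) <= cut_metric (class_repr C) F.
Proof.
apply: le_trans (cut_metric_tri _ F _) _.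
by rewrite (class_repr_sim F).1 addr0.
Qed.

End approximation.

Section lower_bound.
Variables (R : realType) (k : nat) (W0 : graphon R) (p : 'I_k -> 'I_k -> R).
Hypotheses (k0 : (0 < k)%N) (p01 : forall a b, 0 <= p a b <= 1) (psym : forall a b, p a b = p b a).
Hypothesis W0p : forall (a b : 'I_k) x y, cell R k a x -> cell R k b y -> W0 (x, y) = p a b.

Lemma block_prob_sym n (i j : 'I_(k * n)) : block_prob p i j = block_prob p j i.
Proof. exact: psym. Qed.

Lemma ent_edges n (q : 'I_(k * n) -> 'I_(k * n) -> R) : (0 < n)%N -> (forall i j, q i j = q j i) ->
  \sum_i \sum_j ent (block_prob p i j) (q i j) =
  2 * \sum_(e : edge (k * n)) ent (edge_prob W0 e) (q (val e).1 (val e).2)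
  + \sum_i ent (block_prob p i i) (q i i).
Proof.
move=> n0 qsym; rewrite (@sum_sym _ _ (fun i j => ent (block_prob p i j) (q i j))).
  congr (2 * _ + _); apply: eq_bigr => e _.
  by rewrite (edge_prob_block k0 n0 W0p).
by move=> i j; rewrite block_prob_sym qsym.
Qed.

(** A graphon h near C with I(h) < c is replaced by its cell averages q. Graphs
    whose adjacency matrix is close to q have their class in U, and
    [bprob_lower] bounds their probability below. *)
Lemma ldp_lower (U : set (graphon_class R)) C (c : R) : open U -> U C ->
  (rate_J W0 C < c%:E)%E -> exists M, forall n, (M <= n)%N ->
  ((- c)%:E <= (((k * n.+1)%:R ^+ 2)^-1)%:E * lne (class_law W0 (k * n.+1) U))%E.
Proof.
move=> oU UC; rewrite /rate_J; case: asboolP => [_|_]; last by rewrite ltNge leey.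
move=> Jc; have [e0 e00 he0] : exists2 e : R, 0 < e & forall D, class_metric C D < e -> U D by exact: oU.
pose eta := e0 / 8; have eta0 : 0 < eta by rewrite divr_gt0.
have [h hC hc] : exists2 h : graphon R, cut_metric (class_repr C) h <= eta & (rate_I W0 h < c%:E)%E.
  have : (ereal_inf [set rate_I W0 h | h in [set h | (cut_metric (class_repr C) h <= eta)%R]] < c%:E)%E.
    by apply: le_lt_trans Jc; apply: ereal_sup_ubound; exists eta.
  by move=> /ereal_inf_lt[_ [h /= hC <-] hc]; exists h.
have [c' hc' c'c] : exists2 c' : R, (rate_I W0 h <= c'%:E)%E & c' < c.
  have [c' h1 h2] := ereal_between hc; exists c'; first exact: ltW.
  by rewrite -lte_fin.
have [M1 hM1] := cell_avg_approx h eta0.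
have c'0 : 0 <= c'.
  rewrite -lee_fin; apply: le_trans hc'; rewrite /rate_I mule_ge0//.
  by apply: integral_ge0 => z sz; apply: rel_entropy_ge0; exact: graphon_itv.
(* small enough for the factor 1 + 2 * delta to cost at most (c - c') / 2 *)
pose delta := Num.min 2^-1 ((c - c') / (4 * (c' + 1))).
have delta0 : 0 < delta.
  by rewrite /delta lt_min invr_gt0 ltr0n/= divr_gt0 ?mulr_gt0 ?subr_gt0//; lra.
have deltac : 2 * delta * c' <= (c - c') / 2.
  have : delta * (4 * (c' + 1)) <= c - c'.
    by rewrite -ler_pdivlMr ?mulr_gt0//; [rewrite /delta ge_min lexx orbT|lra].
  by move: (delta) delta0 => d d0; nra.
have K0 : 0 < eta ^+ 2 / 16 by rewrite divr_gt0// exprn_gt0.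
have [M2 hM2] := @growth R 1 _ _ K0 delta0.
exists (maxn (maxn M1 M2) (maxn (Num.bound (eta^-1)) (Num.bound (8 / (c - c'))))) => n.
rewrite !geq_max => /andP[/andP[M1n M2n] /andP[b1n b2n]].
have n0 := ltn0Sn n; have N0 : (0 < k * n.+1)%N by rewrite muln_gt0 k0.
have nN : (n <= k * n.+1)%N by apply: leq_trans (leqnSn n) _; rewrite leq_pmull.
set N := (k * n.+1)%N in N0 nN *.
have hL := hM1 N (leq_trans M1n nN) N0.
have hG := hM2 N (leq_trans M2n nN).
have N0R : 0 < N%:R :> R by rewrite ltr0n.
have Neta : eta^-1 <= N%:R.
  by apply: le_natr_bound (leq_trans b1n nN); rewrite invr_ge0 ltW.
have Nc : 8 / (c - c') <= N%:R.
  by apply: le_natr_bound (leq_trans b2n nN); rewrite divr_ge0// subr_ge0 ltW.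
pose q := cell_avg (N := N) h.
have q01 i j : 0 <= q i j <= 1.
  apply: cell_avg_itv => //; first exact: bounded_meas_graphon.
  by move=> z; exact: graphon_itv.
have qsym i j : q i j = q j i by exact: cell_avg_sym.
have [dom Iq] := rate_I_avg k0 n0 p01 W0p hc'.
pose pe : edge N -> R := edge_prob W0 (N := N).
pose qe (e : edge N) := q (val e).1 (val e).2.
have hX : \sum_e ent (pe e) (qe e) <= c' * N%:R ^+ 2.
  move: Iq; rewrite -/N ler_pdivrMr ?exprn_gt0// (@ent_edges n.+1)//.
  have : 0 <= \sum_(i < k * n.+1) ent (block_prob p i i) (q i i).
    by apply: sumr_ge0 => i _; apply: ent_ge0; [exact: p01|exact: q01|exact: dom].
  rewrite /pe /qe; set Y := \sum_i _; set X := \sum_e _; move: (c' * _) => Z; lra.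
have [|||||||PA hP] := @bprob_lower R N pe qe (fun G => `[< U (empirical_class R G) >]) eta delta.
- by move=> e; exact: edge_prob_itv.
- by move=> e; exact: q01.
- by move=> e; rewrite /pe (edge_prob_block k0 n0 W0p); exact: dom.
- exact: eta0.
- by rewrite /delta ge_min lexx.
- by move: hG; rewrite expn1.
- move=> G hG'; apply/asboolP/he0; apply: le_lt_trans (class_metric_to_class _ _) _.
  apply: le_lt_trans (cut_metric_tri _ h _) _.
  have : cut_metric h (empirical R G) <= eta + (eta + eta).
    apply: (cut_metric_empirical N0 hL).
    have hd : mcut (fun i j : 'I_N => (i == j)%:R * q i i) eta.
      apply: mcut_diag => //; first by move=> i; have /andP[q0 q1] := q01 i i; rewrite ger0_norm.
      by rewrite -[leRHS]invrK lef_pV2 ?posrE ?invr_gt0.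
    apply: eq_mcut (mcutD (mcutN hG') hd) => i j.
    have := sym_mxE qsym i j; rewrite sym_mx_zdiag -/q -/qe => ->.
    by move: (adjR _ _ _ _) (zdiag _ _ _) => u v; ring.
  move=> hG''; apply: le_lt_trans (lerD hC hG'') _.
  have -> : eta + (eta + (eta + eta)) = e0 / 2 by rewrite /eta; field.
  by rewrite gtr_pMr// invf_lt1// ltr1n.
rewrite class_lawE lne_EFin// -EFinM lee_fin ler_pdivlMl ?exprn_gt0//.
apply: le_trans hP; rewrite mulrN lerN2 [leRHS]mulrC.
have hN : 4 <= (c - c') / 2 * N%:R ^+ 2.
  have N1 : 1 <= N%:R :> R by rewrite ler1n.
  have : 8 <= N%:R * (c - c') by rewrite -ler_pdivrMr// subr_gt0.
  have : N%:R * (c - c') <= N%:R * (c - c') * N%:R by rewrite ler_peMr// mulr_ge0// subr_ge0 ltW.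
  by rewrite expr2; lra.
apply: (@le_trans _ _ ((1 + 2 * delta) * (c' * N%:R ^+ 2) + 4)).
  by rewrite lerD2r ler_wpM2l//; lra.
have : 2 * delta * c' * N%:R ^+ 2 <= (c - c') / 2 * N%:R ^+ 2.
  by rewrite ler_wpM2r// exprn_ge0.
by move: (N%:R ^+ 2) hN => Z; lra.
Qed.

End lower_bound.

(** * The upper bound and the large deviation principle *)

Section upper_bound.
Variables (R : realType) (k : nat) (W0 : graphon R) (p : 'I_k -> 'I_k -> R).
Hypotheses (k0 : (0 < k)%N) (p01 : forall a b, 0 <= p a b <= 1) (psym : forall a b, p a b = p b a).
Hypothesis W0p : forall (a b : 'I_k) x y, cell R k a x -> cell R k b y -> W0 (x, y) = p a b.
Local Notation sq := (unit_sq R).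
Local Notation plane := (mR R * mR R)%type.

(** The blocks outside Omega. *)
Definition degenerate (a b : 'I_k) := (p a b == 0) || (p a b == 1).

Lemma pull_step_degenerate n (q : 'I_(k * n) -> 'I_(k * n) -> R) phi a b z :
  (0 < n)%N -> blockwise k phi -> (forall i j, dominated (block_prob p i j) (q i j)) ->
  degenerate a b -> (cell R k a `*` cell R k b) z -> pull phi (step q) z = p a b.
Proof.
move=> n0 bphi dom dab [/= za zb]; have N0 : (0 < k * n)%N by rewrite muln_gt0 k0.
have blk (c : 'I_k) x : cell R k c x -> exists2 i : 'I_(k * n), cell R (k * n) i (phi x) & block i = c.
  move=> cx; have [i ix] := cell_exists N0 (cell_sub k0 (bphi _ _ cx)).
  exists i => //; apply: val_inj.
  exact: (cell_inj k0 (cell_block k0 n0 ix) (bphi _ _ cx)).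
have [i ix ia] := blk _ _ za; have [j jy jb] := blk _ _ zb.
rewrite /pull (stepE N0 q ix jy); have [d0 d1] := dom i j.
have E : block_prob p i j = p a b by rewrite /block_prob ia jb.
by case/orP: dab => /eqP pab; rewrite pab; [apply: d0|apply: d1]; rewrite E.
Qed.

(** On a block where W0 is 0 or 1, domination forces each q, composed with a
    blockwise map, to be equal to W0. The integral of g - W0 on the block then
    vanishes; as g lies in [0, 1] this difference has a constant sign. *)
Lemma limit_W_Omega (g : graphon R) :
  (forall e, 0 < e -> exists n (q : 'I_(k * n) -> 'I_(k * n) -> R) phi,
    [/\ (0 < n)%N, mp_bij phi, blockwise k phi,
        forall i j, dominated (block_prob p i j) (q i j) &
        cut_le (fun z => g z - pull phi (step q) z) e]) ->
  W_Omega W0 g.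
Proof.
move=> hg; have bg := bounded_meas_graphon g.
pose B (a b : 'I_k) : set plane := [set z | (cell R k a `*` cell R k b) z /\ g z != p a b].
have negB a b : degenerate a b -> (leb2 R).-negligible (B a b).
  move=> dab; pose D : set plane := cell R k a `*` cell R k b.
  have mD : measurable D := measurable_cellX k a b.
  have DS : D `<=` sq := cellX_sub k0 (i := a) (j := b).
  have bgp : bounded_meas (fun z => g z - p a b) := bounded_measB bg (bounded_meas_cst _).
  have ibgp := bounded_meas_integrable mD DS bgp.
  have int0 : \int[leb2 R]_(z in D) (g z - p a b) = 0.
    apply/eqP; rewrite -normr_eq0 eq_le normr_ge0 andbT; apply/ler_addgt0Pr => e e0.
    rewrite add0r; have [n [q [phi [n0 mp bphi dom hcut]]]] := hg e e0.
    have := hcut _ _ (measurable_cell k a) (measurable_cell k b) (cell_sub k0 (i := a)) (cell_sub k0 (i := b)).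
    rewrite (@eq_Rintegral _ _ _ _ _ (fun z => g z - p a b)) // => z; rewrite inE => Dz.
    by rewrite (pull_step_degenerate n0 bphi dom dab Dz).
  have abs0 : \int[leb2 R]_(z in D) `|g z - p a b| = 0.
    case/orP: (dab) => /eqP pab; move: int0; rewrite pab => int0.
      rewrite -[RHS]int0; apply: eq_Rintegral => z; rewrite inE => /DS /(graphon_itv g)/andP[g0 _].
      by rewrite subr0 ger0_norm.
    rewrite -[RHS]oppr0 -int0 -[RHS]mulN1r -RintegralZl//; last by rewrite -pab.
    apply: eq_Rintegral => z; rewrite inE => /DS /(graphon_itv g)/andP[_ g1].
    by rewrite mulN1r ler0_norm// subr_le0.
  have mg : measurable_fun D (fun z => (g z - p a b)%:E).
    by apply/measurable_EFinP; apply: measurable_funS bgp.1.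
  have := (ae_eq_integral_abs (leb2 R) mD mg).1.
  have -> : (\int[leb2 R]_(z in D) `|(g z - p a b)%:E| = 0)%E.
    have ia := bounded_meas_integrable mD DS (bounded_meas_norm bgp).
    rewrite -[LHS]fineK; last exact: integrable_fin_num ia.
    by congr (_%:E); exact: abs0.
  move=> /(_ erefl); apply: negligibleS => z [Dz gz] /= /(_ Dz) [] /eqP.
  by rewrite subr_eq0 (negbTE gz).
pose F (m : nat) : set plane :=
  if (unpickle m : option ('I_k * 'I_k)) is Some ab then
    (if degenerate ab.1 ab.2 then B ab.1 ab.2 else set0) else set0.
have negF m : (leb2 R).-negligible (F m).
  rewrite /F; case: unpickle => [ab|]; last exact: negligible_set0.
  by case: ifPn => [/negB|_] //; exact: negligible_set0.
apply: negligibleS (negligible_bigcup negF) => z /= /existsNP[h /eqP gW].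
move: h => [sz nO]; have [a [b [za zb]]] := sq_cell k0 sz.
have WE : W0 z = p a b by case: (z) za zb => x y /= za zb; exact: W0p.
exists (pickle (a, b)) => //; rewrite /F pickleK /=; case: ifPn => [_|].
  by split; [split|rewrite -WE].
rewrite negb_or => /andP[p0 p1]; exfalso; apply: nO; split => //.
rewrite WE; have /andP[h0 h1] := p01 a b.
by rewrite !lt_neqAle eq_sym p0 h0 p1 h1.
Qed.

Lemma cut_metric_step_graphon N (q : 'I_N -> 'I_N -> R) (N0 : (0 < N)%N)
  (qs : forall i j, q i j = q j i) (q1 : forall i j, 0 <= q i j <= 1) (g : graphon R) phi (e : R) :
  0 <= e -> mp_bij phi -> cut_le (fun z => g z - pull phi (step q) z) e ->
  cut_metric g (step_graphon N0 qs q1) <= e.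
Proof. by move=> e0 mp; exact: (@cut_metric_le _ _ (step_graphon N0 qs q1)). Qed.

(** A probability above exp (- c N^2) for arbitrarily large N gives, at every
    scale, a graph with class in F and, close to it, a matrix q of rate at most
    c'. A limit point g of these matrices is also a limit of classes in F, and
    the matrices are witnesses of J(g) <= c' for every radius eta. *)
Lemma ldp_upper (F : set (graphon_class R)) (c c' : R) : closed F -> c < c' ->
  (forall M, exists2 n, (M <= n)%N &
    ((- c)%:E < (((k * n.+1)%:R ^+ 2)^-1)%:E * lne (class_law W0 (k * n.+1) F))%E) ->
  exists2 C, F C & (rate_J W0 C <= c'%:E)%E.
Proof.
move=> cF cc' hF.
pose T := {n : nat & (('I_(k * n.+1) -> 'I_(k * n.+1) -> R) * sgraph (k * n.+1))%type}.
pose good m (t : T) := let: existT n (q, G) := t in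
  [/\ forall i j, q i j = q j i, forall i j, 0 <= q i j <= 1 &
      forall i j, dominated (block_prob p i j) (q i j)] /\
  [/\ 2^-1 * (\sum_i \sum_j ent (block_prob p i j) (q i j)) / (k * n.+1)%:R ^+ 2 <= c',
      F (to_class (empirical R G)) & mcut (fun i j => q i j - adjR R G i j) m.+1%:R^-1].
have hgood m : exists t, good m t.
  (* three errors of size eps: two from the net, one from the diagonal *)
  pose eps : R := (3 * m.+1)%:R^-1.
  have eps0 : 0 < eps by rewrite invr_gt0 ltr0n.
  have heps : 1 <= (((3 * m.+1) ^ 2)%N)%:R * eps ^+ 2.
    by rewrite natrX -exprMn divff ?expr1n// pnatr_eq0.
  have [M1 hM1] := @growth R ((3 * m.+1) ^ 2)%N (c' - c) 1 ltac:(by rewrite subr_gt0) ltr01.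
  have [n] := hF (maxn M1 (3 * m.+1)); rewrite geq_max => /andP[M1n mn] hn.
  have n0 := ltn0Sn n; have N0 : (0 < k * n.+1)%N by rewrite muln_gt0 k0.
  have nN : (n <= k * n.+1)%N by apply: leq_trans (leqnSn n) _; rewrite leq_pmull.
  have {hM1}hG := hM1 _ (leq_trans M1n nN).
  have N2 : 0 < (k * n.+1)%:R ^+ 2 :> R by rewrite exprn_gt0// ltr0n.
  move: hn; rewrite class_lawE; set P := bprob _ _ => hn.
  have P0 : 0 < P.
    rewrite ltNge; apply/negP => P0; move: hn.
    by rewrite le0_lneNy ?lee_fin// gt0_muleNy ?lte_fin ?invr_gt0// ltNge leNye.
  have hP : expR (- (c * (k * n.+1)%:R ^+ 2)) < P.
    rewrite -[ltRHS]lnK ?posrE// ltr_expR.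
    move: hn; rewrite lne_EFin// -EFinM lte_fin ltr_pdivlMl//.
    by rewrite mulrN mulrC.
  pose beta : R := expR (- (c' * (k * n.+1)%:R ^+ 2)).
  have hbeta : ((2 * 4 ^ (k * n.+1)) ^ ((3 * m.+1) ^ 2))%:R * beta < P.
    apply: le_lt_trans hP; rewrite /beta.
    have -> : - (c' * (k * n.+1)%:R ^+ 2) = - ((c' - c) * (k * n.+1)%:R ^+ 2) - c * (k * n.+1)%:R ^+ 2 by ring.
    by rewrite expRD mulrA ler_piMl// expR_ge0.
  have [q0 [q01 dom hent [G /asboolP FG hG']]] :=
    bprob_upper (edge_prob_itv W0 (N := k * n.+1)) eps0 heps (expR_gt0 _) hbeta.
  (* the diagonal is chosen so as to have entropy 0 *)
  pose q := sym_mx q0 (fun i => block_prob p i i).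
  have dom' i j : dominated (block_prob p i j) (q i j).
    apply: (@sym_ind _ (fun i j => dominated (block_prob p i j) (q i j))).
    - by move=> i' j'; rewrite block_prob_sym// /q sym_mx_sym.
    - by move=> e; rewrite /q sym_mx_edge -(edge_prob_block k0 n0 W0p).
    - by move=> i'; rewrite /q sym_mx_diag; split.
  exists (existT _ n (q, G)); split; split.
  - by move=> i j; rewrite /q sym_mx_sym.
  - apply: (@sym_ind _ (fun i j => 0 <= q i j <= 1)).
    + by move=> i j; rewrite /q sym_mx_sym.
    + by move=> e; rewrite /q sym_mx_edge.
    + by move=> i; rewrite /q sym_mx_diag p01.
  - exact: dom'.
  - rewrite ler_pdivrMr// (ent_edges k0 psym W0p n0); last by move=> i j; rewrite /q sym_mx_sym.
    rewrite [X in _ + X]big1 => [|i _]; last by rewrite /q sym_mx_diag ent_self.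
    rewrite addr0 mulrA mulVf// mul1r; under eq_bigr do rewrite /q sym_mx_edge.
    by move: hent; rewrite /beta expRK opprK.
  - exact: FG.
  - have hd : mcut (fun i j : 'I_(k * n.+1) => (i == j)%:R * block_prob p i i) eps.
      apply: mcut_diag => //; first by move=> i; have /andP[h0 h1] := p01 (block i) (block i); rewrite ger0_norm.
      rewrite /eps lef_pV2 ?posrE ?ltr0n// ler_nat; exact: leq_trans mn nN.
    have -> : m.+1%:R^-1 = eps + eps + eps.
      have : m.+1%:R != 0 :> R by rewrite pnatr_eq0.
      by rewrite /eps natrM; move: (m.+1%:R : R) => u u0; field.
    apply: eq_mcut (mcutD hG' hd) => i j /=; rewrite /q sym_mx_zdiag.
    by rewrite addrAC.
have [t ht] := choice hgood.
pose n m := (projT1 (t m)).+1.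
pose q m : 'I_(k * n m) -> 'I_(k * n m) -> R := (projT2 (t m)).1.
pose G m : sgraph (k * n m) := (projT2 (t m)).2.
have hq m : [/\ forall i j, q m i j = q m j i, forall i j, 0 <= q m i j <= 1 &
      forall i j, dominated (block_prob p i j) (q m i j)] /\
  [/\ 2^-1 * (\sum_i \sum_j ent (block_prob p i j) (q m i j)) / (k * n m)%:R ^+ 2 <= c',
      F (to_class (empirical R (G m))) & mcut (fun i j => q m i j - adjR R (G m) i j) m.+1%:R^-1].
  by have := ht m; rewrite /good /q /G /n; case: (t m) => n' [q' G'].
have n0 m : (0 < n m)%N by [].
have N0 m : (0 < k * n m)%N by rewrite muln_gt0 k0.
have [g hg] := block_compactness k0 n0 (fun m => let: conj (And3 _ h _) _ := hq m in h)
  (fun m => let: conj (And3 h _ _) _ := hq m in h).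
have gO : W_Omega W0 g.
  apply: limit_W_Omega => e e0; have [m [phi [_ mp bphi hcut]]] := hg e e0 0%N.
  by exists (n m), (q m), phi; split => //; case: (hq m) => -[].
have gsim := class_repr_sim g.
exists (to_class g).
  apply: contrapT => nF; have oF : open (~` F) by exact: closed_openC.
  have [e e0 he] : exists2 e : R, 0 < e & forall D, class_metric (to_class g) D < e -> (~` F) D.
    exact: oF.
  have e4 : 0 < e / 4 by rewrite divr_gt0.
  have [m [phi [Mm mp _ hcut]]] := hg _ e4 (Num.bound (e / 4)^-1).
  have [[qs q1 _] [_ FG hG]] := hq m; apply: (he (to_class (empirical R (G m)))) FG.
  apply: le_lt_trans (class_metric_to_class _ _) _.
  apply: le_lt_trans (cut_metric_tri _ g _) _; rewrite gsim.2 add0r.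
  have hm : m.+1%:R^-1 <= e / 4 by exact: natr_inv_le.
  have h1 : cut_metric g (step_graphon (N0 m) qs q1) <= e / 4.
    exact: (cut_metric_step_graphon (N0 m) qs q1 (ltW e4) mp hcut).
  have h2 : cut_metric (step_graphon (N0 m) qs q1) (empirical R (G m)) <= 0 + e / 4.
    apply: (cut_metric_empirical (N0 m) _ (mcutW hm hG)).
    apply: L1norm_le_cst; first exact: bounded_measB (bounded_meas_step _) (bounded_meas_step _).
    by move=> z _; rewrite /= subrr normr0.
  apply: le_lt_trans (cut_metric_tri _ _ _) _; apply: le_lt_trans (lerD h1 h2) _.
  have -> : e / 4 + (0 + e / 4) = e / 2 by field.
  by rewrite gtr_pMr// invf_lt1// ltr1n.
rewrite /rate_J; case: asboolP => [_|[]]; last by exists g => //; exact: gsim.2.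
apply: ge_ereal_sup => _ [eta /= eta0 <-].
have [m [phi [_ mp _ hcut]]] := hg _ eta0 0%N.
have [[qs q1 dom] [hI _ _]] := hq m.
apply: ge_ereal_inf; exists (rate_I W0 (step_graphon (N0 m) qs q1)); last first.
  rewrite (rate_I_step k0 (n0 m) W0p (q := q m))//; by rewrite lee_fin.
exists (step_graphon (N0 m) qs q1) => //=.
apply: le_trans (cut_metric_tri _ g _) _; rewrite gsim.2 add0r.
exact: (cut_metric_step_graphon (N0 m) qs q1 (ltW eta0) mp hcut).
Qed.

End upper_bound.

Unset Implicit Arguments.

Theorem theorem1p11 (R : realType) (k : nat) (W0 : graphon R)
    (hk : (0 < k)%N) (hW0 : uniform_block_graphon k W0) :
  (forall U : set (graphon_class R), open U ->
     (- ereal_inf [set rate_J W0 h | h in U] <=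
      limn_einf (fun n => (((k * n.+1)%:R ^+ 2)^-1)%:E
                          * lne (class_law W0 (k * n.+1) U)))%E) /\
  (forall F : set (graphon_class R), closed F ->
     (limn_esup (fun n => (((k * n.+1)%:R ^+ 2)^-1)%:E
                          * lne (class_law W0 (k * n.+1) F)) <=
      - ereal_inf [set rate_J W0 h | h in F])%E).
Proof.
have [p [psym p01 W0p]] := hW0.
split=> [U oU|F cF].
  rewrite leeNl; apply: le_ereal_inf_tmp => _ [C UC <-]; rewrite leNgt; apply/negP.
  move=> /ereal_between[c Jc cL].
  have [M hM] := ldp_lower hk p01 psym W0p oU UC Jc.
  have := limn_einf_ge hM; rewrite EFinN leeNl leNgt.
  by rewrite cL.
rewrite leNgt; apply/negP => /ereal_between[b hb bL].
have [b' hb' bb'] := ereal_between hb.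
have hF M : exists2 n, (M <= n)%N &
    ((- - b)%:E < (((k * n.+1)%:R ^+ 2)^-1)%:E * lne (class_law W0 (k * n.+1) F))%E.
  apply: contrapT => nex; move: bL; apply/negP; rewrite -leNgt.
  apply: (@limn_esup_le _ _ _ M) => n Mn; rewrite leNgt; apply/negP => h.
  by apply: nex; exists n => //; rewrite opprK.
have bb : - b < - b' by rewrite ltrN2 -lte_fin.
have [C FC JC] := ldp_upper hk p01 psym W0p cF bb hF.
move: hb'; apply/negP; rewrite -leNgt leeNr -EFinN.
by apply: ge_ereal_inf; exists (rate_J W0 C) => //; exists C.
Qed.
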